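(* Let $M$ be an expansion $0\to A^*\xrightarrow{\iota}B\xrightarrow{\nu}C^*\to0$ of a pure short exact sequence of Abelian structures expanded by $\Phi$, with $\Phi$ a fundamental system for $B$ (see context). Let $\Gamma\subseteq\Delta\subseteq M^{eq}$ with $\Gamma=\mathrm{dcl}^{eq}(\Gamma)$, $\Delta=\mathrm{dcl}^{eq}(\Delta)$, where $M$ is $|\Delta|^+$-saturated and strongly $|\Delta|^+$-homogeneous, and let $u$ be a finite tuple of $M$. Assume: (H1) for every $\phi\in\Phi$, each coset in $C/\phi(C)$ belonging to $\mathrm{acl}^{eq}(\Gamma)$ belongs to $\Gamma$; (H2) $\Delta=\mathrm{dcl}^{eq}(A^*(\Delta)\cup B(\Delta)\cup C^*(\Delta))$. Let $p_0$ be the partial type over $\Gamma$ associated with $u$ defined in the context. Let $S_{\mathbf d}^\Delta$ be the Stone space of all complete types over $\Delta$ (in the variables of $u$) which extend $p_0$ and do not divide over $\Gamma$. Let $\mathcal{A}_{\mathbf d}^\Delta$ (resp. $\mathcal{C}_{\mathbf d}^\Delta$) be the space of $A$-types $\mathrm{tp}_A(v/\Delta)$ (resp. $C$-types $\mathrm{tp}_C(v/\Delta)$) of realizations $v$ of $p_0$ such that $\mathrm{tp}(v/\Delta)$ does not divide over $\Gamma$. Then $S_{\mathbf d}^\Delta$ is naturally homeomorphic, via $\mathrm{tp}(v/\Delta)\mapsto(\mathrm{tp}_A(v/\Delta),\mathrm{tp}_C(v/\Delta))$, to $\mathcal{A}_{\mathbf d}^\Delta\times\mathcal{C}_{\mathbf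 d}^\Delta$.
   Context: Fix a multi-sorted language $\mathcal{L}$. p.p.-formulas are the formulas in the closure of parameter-free atomic formulas under finite conjunction and existential quantification. An Abelian structure is an $\mathcal{L}$-structure such that each sort expands an Abelian group, each parameter-free term is a group homomorphism, and each p.p.-formula $\phi(x_{s_1},\dots,x_{s_n})$ defines a subgroup of the product of the corresponding sorts. For an Abelian structure $A$, $A/\phi(A)$ denotes the quotient of that product by $\phi(A)$. A fundamental system for $B$ is a set $\Phi$ of p.p.-formulas such that, modulo the theory of $B$, every p.p.-formula is equivalent to a finite conjunction of formulas $\phi(t(x))$ with $\phi\in\Phi$ and $t$ a tuple of parameter-free terms. An embedding $\iota:A\to B$ is pure if $\iota^{-1}(\phi(B))=\phi(A)$ for every p.p.-formula $\phi$. A pure short exact sequence expanded by $\Phi$ consists of Abelian structures $A,B,C$ on disjoint copies of $\mathcal{L}$, a pure embedding $\iota:A\to B$, a surjective morphism $\nu:B\to C$ with $\mathrm{Im}(\iota)=\mathrm{Ker}(\nu)$ on each sort and $\nu^{-1}(\phi(C))=\phi(B)+\iota(A)$ for all p.p. $\phi$, and for each $\phi\in\Phi$ the sort $A/\phi(A)$, the quotient map $\pi_\phi:A\to A/\phi(A)$, and the map $\rho_\phi:B\to A/\phi(A)$ which is $0$ outside $\phi(B)+\iota(A)$ and on $\phi(B)+\iota(A)$ is the homomorphism $\phi(B)+\iota(A)\to(\phi(B)+\iota(A))/\phi(B)\simeq A/\phi(A)$. $A^*$ is an arbitrary expansion of $A$ together with the sorts $A/\phi(A)$ and maps $\pi_\phi$,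 in a language $\mathcal{L}_A$; $C^*$ is an arbitrary expansion of $C$, in a language $\mathcal{L}_C$; $\mathcal{L}_B$ is the language of $B$. $M$ is the resulting expansion of the sequence. For $D\subseteq M^{eq}$, $A^*(D),B(D),C^*(D)$ are the sets of elements of $D$ in the sorts of $A^*,B,C^*$. A tuple $u$ is written $u_Au_Bu_C$ according to sorts, and similarly for variables. A $C$-formula over $D$ is a formula $\psi_C(\nu(x_B),x_C,\gamma)$ with $\psi_C\in\mathcal{L}_C$ parameter-free, $\gamma\in C^*(D)$; an $A$-formula over $D$ is a formula $\psi_A(\alpha,x_A,(\rho_{\phi_i}(t_i(x_B)-\beta_i))_i)$ with $\psi_A\in\mathcal{L}_A$ parameter-free, finitely many $\phi_i\in\Phi$, $t_i$ (tuples of) parameter-free $\mathcal{L}_B$-terms, $\alpha\in A^*(D)$, $\beta_i\in B(D)$. $\mathrm{tp}_A(u/D)$ (resp. $\mathrm{tp}_C(u/D)$) is the set of $A$-formulas (resp. $C$-formulas) over $D$ satisfied by $u$; spaces of such types carry the topology generated by $A$-formulas (resp. $C$-formulas). Let $\mathcal{T}$ be the set of (tuples of) parameter-free $\mathcal{L}_B$-terms, $E_0^+=\{(\phi,t)\in\Phi\times\mathcal{T}:\nu(t(u_B))+\phi(C)\in\Gamma\}$ (the coset viewed as an element of the sort $C/\phi(C)$ of $M^{eq}$), $E_0^-=(\Phi\times\mathcal{T})\smallsetminus E_0^+$, and $$p_0(x_A,x_B,x_C)=\{\nu(t(x_B-u_B))\in\phi(C):(\phi,t)\in E_0^+\}\cup\{\nu(t(x_B))+\phi(C)\ne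 X:(\phi,t)\in E_0^-,\ X\in (C/\phi(C))(\Gamma)\},$$ which is equivalent to a partial type over $\Gamma$, realized by $u$. A formula divides over $\Gamma$ if for some $\Gamma$-indiscernible sequence of conjugates of its parameters, starting with the original, the corresponding formulas are jointly inconsistent; a type divides over $\Gamma$ if it implies a formula that does. *)

(* Defs.v *)
From HB Require Import structures.
From mathcomp Require Import all_boot all_order all_algebra.
From mathcomp Require Import boolp classical_sets functions cardinality filter topology.

Set Implicit Arguments.
Unset Strict Implicit.
Unset Printing Implicit Defensive.

Import GRing.Theory.
Local Open Scope classical_set_scope.

(* A context is a possibly infinite family of sorted variables; an arity is a
   finite one.  Formulas over an infinite context have finitely many free
   variables, so parameters from a set are treated as extra variables. *)
Record ctx (S : Type) := Ctx { var : Type; vsort : var -> S }.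
Record arity (S : Type) := Arity { alen : nat; asort : 'I_alen -> S }.
Definition ctx_of_arity S (a : arity S) : ctx S := Ctx (@asort S a).
Coercion ctx_of_arity : arity >-> ctx.

Definition cmap S T (f : S -> T) (c : ctx S) : ctx T :=
  Ctx (fun v : var c => f (vsort v)).
Definition amap S T (f : S -> T) (a : arity S) : arity T :=
  Arity (fun i : 'I_(alen a) => f (asort i)).
Definition csum S (c d : ctx S) : ctx S :=
  Ctx (fun v : var c + var d =>
         match v with inl x => vsort x | inr y => vsort y end).
Definition cext S (c : ctx S) (s : S) : ctx S :=
  Ctx (fun o : option (var c) => match o with Some v => vsort v | None => s end).
Definition ctx1 S (s : S) : ctx S := Ctx (fun _ : unit => s).

Definition asg S (D : S -> Type) (c : ctx S) := forall v : var c, D (vsort v).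
Definition xsum S (D : S -> Type) (c d : ctx S) (x : asg D c) (y : asg D d) :
    asg D (csum c d) :=
  fun v => match v with inl i => x i | inr j => y j end.
Definition xext S (D : S -> Type) (c : ctx S) (s : S) (x : asg D c) (y : D s) :
    asg D (cext c s) :=
  fun o => match o with Some v => x v | None => y end.
Definition xone S (D : S -> Type) (s : S) (y : D s) : asg D (ctx1 s) := fun _ => y.

Record language := Language {
  srt : Type;
  fsym : Type; fdom : fsym -> arity srt; fcod : fsym -> srt;
  rsym : Type; rdom : rsym -> arity srt }.

Inductive term (L : language) (c : ctx (srt L)) : srt L -> Type :=
| Var (v : var c) : term c (vsort v)
| App (f : fsym L) (ts : forall i : 'I_(alen (fdom f)), term c (asort i)) :
    term c (fcod f).

Inductive formula (L : language) (c : ctx (srt L)) : Type :=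
| Top
| Eq (s : srt L) (t1 t2 : term c s)
| Rel (r : rsym L) (ts : forall i : 'I_(alen (rdom r)), term c (asort i))
| And (p q : formula c)
| Not (p : formula c)
| Ex (s : srt L) (p : formula (cext c s)).

Arguments Var {L c} v.
Arguments App {L c} f ts.
Arguments Top {L c}.

Definition terms (L : language) (c : ctx (srt L)) (a : arity (srt L)) :=
  asg (@term L c) a.

Record str (L : language) := Str {
  dom : srt L -> Type;
  fint : forall f : fsym L, asg dom (fdom f) -> dom (fcod f);
  rint : forall r : rsym L, asg dom (rdom r) -> Prop }.

Section Semantics.
Variables (L : language) (N : str L).

Fixpoint eval (c : ctx (srt L)) (x : asg (dom N) c) (s : srt L) (t : term c s) :
    dom N s :=
  match t with
  | Var v => x v
  | App f ts => @fint L N f (fun i => eval x (ts i))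
  end.

Fixpoint sat (c : ctx (srt L)) (p : formula c) : asg (dom N) c -> Prop :=
  match p with
  | Top => fun _ => True
  | Eq s t1 t2 => fun x => eval x t1 = eval x t2
  | Rel r ts => fun x => @rint L N r (fun i => eval x (ts i))
  | And p q => fun x => sat p x /\ sat q x
  | Not p => fun x => ~ sat p x
  | Ex s p => fun x => exists y : dom N s, sat p (xext x y)
  end.

Definition evals (c : ctx (srt L)) (a : arity (srt L)) (t : terms c a)
    (x : asg (dom N) c) : asg (dom N) a :=
  fun i => eval x (t i).

Definition elt := {s : srt L & dom N s}.
Definition mkelt (s : srt L) (y : dom N s) : elt := existT _ s y.

Definition params (D : set elt) : ctx (srt L) :=
  Ctx (fun e : {e : elt | D e} => projT1 (sval e)).
Definition pval (D : set elt) : asg (dom N) (params D) :=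
  fun e => projT2 (sval e).

Definition formula_over (D : set elt) (c : ctx (srt L)) :=
  formula (csum c (params D)).
Definition sat_over (D : set elt) (c : ctx (srt L)) (p : formula_over D c) :
    set (asg (dom N) c) :=
  [set x | sat p (xsum x (@pval D))].

Definition dcl (D : set elt) : set elt :=
  [set e | exists p : formula_over D (ctx1 (projT1 e)),
      [set y | sat_over p (xone y)] = [set projT2 e]].
Definition acl (D : set elt) : set elt :=
  [set e | exists p : formula_over D (ctx1 (projT1 e)),
      finite_set [set y | sat_over p (xone y)] /\ sat_over p (xone (projT2 e))].

Definition finitely_satisfiable (c : ctx (srt L)) (I : Type)
    (F : I -> set (asg (dom N) c)) :=
  forall (k : nat) (g : 'I_k -> I), exists x, forall j, F (g j) x.

Definition consistent (D : set elt) (c : ctx (srt L)) (q : set (formula_over D c)) :=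
  finitely_satisfiable (fun p : {p | q p} => sat_over (sval p)).
Definition complete_type (D : set elt) (c : ctx (srt L))
    (q : set (formula_over D c)) :=
  consistent q /\ forall p, q p \/ q (Not p).

Definition tp (D : set elt) (c : ctx (srt L)) (x : asg (dom N) c) :
    set (formula_over D c) :=
  [set p | sat_over p x].
Definition realizes (D : set elt) (c : ctx (srt L)) (q : set (formula_over D c))
    (x : asg (dom N) c) :=
  forall p, q p -> sat_over p x.

Definition automorphism (h : forall s, dom N s -> dom N s) :=
  [/\ forall s, bijective (h s),
      forall f (x : asg (dom N) (fdom f)),
        h _ (@fint L N f x) = @fint L N f (fun i => h _ (x i))
    & forall r (x : asg (dom N) (rdom r)),
        @rint L N r x <-> @rint L N r (fun i => h _ (x i))].

(* |K|^+-saturation: types over parameter sets of size < |K|^+ *)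
Definition saturated_above (T : Type) (K : set T) :=
  forall (X : set elt), (X #<= K)%card ->
  forall (s : srt L) (q : set (formula_over X (ctx1 s))),
    consistent q -> exists y : dom N s, realizes q (xone y).

Definition elementary_on (X : set elt) (f : forall s, dom N s -> dom N s) :=
  forall p : formula (params X),
    sat p (@pval X) <-> sat p (fun e => f _ (@pval X e)).

Definition strongly_homogeneous_above (T : Type) (K : set T) :=
  forall (X : set elt), (X #<= K)%card ->
  forall f : forall s, dom N s -> dom N s, elementary_on X f ->
    exists h, automorphism h /\
      forall s (y : dom N s), X (mkelt y) -> h s y = f s y.

Definition conjugate (D : set elt) (c : ctx (srt L)) (x y : asg (dom N) c) :=
  exists h, [/\ automorphism h,
                forall e, D e -> h _ (projT2 e) = projT2 e
              & y = fun v => h _ (x v)].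

Definition indiscernible (D : set elt) (c : ctx (srt L))
    (d : nat -> asg (dom N) c) :=
  forall (k : nat) (f g : 'I_k -> nat),
    (forall i j : 'I_k, i < j -> f i < f j)%N ->
    (forall i j : 'I_k, i < j -> g i < g j)%N ->
  forall p : formula_over D (Ctx (fun v : 'I_k * var c => vsort v.2)),
    sat_over p (fun v => d (f v.1) v.2) <-> sat_over p (fun v => d (g v.1) v.2).

(* p(x, d) divides over D *)
Definition formula_divides (D : set elt) (c : ctx (srt L)) (a : arity (srt L))
    (p : formula (csum c a)) (d : asg (dom N) a) :=
  exists e : nat -> asg (dom N) a,
    [/\ e 0%N = d, forall n, conjugate D d (e n), indiscernible D e
      & ~ finitely_satisfiable (fun n x => sat p (xsum x (e n)))].

Definition type_implies (D : set elt) (c : ctx (srt L)) (q : set (formula_over D c))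
    (P : set (asg (dom N) c)) :=
  exists (k : nat) (g : 'I_k -> formula_over D c),
    (forall j, q (g j)) /\ forall x, (forall j, sat_over (g j) x) -> P x.

Definition type_divides (D0 D : set elt) (c : ctx (srt L))
    (q : set (formula_over D c)) :=
  exists (a : arity (srt L)) (p : formula (csum c a)) (d : asg (dom N) a),
    type_implies q [set x | sat p (xsum x d)] /\ formula_divides D0 p d.

End Semantics.

(* An expansion may add sorts as well as function and relation symbols. *)
Record expansion (L : language) := Expansion {
  xsort : Type;
  xfun : Type; xdom : xfun -> arity (srt L + xsort); xcod : xfun -> srt L + xsort;
  xrel : Type; xrdom : xrel -> arity (srt L + xsort) }.

Definition expand (L : language) (X : expansion L) : language :=
  @Language (srt L + xsort X)
    (fsym L + xfun X)
    (fun f => match f with inl f => amap inl (fdom f) | inr f => xdom f end)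
    (fun f => match f with inl f => inl (fcod f) | inr f => xcod f end)
    (rsym L + xrel X)
    (fun r => match r with inl r => amap inl (rdom r) | inr r => xrdom r end).

Definition sum_dom S T (D : S -> Type) (E : T -> Type) (s : S + T) : Type :=
  match s with inl s => D s | inr t => E t end.

Record exp_str (L : language) (N : str L) (X : expansion L) := ExpStr {
  xcar : xsort X -> Type;
  xfint : forall f : xfun X,
    asg (sum_dom (dom N) xcar) (xdom f) -> sum_dom (dom N) xcar (xcod f);
  xrint : forall r : xrel X, asg (sum_dom (dom N) xcar) (xrdom r) -> Prop }.

Definition expand_str (L : language) (N : str L) (X : expansion L)
    (Y : exp_str N X) : str (expand X) :=
  @Str (expand X) (sum_dom (dom N) (xcar Y))
    (fun f => match f return
         asg (sum_dom (dom N) (xcar Y)) (@fdom (expand X) f) ->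
         sum_dom (dom N) (xcar Y) (@fcod (expand X) f) with
       | inl f => @fint L N f | inr f => @xfint L N X Y f end)
    (fun r => match r return
         asg (sum_dom (dom N) (xcar Y)) (@rdom (expand X) r) -> Prop with
       | inl r => @rint L N r | inr r => @xrint L N X Y r end).

Definition quot_exp (L : language) (I : Type) (a : I -> arity (srt L)) : expansion L :=
  @Expansion L I I (fun i => amap inl (a i)) (fun i => inr i)
    void (fun v => match v with end).

Definition quot_str (L : language) (N : str L) (I : Type) (a : I -> arity (srt L))
    (E : forall i, asg (dom N) (a i) -> set (asg (dom N) (a i))) :
    exp_str N (quot_exp a) :=
  @ExpStr L N (quot_exp a)
    (fun i => {X : set (asg (dom N) (a i)) | exists x, X = E i x})
    (fun i (x : asg (dom N) (a i)) => exist _ (E i x) (ex_intro _ x erefl))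
    (fun v => match v with end).

Definition is_equivalence (T : Type) (R : T -> T -> Prop) :=
  [/\ forall x, R x x, forall x y, R x y -> R y x
    & forall x y z, R x y -> R y z -> R x z].

Record imaginary (L : language) (N : str L) := Imaginary {
  im_ar : arity (srt L);
  im_fm : formula (csum im_ar im_ar);
  im_equiv : is_equivalence (fun x y : asg (dom N) im_ar => sat im_fm (xsum x y)) }.

Definition eq_lang (L : language) (N : str L) : language :=
  expand (quot_exp (@im_ar L N)).
Definition eq_str (L : language) (N : str L) : str (eq_lang N) :=
  expand_str (@quot_str L N _ (@im_ar L N)
                (fun i x => [set y | sat (im_fm i) (xsum x y)])).

Definition tadd S (D : S -> zmodType) (c : ctx S) (x y : asg D c) : asg D c :=
  fun v => (x v + y v)%R.
Definition tsub S (D : S -> zmodType) (c : ctx S) (x y : asg D c) : asg D c :=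
  fun v => (x v - y v)%R.
Definition tzero S (D : S -> zmodType) (c : ctx S) : asg D c := fun v => 0%R.

(* L0 lists the symbols besides those of the group structure on each sort. *)
Inductive ab_fsym (L0 : language) : Type :=
| Zero (s : srt L0) | Opp (s : srt L0) | Add (s : srt L0) | Fun (f : fsym L0).
Definition ab_lang (L0 : language) : language :=
  @Language (srt L0) (ab_fsym L0)
    (fun f => match f with
       | Zero s => Arity (fun _ : 'I_0 => s)
       | Opp s => Arity (fun _ : 'I_1 => s)
       | Add s => Arity (fun _ : 'I_2 => s)
       | Fun f => fdom f end)
    (fun f => match f with
       | Zero s | Opp s | Add s => s
       | Fun f => fcod f end)
    (rsym L0) (@rdom L0).

Record grp_str (L0 : language) := GrpStr {
  car : srt L0 -> zmodType;
  cfun : forall f : fsym L0, asg car (fdom f) -> car (fcod f);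
  crel : forall r : rsym L0, asg car (rdom r) -> Prop }.

Definition str_of_grp (L0 : language) (G : grp_str L0) : str (ab_lang L0) :=
  @Str (ab_lang L0) (fun s => car G s)
    (fun f => match f return
         asg (fun s => car G s) (@fdom (ab_lang L0) f) ->
         car G (@fcod (ab_lang L0) f) with
       | Zero s => fun _ => 0%R
       | Opp s => fun x => (- x ord0)%R
       | Add s => fun x => (x ord0 + x ord_max)%R
       | Fun f => @cfun L0 G f end)
    (@crel L0 G).
Coercion str_of_grp : grp_str >-> str.

Fixpoint is_pp (L : language) (c : ctx (srt L)) (p : formula c) : bool :=
  match p with
  | Top | Eq _ _ _ | Rel _ _ => true
  | And p q => is_pp p && is_pp q
  | Not _ => false
  | Ex _ p => is_pp p
  end.

Record ppf (L : language) := PPF {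
  pp_ar : arity (srt L);
  pp_fm : formula pp_ar;
  pp_ok : is_pp pp_fm }.

Definition ppset (L : language) (N : str L) (p : ppf L) : set (asg (dom N) (pp_ar p)) :=
  [set x | sat (pp_fm p) x].
Arguments ppset {L} N p.

Record ab_str (L0 : language) := AbStr {
  ab_grp :> grp_str L0;
  ab_hom : forall (a : arity (srt L0)) (s : srt L0) (t : @term (ab_lang L0) a s)
      (x y : asg (car ab_grp) a),
    @eval _ ab_grp a (tadd x y) s t =
    (@eval _ ab_grp a x s t + @eval _ ab_grp a y s t)%R;
  ab_subgroup : forall p : ppf (ab_lang L0),
    ppset ab_grp p (@tzero _ (car ab_grp) (pp_ar p)) /\
    forall x y : asg (car ab_grp) (pp_ar p),
      ppset ab_grp p x -> ppset ab_grp p y -> ppset ab_grp p (tsub x y) }.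

Section Fundamental.
Variables (L : language) (Phi : set (ppf L)).

(* pairs (phi, t) standing for the formula phi(t(x)), x in the context c *)
Definition phi_term (c : ctx (srt L)) := {p : {p | Phi p} & terms c (pp_ar (sval p))}.

Definition fundamental_system (N : str L) :=
  forall p : ppf L, exists (k : nat) (g : 'I_k -> phi_term (pp_ar p)),
  forall x : asg (dom N) (pp_ar p),
    ppset N p x <->
    forall j, ppset N (sval (projT1 (g j))) (evals (projT2 (g j)) x).
End Fundamental.

(* A homomorphism of L-structures; on Abelian structures it preserves 0, - and +
   since these are symbols of [ab_lang]. *)
Definition morphism (L : language) (N1 N2 : str L) (h : forall s, dom N1 s -> dom N2 s) :=
  (forall f (x : asg (dom N1) (fdom f)),
     h _ (@fint L N1 f x) = @fint L N2 f (fun i => h _ (x i))) /\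
  (forall r (x : asg (dom N1) (rdom r)),
     @rint L N1 r x -> @rint L N2 r (fun i => h _ (x i))).
Definition embedding (L : language) (N1 N2 : str L) (h : forall s, dom N1 s -> dom N2 s) :=
  [/\ morphism h, forall s, injective (h s)
    & forall r (x : asg (dom N1) (rdom r)),
        @rint L N2 r (fun i => h _ (x i)) -> @rint L N1 r x].
Definition pure_embedding (L : language) (N1 N2 : str L)
    (h : forall s, dom N1 s -> dom N2 s) :=
  embedding h /\
  forall (p : ppf L) (x : asg (dom N1) (pp_ar p)),
    ppset N2 p (fun i => h _ (x i)) <-> ppset N1 p x.

Section PureSES.
Variables (L0 : language) (Phi : set (ppf (ab_lang L0))).
Notation L := (ab_lang L0).

Definition phi_ar (p : {p | Phi p}) : arity (srt L) := pp_ar (sval p).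

(* L with the sorts A/phi(A) and the maps pi_phi; the latter are the function
   symbols [inr phi] *)
Definition quot_lang : language := expand (quot_exp phi_ar).
Definition quot_ab (A : ab_str L0) : str quot_lang :=
  expand_str (@quot_str L A _ phi_ar
    (fun p (x : asg (car A) (phi_ar p)) =>
       [set y : asg (car A) (phi_ar p) | ppset A (sval p) (tsub x y)])).
Definition quot_sort (p : {p | Phi p}) : srt quot_lang := inr p.
Definition pi_phi (A : ab_str L0) (p : {p | Phi p}) (x : asg (car A) (phi_ar p)) :
    dom (quot_ab A) (quot_sort p) :=
  @fint quot_lang (quot_ab A) (inr p) x.

Variables A B C : ab_str L0.

Record pure_ses := PureSES {
  inc : forall s : srt L0, car A s -> car B s;
  prj : forall s : srt L0, car B s -> car C s;
  rho : forall p : {p | Phi p}, asg (car B) (phi_ar p) -> dom (quot_ab A) (quot_sort p);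
  inc_pure : @pure_embedding L A B inc;
  prj_morph : @morphism L B C prj;
  prj_surj : forall s (z : car C s), exists y, prj y = z;
  ses_exact : forall s (y : car B s), (exists x, y = inc x) <-> prj y = 0%R;
  prj_pp : forall (p : ppf L) (y : asg (car B) (pp_ar p)),
    ppset C p (fun i => prj (y i)) <->
    exists (b : asg (car B) (pp_ar p)) (x : asg (car A) (pp_ar p)),
      ppset B p b /\ y = tadd b (fun i => inc (x i));
  rho_in : forall (p : {p | Phi p}) (b : asg (car B) (phi_ar p))
      (x : asg (car A) (phi_ar p)),
    ppset B (sval p) b -> rho (tadd b (fun i => inc (x i))) = pi_phi x;
  rho_out : forall (p : {p | Phi p}) (y : asg (car B) (phi_ar p)),
    ~ (exists (b : asg (car B) (phi_ar p)) (x : asg (car A) (phi_ar p)),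
         ppset B (sval p) b /\ y = tadd b (fun i => inc (x i))) ->
    rho y = pi_phi (@tzero _ (car A) (phi_ar p)) }.

Variables (E : pure_ses).
Variables (XA : expansion quot_lang) (YA : exp_str (quot_ab A) XA).
Variables (XC : expansion L) (YC : exp_str C XC).

Definition LA : language := expand XA.
Definition LC : language := expand XC.
Definition Astar : str LA := expand_str YA.
Definition Cstar : str LC := expand_str YC.

(* SA, SB, SC tag the disjoint copies of the languages. *)
Inductive m_sort : Type := SA (s : srt LA) | SB (s : srt L) | SC (s : srt LC).
Inductive m_fsym : Type :=
| FA (f : fsym LA) | FB (f : fsym L) | FC (f : fsym LC)
| Finc (s : srt L) | Fprj (s : srt L) | Frho (p : {p | Phi p}).
Inductive m_rsym : Type := RA (r : rsym LA) | RB (r : rsym L) | RC (r : rsym LC).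

Definition A_sort (s : srt L) : srt LA := inl (inl s).
Definition Aquot_sort (p : {p | Phi p}) : srt LA := inl (quot_sort p).
Definition C_sort (s : srt L) : srt LC := inl s.

Definition LM : language :=
  @Language m_sort m_fsym
    (fun f => match f with
       | FA f => amap SA (fdom f)
       | FB f => amap SB (fdom f)
       | FC f => amap SC (fdom f)
       | Finc s => Arity (fun _ : 'I_1 => SA (A_sort s))
       | Fprj s => Arity (fun _ : 'I_1 => SB s)
       | Frho p => amap SB (phi_ar p) end)
    (fun f => match f with
       | FA f => SA (fcod f)
       | FB f => SB (fcod f)
       | FC f => SC (fcod f)
       | Finc s => SB s
       | Fprj s => SC (C_sort s)
       | Frho p => SA (Aquot_sort p) end)
    m_rsym
    (fun r => match r with
       | RA r => amap SA (rdom r)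
       | RB r => amap SB (rdom r)
       | RC r => amap SC (rdom r) end).

Definition m_dom (s : m_sort) : Type :=
  match s with SA s => dom Astar s | SB s => car B s | SC s => dom Cstar s end.

Definition M : str LM :=
  @Str LM m_dom
    (fun f => match f return
         asg m_dom (@fdom LM f) -> m_dom (@fcod LM f) with
       | FA f => @fint LA Astar f
       | FB f => @fint L B f
       | FC f => @fint LC Cstar f
       | Finc s => fun x => inc E (x ord0)
       | Fprj s => fun x => prj E (x ord0)
       | Frho p => @rho E p end)
    (fun r => match r return asg m_dom (@rdom LM r) -> Prop with
       | RA r => @rint LA Astar r
       | RB r => @rint L B r
       | RC r => @rint LC Cstar r end).

Definition Meq : str (eq_lang M) := eq_str M.

Definition A_elt (e : elt Astar) : elt Meq :=
  @mkelt _ Meq (inl (SA (projT1 e))) (projT2 e).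
Definition B_elt (e : elt B) : elt Meq :=
  @mkelt _ Meq (inl (SB (projT1 e))) (projT2 e).
Definition C_elt (e : elt Cstar) : elt Meq :=
  @mkelt _ Meq (inl (SC (projT1 e))) (projT2 e).
Definition A_part (D : set (elt Meq)) : set (elt Astar) := [set e | D (A_elt e)].
Definition B_part (D : set (elt Meq)) : set (elt B) := [set e | D (B_elt e)].
Definition C_part (D : set (elt Meq)) : set (elt Cstar) := [set e | D (C_elt e)].
Definition home (D : set (elt Meq)) : set (elt Meq) :=
  (A_elt @` A_part D) `|` (B_elt @` B_part D) `|` (C_elt @` C_part D).

Fixpoint wk (L' : language) (c : ctx (srt L')) (s' s : srt L') (t : term c s) :
    term (cext c s') s :=
  match t in term _ s return term (cext c s') s with
  | Var v => @Var L' (cext c s') (Some v)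
  | App f ts => App f (fun i => wk s' (ts i))
  end.

(* translation to the copy of L carried by C, with simultaneous substitution *)
Fixpoint tr_term (c : ctx (srt L)) (d : ctx (srt LM))
    (sub : forall v : var c, @term LM d (SC (C_sort (vsort v))))
    (s : srt L) (t : term c s) : @term LM d (SC (C_sort s)) :=
  match t in term _ s return @term LM d (SC (C_sort s)) with
  | Var v => sub v
  | App f ts => @App LM d (FC (inl f)) (fun i => tr_term sub (ts i))
  end.

Fixpoint tr (c : ctx (srt L)) (p : formula c) (d : ctx (srt LM))
    (sub : forall v : var c, @term LM d (SC (C_sort (vsort v)))) : @formula LM d :=
  match p with
  | Top => Top
  | Eq s t1 t2 => Eq (tr_term sub t1) (tr_term sub t2)
  | Rel r ts => @Rel LM d (RC (inl r)) (fun i => tr_term sub (ts i))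
  | And p q => And (tr p sub) (tr q sub)
  | Not p => Not (tr p sub)
  | Ex s p => @Ex LM d (SC (C_sort s))
      (tr p (fun o : option (var c) =>
         match o return @term LM (cext d (SC (C_sort s)))
             (SC (C_sort (@vsort _ (cext c s) o))) with
         | Some v => wk _ (sub v)
         | None => @Var LM (cext d (SC (C_sort s))) None end))
  end.

Lemma eval_wk (L' : language) (N : str L') (c : ctx (srt L')) (s' s : srt L')
    (t : term c s) (x : asg (dom N) c) (y : dom N s') :
  eval (xext x y) (wk s' t) = eval x t.
Proof.
elim: t => [v|f ts IH] //=; apply: (congr1 (@fint L' N f)).
by apply: functional_extensionality_dep => i; apply: IH.
Qed.

Lemma eval_tr (c : ctx (srt L)) (d : ctx (srt LM))
    (sub : forall v : var c, @term LM d (SC (C_sort (vsort v))))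
    (s : srt L) (t : term c s) (x : asg (dom M) d) :
  @eval _ M d x _ (tr_term sub t) =
  @eval _ C c (fun v => @eval _ M d x _ (sub v)) s t.
Proof.
elim: t => [v|f ts IH] //; apply: (congr1 (@fint L C f)).
by apply: functional_extensionality_dep => i; apply: IH.
Qed.

Lemma sat_tr (c : ctx (srt L)) (p : formula c) (d : ctx (srt LM))
    (sub : forall v : var c, @term LM d (SC (C_sort (vsort v)))) (x : asg (dom M) d) :
  @sat _ M d (tr p sub) x <->
  @sat _ C c p (fun v => @eval _ M d x _ (sub v)).
Proof.
elim: p d sub x => [{}c|{}c s t1 t2|{}c r ts|{}c p IHp q IHq|{}c p IHp|{}c s p IHp] d sub x //=.
- by rewrite !eval_tr.
- suff -> : (fun i => @eval _ M d x _ (tr_term sub (ts i))) =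
            (fun i => @eval _ C c (fun v => @eval _ M d x _ (sub v)) _ (ts i)) by [].
  by apply: functional_extensionality_dep => i; apply: eval_tr.
- by rewrite IHp IHq.
- by rewrite IHp.
- split=> -[y Hy]; exists y; move: Hy; rewrite IHp; congr (sat p _);
    apply: functional_extensionality_dep => -[v|] //=;
    by [rewrite eval_wk | rewrite (@eval_wk LM M)].
Qed.

Definition c_ar (p : ppf L) : arity (srt LM) := amap (fun s => SC (C_sort s)) (pp_ar p).

(* the LM-formula phi(x - y) on the sorts of C *)
Definition c_cong (p : ppf L) : @formula LM (csum (c_ar p) (c_ar p)) :=
  tr (pp_fm p) (fun i : 'I_(alen (pp_ar p)) =>
    @App LM (csum (c_ar p) (c_ar p)) (FC (inl (@Add L0 (asort i))))
      (fun j : 'I_2 => if j == ord0 then @Var LM (csum (c_ar p) (c_ar p)) (inl i)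
        else @App LM (csum (c_ar p) (c_ar p)) (FC (inl (@Opp L0 (asort i))))
               (fun _ : 'I_1 => @Var LM (csum (c_ar p) (c_ar p)) (inr i)))).

Lemma sat_c_cong (p : ppf L) (x y : asg (car C) (pp_ar p)) :
  @sat _ M (csum (c_ar p) (c_ar p)) (c_cong p)
    (@xsum _ m_dom (c_ar p) (c_ar p) x y) <-> ppset C p (tsub x y).
Proof. exact: sat_tr. Qed.

Lemma c_cong_equiv (p : ppf L) :
  is_equivalence (fun x y : asg (dom M) (c_ar p) => sat (c_cong p) (xsum x y)).
Proof.
have [H0 Hs] := @ab_subgroup L0 C p.
have E1 (x : asg (car C) (pp_ar p)) : tsub x x = @tzero _ (car C) (pp_ar p).
  by apply: functional_extensionality_dep => i; rewrite /tsub subrr.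
have sym (x y : asg (car C) (pp_ar p)) :
    ppset C p (tsub x y) -> ppset C p (tsub y x).
  move=> H; have := Hs _ _ H0 H; congr (ppset C p _).
  by apply: functional_extensionality_dep => i; rewrite /tsub sub0r opprB.
split=> [x|x y|x y z].
- by apply/(@sat_c_cong p x x); rewrite E1.
- by move/(@sat_c_cong p x y) => H; apply/(@sat_c_cong p y x); apply: sym.
- move=> /(@sat_c_cong p x y) H /(@sat_c_cong p y z) /sym H'.
  apply/(@sat_c_cong p x z); have := Hs _ _ H H'; congr (ppset C p _).
  by apply: functional_extensionality_dep => i; rewrite /tsub opprB addrA subrK.
Qed.

Definition c_imag (p : ppf L) : imaginary M := Imaginary (c_cong_equiv p).
Definition cquot_sort (p : ppf L) : srt (eq_lang M) := inr (c_imag p).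
(* z + phi(C) *)
Definition c_coset (p : ppf L) (z : asg (car C) (pp_ar p)) : dom Meq (cquot_sort p) :=
  @fint _ Meq (inr (c_imag p)) z.

Variables (a : arity (srt LA)) (b : arity (srt L)) (c : arity (srt LC)).

Definition uctx : ctx (srt LM) := csum (csum (amap SA a) (amap SB b)) (amap SC c).
Definition uctx_eq : ctx (srt (eq_lang M)) := cmap inl uctx.

Definition part_A (u : asg (dom M) uctx) : asg (dom Astar) a := fun i => u (inl (inl i)).
Definition part_B (u : asg (dom M) uctx) : asg (car B) b := fun i => u (inl (inr i)).
Definition part_C (u : asg (dom M) uctx) : asg (dom Cstar) c := fun i => u (inr i).

Definition prjs (d : arity (srt L)) (y : asg (car B) d) : asg (car C) d :=
  fun i => prj E (y i).

(* the terms rho_phi(t(x_B) - beta), beta in B(D) *)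
Record rho_term (D : set (elt Meq)) := RhoTerm {
  rt_phi : {p | Phi p};
  rt_term : @terms L b (phi_ar rt_phi);
  rt_beta : asg (car B) (phi_ar rt_phi);
  rt_beta_in : forall i, B_part D (@mkelt _ B _ (rt_beta i)) }.

Definition rho_ctx (D : set (elt Meq)) : ctx (srt LA) :=
  Ctx (fun r : rho_term D => Aquot_sort (rt_phi r)).
Definition rho_val (D : set (elt Meq)) (u : asg (dom M) uctx) :
    asg (dom Astar) (rho_ctx D) :=
  fun r : rho_term D =>
    @rho E (rt_phi r)
      (@tsub _ (car B) (phi_ar (rt_phi r))
         (@evals _ B b _ (@rt_term D r) (part_B u)) (@rt_beta D r)).

(* The variables of an L_A-formula are instantiated by parameters alpha in
   A^*(D), by x_A, and by the terms rho_phi(t(x_B) - beta). *)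
Definition A_formula (D : set (elt Meq)) :=
  @formula LA (csum (csum (params (A_part D)) a) (rho_ctx D)).
Definition A_sat (D : set (elt Meq)) (p : A_formula D) (u : asg (dom M) uctx) : Prop :=
  sat p (xsum (xsum (@pval _ Astar (A_part D)) (part_A u))
    (@rho_val D u)).

(* Likewise with gamma in C^*(D), x_C and nu(x_B). *)
Definition C_formula (D : set (elt Meq)) :=
  @formula LC (csum (csum (params (C_part D)) c) (amap C_sort b)).
Definition C_sat (D : set (elt Meq)) (p : C_formula D) (u : asg (dom M) uctx) : Prop :=
  sat p (xsum (xsum (@pval _ Cstar (C_part D)) (part_C u))
    (prjs (part_B u) : asg (dom Cstar) (amap C_sort b))).

Definition tp_A (D : set (elt Meq)) (u : asg (dom M) uctx) : set (A_formula D) :=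
  [set p | A_sat p u].
Definition tp_C (D : set (elt Meq)) (u : asg (dom M) uctx) : set (C_formula D) :=
  [set p | C_sat p u].
Definition tp_M (D : set (elt Meq)) (u : asg (dom M) uctx) :
    set (@formula_over _ Meq D uctx_eq) :=
  @tp _ Meq D uctx_eq u.

Arguments tp_A D u : clear implicits.
Arguments tp_C D u : clear implicits.
Arguments tp_M D u : clear implicits.

Definition E0_plus (G : set (elt Meq)) (u : asg (dom M) uctx) : set (phi_term Phi b) :=
  [set pt | G (@mkelt _ Meq _
     (@c_coset (sval (projT1 pt)) (prjs (@evals _ B b _ (projT2 pt) (part_B u)))))].

(* u is finite and v ranges over M: p0 G u is the set of realizations of the
   partial type. *)
Definition p0 (G : set (elt Meq)) (u v : asg (dom M) uctx) : Prop :=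
  (forall pt : phi_term Phi b, E0_plus G u pt ->
     ppset C (sval (projT1 pt))
       (prjs (@evals _ B b _ (projT2 pt) (tsub (part_B v) (part_B u))))) /\
  (forall pt : phi_term Phi b, ~ E0_plus G u pt ->
     forall X : dom Meq (cquot_sort (sval (projT1 pt))), G (@mkelt _ Meq _ X) ->
       @c_coset (sval (projT1 pt)) (prjs (@evals _ B b _ (projT2 pt) (part_B v))) <> X).

Definition nondividing_types (G D : set (elt Meq)) (u : asg (dom M) uctx) :
    set (set (@formula_over _ Meq D uctx_eq)) :=
  [set q | [/\ complete_type q,
               forall v, @realizes _ Meq D uctx_eq q v -> p0 G u v
             & ~ type_divides G q]].

Definition nondividing_A_types (G D : set (elt Meq)) (u : asg (dom M) uctx) :
    set (set (A_formula D)) :=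
  [set q | exists v, [/\ p0 G u v, ~ type_divides G (tp_M D v) & q = tp_A D v]].

Definition nondividing_C_types (G D : set (elt Meq)) (u : asg (dom M) uctx) :
    set (set (C_formula D)) :=
  [set q | exists v, [/\ p0 G u v, ~ type_divides G (tp_M D v) & q = tp_C D v]].

End PureSES.

Arguments tp_A {L0 Phi A B C E XA YA XC YC a b c} D u.
Arguments tp_C {L0 Phi A B C E XA YA XC YC a b c} D u.
Arguments tp_M {L0 Phi A B C E XA YA XC YC a b c} D u.
Arguments nondividing_types {L0 Phi A B C E XA YA XC YC a b c} G D u.
Arguments nondividing_A_types {L0 Phi A B C E XA YA XC YC a b c} G D u.
Arguments nondividing_C_types {L0 Phi A B C E XA YA XC YC a b c} G D u.

(* types in Q, with the topology generated by the sets {q | p \in q} *)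
Definition type_space (F : Type) (Q : set (set F)) : Type := {q : set F | Q q}.
Definition type_subbase (F : Type) (Q : set (set F)) : set (set (type_space Q)) :=
  [set O | exists p : F, O = [set q : type_space Q | sval q p]].

HB.instance Definition _ (F : Type) (Q : set (set F)) := gen_eqMixin (type_space Q).
HB.instance Definition _ (F : Type) (Q : set (set F)) := gen_choiceMixin (type_space Q).
HB.instance Definition _ (F : Type) (Q : set (set F)) :=
  isSubBaseTopological.Build (type_space Q) (@type_subbase F Q) id.

Definition homeomorphism (X Y : topologicalType) (f : X -> Y) :=
  continuous f /\ exists g : Y -> X, [/\ continuous g, cancel f g & cancel g f].

(* Main.v *)
(* Every formula of the expanded sequence is a Boolean combination of A- and
   C-formulas (relative quantifier elimination), so the map to the pair of types
   is injective and open onto its image.  For surjectivity let v and w realize p0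
   with nondividing types.  By (H1) a nondividing type enters no coset of C/phi(C)
   over Delta that is not over Gamma, so for each phi, t and beta the elements
   nu(t(v) - beta) and nu(t(w) - beta) lie in phi(C) simultaneously.  By purity
   and saturation there is x in A with t(v - w - iota(x)) in phi(B) whenever
   nu(t(v - w)) is in phi(C); then (v_A, w_B + iota(x), w_C) has the A-type of v
   and the C-type of w.  If its type divided along an indiscernible sequence, an
   A-formula and a C-formula would already be inconsistent along it; but each of
   them is consistent along the sequence, and two realizations can be merged by
   the same construction. *)

From mathcomp Require Import all_boot all_algebra.
From mathcomp Require Import finmap boolp classical_sets functions cardinality topology.
Require Import Defs.

Set Implicit Arguments.
Unset Strict Implicit.
Unset Printing Implicit Defensive.

Import GRing.Theory.
Local Open Scope classical_set_scope.

(** Since rho_phi is 0 outside phi(B) + iota(A), its value is informative only once it is known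
    whether nu of its argument lies in phi(C). The delicate steps therefore fix this pattern for the
    finitely many rho-terms in play. Under a fixed pattern a quantifier over B decouples into one
    over A and one over C. Against dividing, the pattern found over Delta is added to both formulas,
    since otherwise the two realizations obtained along the sequence could disagree on it and could
    not be merged. (H1) enters through acl: if the coset of beta is not algebraic over Gamma, there
    is an indiscernible sequence with pairwise distinct cosets, along which nu(t(x) - y) in phi(C)
    is 2-inconsistent. (H2) turns parameters from Delta into elements of the three sorts, which
    serve as further variables in the elimination. Dividing is defined with finite tuples, while
    merging moves all of Delta at once; Ramsey's theorem yields sequences enumerating Delta. The
    cardinal bounds need Delta infinite, which holds because dcl^eq contains infinitely many
    one-element imaginary sorts. *)

Notation funD := functional_extensionality_dep.

Lemma dep_choice (X : Type) (Y : X -> Type) (P : forall x, Y x -> Prop) :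
  (forall x, exists y, P x y) -> exists f, forall x, P x (f x).
Proof. by move=> H; exists (fun x => projT1 (cid (H x))) => x; case: cid. Qed.

(** * Assignments, substitution and supports of formulas *)

Section Assignments.
Variables (S : Type) (D : S -> Type).

Definition lpart (c d : ctx S) (z : asg D (csum c d)) : asg D c := fun v => z (inl v).
Definition rpart (c d : ctx S) (z : asg D (csum c d)) : asg D d := fun v => z (inr v).

Lemma xsum_parts (c d : ctx S) (z : asg D (csum c d)) : xsum (lpart z) (rpart z) = z.
Proof. by apply: funD => -[]. Qed.

(** The type of the value at [v] depends on [v], so [x' i] has to be transported along [tau i = v].
    Injectivity of [tau] and proof irrelevance make the result independent of [i] and of the
    equation. *)
Lemma extend_asg (c : ctx S) (I : Type) (tau : I -> var c)
    (x' : forall i, D (vsort (tau i))) (x0 : forall v, (forall i, tau i <> v) -> D (vsort v)) :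
  injective tau ->
  exists x : asg D c, (forall i, x (tau i) = x' i) /\
    (forall v (h : forall i, tau i <> v), x v = x0 v h).
Proof.
move=> tau_inj.
have H v : exists z : D (vsort v),
    (forall i (e : tau i = v), eq_rect _ (fun w => D (vsort w)) (x' i) _ e = z) /\
    (forall h : forall i, tau i <> v, z = x0 v h).
  have [[i e]|h] := pselect (exists i, tau i = v).
    exists (eq_rect _ (fun w => D (vsort w)) (x' i) _ e); split=> [j e'|h].
      have ji : j = i by apply: tau_inj; rewrite e'.
      by subst j; rewrite (Prop_irrelevance e' e).
    by case: (h i).
  have h' : forall i, tau i <> v by move=> i e; apply: h; exists i.
  exists (x0 v h'); split=> [i e|h'']; first by case: (h' i).
  by rewrite (Prop_irrelevance h' h'').
have [x Hx] := dep_choice H.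
exists x; split=> [i|v h]; last exact: (Hx v).2.
by rewrite -((Hx (tau i)).1 i erefl).
Qed.

Lemma extend_surj (c : ctx S) (I : Type) (tau : I -> var c)
    (x' : forall i, D (vsort (tau i))) :
  injective tau -> (forall v, exists i, tau i = v) ->
  exists x : asg D c, forall i, x (tau i) = x' i.
Proof.
move=> inj surj.
have no v : (forall i, tau i <> v) -> D (vsort v).
  by move=> h; exfalso; case: (surj v) => i /h.
by have [x [Hx _]] := extend_asg x' no inj; exists x.
Qed.
End Assignments.

(** * Simultaneous substitution in terms and formulas *)

Section Substitution.
Variable L : language.

Fixpoint term_subst (c : ctx (srt L)) (d : ctx (srt L))
    (sub : forall v : var c, term d (vsort v)) (s : srt L) (t : term c s) : term d s :=
  match t in term _ s return term d s with
  | Var v => sub v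
  | App f ts => App f (fun i => term_subst sub (ts i))
  end.

Definition sub_ext (c d : ctx (srt L)) (sub : forall v : var c, term d (vsort v))
    (s : srt L) (o : var (cext c s)) : term (cext d s) (vsort o) :=
  match o return term (cext d s) (@vsort _ (cext c s) o) with
  | Some v => wk s (sub v)
  | None => @Var L (cext d s) None
  end.

Fixpoint formula_subst (c : ctx (srt L)) (p : formula c) (d : ctx (srt L))
    (sub : forall v : var c, term d (vsort v)) : formula d :=
  match p with
  | Top => Top
  | Eq s t1 t2 => Eq (term_subst sub t1) (term_subst sub t2)
  | Rel r ts => @Rel L d r (fun i => term_subst sub (ts i))
  | And p q => And (formula_subst p sub) (formula_subst q sub)
  | Not p => Not (formula_subst p sub)
  | Ex s p => Ex (formula_subst p (sub_ext sub (s:=s)))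
  end.

Lemma is_pp_formula_subst (c : ctx (srt L)) (p : formula c) d
    (sub : forall v : var c, term d (vsort v)) : is_pp (formula_subst p sub) = is_pp p.
Proof.
by elim: p d sub => //= {}c p IHp q IHq d sub; rewrite IHp IHq.
Qed.

Variable N : str L.

Lemma eval_term_subst (c d : ctx (srt L)) (sub : forall v : var c, term d (vsort v))
    (s : srt L) (t : term c s) (x : asg (dom N) d) :
  eval x (term_subst sub t) = eval (fun v => eval x (sub v)) t.
Proof.
elim: t => [v|f ts IH] //=; congr (fint _).
by apply: funD => i; apply: IH.
Qed.

Lemma eval_sub_ext (c d : ctx (srt L)) (sub : forall v : var c, term d (vsort v))
    (s : srt L) (x : asg (dom N) d) (y : dom N s) :
  (fun o => eval (xext x y) (sub_ext sub (s:=s) o)) = xext (fun v => eval x (sub v)) y.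
Proof. by apply: funD => -[v|] //=; rewrite eval_wk. Qed.

Lemma sat_formula_subst (c : ctx (srt L)) (p : formula c) d
    (sub : forall v : var c, term d (vsort v)) (x : asg (dom N) d) :
  sat (formula_subst p sub) x <-> sat p (fun v => eval x (sub v)).
Proof.
elim: p d sub x => [{}c|{}c s t1 t2|{}c r ts|{}c p IHp q IHq|{}c p IHp|{}c s p IHp] d sub x //=.
- by rewrite !eval_term_subst.
- by have -> : (fun i => eval x (term_subst sub (ts i))) =
    (fun i => eval (fun v => eval x (sub v)) (ts i))
    by apply: funD => i; apply: eval_term_subst.
- by rewrite IHp IHq.
- by rewrite IHp.
- by split=> -[y Hy]; exists y; move: Hy; rewrite IHp eval_sub_ext.
Qed.

End Substitution.

Lemma eval_ext (L : language) (N : str L) (c : ctx (srt L)) (x y : asg (dom N) c) s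
  (t : term c s) : (forall v, x v = y v) -> eval x t = eval y t.
Proof. by move=> h; have -> : x = y by apply: funD. Qed.

Lemma sat_ext (L : language) (N : str L) (c : ctx (srt L)) (p : formula c)
  (x y : asg (dom N) c) : (forall v, x v = y v) -> sat p x <-> sat p y.
Proof. by move=> h; have -> : x = y by apply: funD. Qed.

(** * Reduction to finitely many variables *)

Section Support.
Variable L : language.

Definition subctx (c : ctx (srt L)) (S : set (var c)) : ctx (srt L) :=
  Ctx (fun v : {v | S v} => vsort (sval v)).

Definition restrict (D : srt L -> Type) (c : ctx (srt L)) (S : set (var c)) (x : asg D c) :
  asg D (subctx S) := fun v => x (sval v).

(** The quantification over all [S] containing the support lets the supports of several subterms be
    enlarged to a common one. The new term is chosen before the structure [N], so that it can be
    read in A, B and C alike. *)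
Lemma term_support (c : ctx (srt L)) s (t : term c s) :
  exists l : set (var c), finite_set l /\ forall S, l `<=` S ->
  exists t' : term (subctx S) s, forall (N : str L) (x : asg (dom N) c),
    eval x t = eval (restrict (S:=S) x) t'.
Proof.
elim: t => [v|f ts IH].
  exists [set v]; split=> [|S /(_ v erefl) Sv]; first exact: finite_set1.
  by exists (@Var L (subctx S) (exist _ v Sv)).
have [l Hl] := dep_choice IH.
exists (\bigcup_i l i); split=> [|S HS].
  by apply: bigcup_finite => // i _; case: (Hl i).
have H i : exists t' : term (subctx S) (asort i), forall (N : str L) (x : asg (dom N) c),
    eval x (ts i) = eval (restrict (S:=S) x) t'.
  by apply: (Hl i).2 => v lv; apply: HS; exists i.
have [ts' Hts'] := dep_choice H.
exists (App f ts') => N x /=; congr (fint _).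
by apply: funD => i; apply: Hts'.
Qed.

(* [None] is kept, since it is the variable bound by the quantifier *)
Definition lift_set (c : ctx (srt L)) (s : srt L) (S : set (var c)) : set (var (cext c s)) :=
  fun o => match o with Some v => S v | None => True end.

Definition lift_sub (c : ctx (srt L)) (s : srt L) (S : set (var c))
    (o : var (subctx (lift_set (s:=s) S))) : term (cext (subctx S) s) (vsort o) :=
  match o return term (cext (subctx S) s) (@vsort _ (subctx (lift_set (s:=s) S)) o) with
  | exist (Some v) h => @Var L (cext (subctx S) s) (Some (exist _ v h))
  | exist None _ => @Var L (cext (subctx S) s) None
  end.

(** Under a quantifier the support loses the bound variable, and [lift_sub] moves that variable back
    out of the restricted context. Being pp is tracked because the axioms on Abelian structures and
    pure sequences are about pp-formulas. *)
Lemma formula_support (c : ctx (srt L)) (p : formula c) :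
  exists l : set (var c), finite_set l /\ forall S, l `<=` S ->
  exists p' : formula (subctx S), is_pp p' = is_pp p /\
    forall (N : str L) (x : asg (dom N) c), sat p x <-> sat p' (restrict (S:=S) x).
Proof.
elim: p => [{}c|{}c s t1 t2|{}c r ts|{}c p [l1 [F1 H1]] q [l2 [F2 H2]]|{}c p [l [F H]]|{}c s p [l [F H]]].
- by exists set0; split=> // S _; exists Top.
- have [l1 [F1 H1]] := term_support t1; have [l2 [F2 H2]] := term_support t2.
  exists (l1 `|` l2); split=> [|S HS]; first by rewrite finite_setU.
  have [|t1' E1] := H1 S; first by move=> v lv; apply: HS; left.
  have [|t2' E2] := H2 S; first by move=> v lv; apply: HS; right.
  by exists (Eq t1' t2'); split=> // N x /=; rewrite E1 E2.
- have [l Hl] := dep_choice (fun i => term_support (ts i)).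
  exists (\bigcup_i l i); split=> [|S HS].
    by apply: bigcup_finite => // i _; case: (Hl i).
  have H i : exists t' : term (subctx S) (asort i), forall (N : str L) (x : asg (dom N) c),
      eval x (ts i) = eval (restrict (S:=S) x) t'.
    by apply: (Hl i).2 => v lv; apply: HS; exists i.
  have [ts' Hts'] := dep_choice H.
  exists (@Rel L (subctx S) r ts'); split=> // N x /=.
  by have -> : (fun i => eval x (ts i)) = (fun i => eval (restrict (S:=S) x) (ts' i))
    by apply: funD => i; apply: Hts'.
- exists (l1 `|` l2); split=> [|S HS]; first by rewrite finite_setU.
  have [|p' [P1 E1]] := H1 S; first by move=> v lv; apply: HS; left.
  have [|q' [P2 E2]] := H2 S; first by move=> v lv; apply: HS; right.
  by exists (And p' q'); split=> [|N x] /=; rewrite ?P1 ?P2 ?E1 ?E2.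
- by exists l; split=> // S /H [p' [P E]]; exists (Not p'); split=> // N x /=; rewrite E.
- exists (Some @^-1` l); split=> [|S HS].
    by apply: finite_preimage => // x y _ _ [].
  have [|p' [P E]] := H (lift_set S); first by move=> [v|] // lv; apply: HS.
  exists (Ex (formula_subst p' (@lift_sub c s S))); split=> [|N x]; first by rewrite /= is_pp_formula_subst.
  by split=> /= -[y Hy]; exists y; move: Hy; rewrite E sat_formula_subst;
  congr (sat _ _); by apply: funD => -[[v|] h].
Qed.

Lemma finite_set_enum (T : Type) (A : set T) : finite_set A ->
  exists n (tau : 'I_n -> T), injective tau /\ forall v, A v <-> exists i, tau i = v.
Proof.
move=> /finite_setP[n] /card_set_bijP [f [fA finj fsurj]].
have H (i : 'I_n) : exists v, A v /\ f v = i.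
  by have [v Av fv] := fsurj i (ltn_ord i); exists v.
have [tau Htau] := dep_choice H.
exists n, tau; split=> [i j e|v].
  by apply: val_inj; rewrite /= -(Htau i).2 -(Htau j).2 e.
split=> [Av|[i <-]]; last by case: (Htau i).
exists (Ordinal (fA _ Av)); apply: finj; rewrite ?inE //; first by case: (Htau (Ordinal (fA _ Av))).
by rewrite (Htau _).2.
Qed.

Definition enum_arity (c : ctx (srt L)) n (tau : 'I_n -> var c) : arity (srt L) :=
  Arity (fun i => vsort (tau i)).
Definition pick_vars (D : srt L -> Type) (c : ctx (srt L)) n (tau : 'I_n -> var c)
  (x : asg D c) : asg D (enum_arity tau) := fun i => x (tau i).
Arguments pick_vars {D c n} tau x v.

(** Purity, the subgroup axiom and fundamental systems are stated for formulas in an arity; this is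
    the bridge to formulas in an arbitrary, possibly infinite, context. *)
Lemma formula_arity (c : ctx (srt L)) (p : formula c) :
  exists n (tau : 'I_n -> var c), injective tau /\
  exists p' : formula (enum_arity tau), is_pp p' = is_pp p /\
    forall (N : str L) (x : asg (dom N) c), sat p x <-> sat p' (pick_vars tau x).
Proof.
have [l [Fl Hl]] := formula_support p.
have [n [tau [inj Htau]]] := finite_set_enum Fl.
exists n, tau; split=> //.
have [p' [P E]] := Hl l (@subset_refl _ l).
have sub (v : var (subctx l)) : exists t : term (enum_arity tau) (vsort v),
    forall (N : str L) (x : asg (dom N) c), eval (pick_vars tau x) t = x (sval v).
  case: v => v lv /=; have [i e] := (Htau v).1 lv; subst v.
  by exists (@Var L (enum_arity tau) i).
have [f Hf] := dep_choice sub.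
exists (formula_subst p' f); rewrite is_pp_formula_subst; split=> // N x.
rewrite E sat_formula_subst; apply: sat_ext => v; by rewrite Hf.
Qed.

Lemma formula_arity_left (c d : ctx (srt L)) (p : formula (csum c d)) :
  exists n (tau : 'I_n -> var c), injective tau /\
  exists p' : formula (csum (enum_arity tau) d),
    forall (N : str L) (x : asg (dom N) c) y, sat p (xsum x y) <-> sat p' (xsum (pick_vars tau x) y).
Proof.
have [l [Fl Hl]] := formula_support p.
have Fl' : finite_set (inl @^-1` l : set (var c)).
  by apply: finite_preimage => // x y _ _ [].
have [n [tau [inj Htau]]] := finite_set_enum Fl'.
exists n, tau; split=> //.
have [p' [P E]] := Hl l (@subset_refl _ l).
have sub (v : var (subctx l)) : exists t : term (csum (enum_arity tau) d) (vsort v),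
    forall (N : str L) (x : asg (dom N) c) y,
      eval (xsum (pick_vars tau x) y) t = xsum x y (sval v).
  case: v => -[v lv|v lv] /=; last by exists (@Var L (csum (enum_arity tau) d) (inr v)).
  have [i e] := (Htau v).1 lv; subst v.
  by exists (@Var L (csum (enum_arity tau) d) (inl i)).
have [f Hf] := dep_choice sub.
exists (formula_subst p' f) => N x y.
rewrite E sat_formula_subst; apply: sat_ext => v; by rewrite Hf.
Qed.

End Support.

Arguments pick_vars {L D c n} tau x v.

(** * Definable sets *)

Section Definable.
Variables (L : language) (N : str L).
Implicit Types c d : ctx (srt L).

(** Predicates are handled semantically, up to equivalence in the fixed structure, so that closure
    properties can be used instead of explicit syntax. *)
Definition definable c (P : asg (dom N) c -> Prop) :=
  exists p : formula c, forall x, sat p x <-> P x.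

Definition term_fun c s (g : asg (dom N) c -> dom N s) :=
  exists t : term c s, forall x, eval x t = g x.

Lemma term_fun_var c (v : var c) : term_fun (fun x => x v).
Proof. by exists (Var v). Qed.

Lemma term_fun_app c f (g : forall i : 'I_(alen (fdom f)), asg (dom N) c -> dom N (asort i)) :
  (forall i, term_fun (g i)) -> term_fun (fun x => @fint L N f (fun i => g i x)).
Proof.
move=> /dep_choice[t Ht]; exists (App f t) => x /=; congr (fint _).
by apply: funD => i; apply: Ht.
Qed.

Lemma term_fun_ext c s (g h : asg (dom N) c -> dom N s) :
  (forall x, g x = h x) -> term_fun g -> term_fun h.
Proof. by move=> E [t Ht]; exists t => x; rewrite Ht. Qed.

Lemma term_fun_comp c d s (g : forall v : var c, asg (dom N) d -> dom N (vsort v))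
    (h : asg (dom N) c -> dom N s) :
  (forall v, term_fun (g v)) -> term_fun h -> term_fun (fun x => h (fun v => g v x)).
Proof.
move=> /dep_choice[t Ht] [u Hu]; exists (term_subst t u) => x.
rewrite eval_term_subst Hu; congr h; by apply: funD => v; apply: Ht.
Qed.

Lemma definable_ext c (P Q : asg (dom N) c -> Prop) :
  (forall x, P x <-> Q x) -> definable P -> definable Q.
Proof. by move=> E [p Hp]; exists p => x; rewrite Hp. Qed.

Lemma definable_sat c (p : formula c) : definable (@sat L N c p).
Proof. by exists p. Qed.

Lemma definable_true c (P : Prop) : P -> definable (fun _ : asg (dom N) c => P).
Proof. by move=> h; exists Top. Qed.

Lemma definable_and c (P Q : asg (dom N) c -> Prop) :
  definable P -> definable Q -> definable (fun x => P x /\ Q x).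
Proof. by move=> [p Hp] [q Hq]; exists (And p q) => x /=; rewrite Hp Hq. Qed.

Lemma definable_not c (P : asg (dom N) c -> Prop) :
  definable P -> definable (fun x => ~ P x).
Proof. by move=> [p Hp]; exists (Not p) => x /=; rewrite Hp. Qed.

Lemma definable_cst c (P : Prop) : definable (fun _ : asg (dom N) c => P).
Proof.
have [h|h] := pselect P; first exact: definable_true.
apply: definable_ext (definable_not (@definable_true c True I)) => x; split=> // H.
Qed.

Lemma definable_or c (P Q : asg (dom N) c -> Prop) :
  definable P -> definable Q -> definable (fun x => P x \/ Q x).
Proof.
move=> /definable_not HP /definable_not HQ.
apply: definable_ext (definable_not (definable_and HP HQ)) => x.
by rewrite not_andE !notK.
Qed.

Lemma definable_imp c (P Q : asg (dom N) c -> Prop) :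
  definable P -> definable Q -> definable (fun x => P x -> Q x).
Proof.
move=> /definable_not HP HQ; apply: definable_ext (definable_or HP HQ) => x.
by rewrite implyE.
Qed.

Lemma definable_iff c (P Q : asg (dom N) c -> Prop) :
  definable P -> definable Q -> definable (fun x => P x <-> Q x).
Proof. by move=> HP HQ; apply: definable_and; apply: definable_imp. Qed.

Lemma definable_all c (k : nat) (P : 'I_k -> asg (dom N) c -> Prop) :
  (forall j, definable (P j)) -> definable (fun x => forall j, P j x).
Proof.
elim: k P => [|k IH] P HP.
  by apply: definable_ext (@definable_true c True I) => x; split=> // _ [].
apply: definable_ext (definable_and (HP ord0) (IH _ (fun j => HP (lift ord0 j)))) => x.
split=> [[H0 H] j|H]; last by split=> // j; apply: H.
by case: (unliftP ord0 j) => [i ->|->].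
Qed.

Lemma definable_allT c (I : finType) (P : I -> asg (dom N) c -> Prop) :
  (forall j, definable (P j)) -> definable (fun x => forall j, P j x).
Proof.
move=> H; apply: definable_ext (definable_all (fun j : 'I_#|I| => H (enum_val j))) => x.
by split=> HH j; [rewrite -(enum_rankK j)|].
Qed.

Lemma definable_ex c s (P : asg (dom N) (cext c s) -> Prop) :
  definable P -> definable (fun x => exists y, P (xext x y)).
Proof.
by move=> [p Hp]; exists (Ex p) => x /=; split=> -[y Hy]; exists y; apply/Hp.
Qed.

Lemma definable_comp c d (g : forall v : var c, asg (dom N) d -> dom N (vsort v))
    (P : asg (dom N) c -> Prop) :
  (forall v, term_fun (g v)) -> definable P -> definable (fun x => P (fun v => g v x)).
Proof.
move=> /dep_choice[t Ht] [p Hp]; exists (formula_subst p t) => x.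
rewrite sat_formula_subst -Hp; exact: sat_ext.
Qed.

Lemma definable_eq c s (g h : asg (dom N) c -> dom N s) :
  term_fun g -> term_fun h -> definable (fun x => g x = h x).
Proof. by move=> [t Ht] [u Hu]; exists (Eq t u) => x /=; rewrite Ht Hu. Qed.

Lemma definable_rel c r (g : forall i : 'I_(alen (rdom r)), asg (dom N) c -> dom N (asort i)) :
  (forall i, term_fun (g i)) -> definable (fun x => @rint L N r (fun i => g i x)).
Proof.
move=> /dep_choice[t Ht]; exists (@Rel L c r t) => x /=.
by have -> : (fun i => eval x (t i)) = (fun i => g i x) by apply: funD => i; apply: Ht.
Qed.

Lemma definable_parts c d (P : asg (dom N) (csum c d) -> Prop) :
  definable P <-> definable (fun z : asg (dom N) (csum c d) => P (xsum (lpart z) (rpart z))).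
Proof. by split; apply: definable_ext => z; rewrite xsum_parts. Qed.

Lemma term_fun_sym f : @term_fun (fdom f) (fcod f) (fun x => @fint L N f x).
Proof. by exists (App f (fun k => @Var L (fdom f) k)). Qed.

Lemma definable_sym r : @definable (rdom r) (fun x => @rint L N r x).
Proof. by exists (@Rel L (rdom r) r (fun k => @Var L (rdom r) k)). Qed.

End Definable.

(** * Classes of predicates closed under the logical operations *)

Definition projection (L : language) (N : str L) (d : ctx (srt L)) s
    (g : asg (dom N) d -> dom N s) :=
  exists (w : var d) (e : vsort w = s), forall x, g x = eq_rect _ (dom N) (x w) _ e.

Lemma projection_var (L : language) (N : str L) (d : ctx (srt L)) (w : var d) :
  @projection L N d (vsort w) (fun x => x w).
Proof. by exists w, erefl. Qed.

Lemma projectionP (L : language) (N : str L) (d : ctx (srt L))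
    (R : forall s, (asg (dom N) d -> dom N s) -> Prop) :
  (forall w, R (vsort w) (fun x => x w)) ->
  forall s g, projection g -> R s g.
Proof.
move=> H s g [w [e Hg]]; subst s.
by have -> : g = fun x => x w by apply: funext.
Qed.

Lemma projection_comp (L : language) (N : str L) (d d' : ctx (srt L))
    (h : forall w : var d, asg (dom N) d' -> dom N (vsort w)) s (g : asg (dom N) d -> dom N s) :
  (forall w, projection (h w)) -> projection g -> projection (fun x => g (fun w => h w x)).
Proof.
by move=> Hh; elim/projectionP: g / => w; apply: Hh.
Qed.

(** Only renamings of variables are allowed in [cc_comp], not substitution of terms: for the class
    [Qe] of relative quantifier elimination, stability under terms is what has to be proved. *)
Record closed_class (L : language) (N : str L)
    (Q : forall c : ctx (srt L), (asg (dom N) c -> Prop) -> Prop) := ClosedClass {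
  cc_ext : forall c P P', (forall x, P x <-> P' x) -> Q c P -> Q c P';
  cc_and : forall c P P', Q c P -> Q c P' -> Q c (fun x => P x /\ P' x);
  cc_ex : forall c s P, Q (cext c s) P -> Q c (fun x => exists y, P (xext x y));
  cc_true : forall c, Q c (fun=> True);
  cc_comp : forall (c d : ctx (srt L)) (P : asg (dom N) c -> Prop)
      (g : forall v : var c, asg (dom N) d -> dom N (vsort v)),
    (forall v, projection (g v)) ->
    Q c P -> Q d (fun x => P (fun v => g v x)) }.

Section Closed.
Variables (L : language) (N : str L).
Variable Q : forall c : ctx (srt L), (asg (dom N) c -> Prop) -> Prop.
Hypothesis HQ : closed_class Q.

(** Induction on the length of the arity: the first variable is handed to [cc_ex] and the others to
    the induction hypothesis. What remains is to see that regrouping the variables is a family of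
    projections. *)
Lemma closed_exs (e : arity (srt L)) (d : ctx (srt L)) (P : asg (dom N) e -> asg (dom N) d -> Prop) :
  Q (fun z : asg (dom N) (csum e d) => P (lpart z) (rpart z)) ->
  Q (fun y => exists x, P x y).
Proof.
case: e P => n; elim: n d => [|n IH] d s P HP.
  have x0 : asg (dom N) (Arity s) by case.
  have g (v : var (csum (Arity s) d)) : {g : asg (dom N) d -> dom N (vsort v) |
      projection g /\ forall y, g y = xsum x0 y v}.
    case: v => [[]//|v]; exists (fun y => y v); split=> //; exact: projection_var.
  apply: (cc_ext HQ) (cc_comp HQ (fun v => (svalP (g v)).1) HP) => y.
  rewrite (_ : (fun v => sval (g v) y) = xsum x0 y); last by apply: funD => v; apply: (svalP (g v)).2.
  split=> [H|[x]]; first by exists x0.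
  by rewrite (_ : x = x0) //; apply: funD => -[].
pose s' (i : 'I_n) := s (lift ord0 i).
have Hcomb (z : dom N (s ord0)) (x : asg (dom N) (Arity s')) :
    exists xx : asg (dom N) (Arity s), xx ord0 = z /\ forall i, xx (lift ord0 i) = x i.
  pose tau (o : option 'I_n) : var (Arity s) := if o is Some i then lift ord0 i else ord0.
  have [|v|xx Hxx] := @extend_surj _ (dom N) (Arity s) _ tau
    (fun o => match o return dom N (vsort (tau o)) with Some i => x i | None => z end).
  - by move=> [i|] [j|] //= e; rewrite (lift_inj e).
  - by case: (unliftP ord0 v) => [j ->|->]; [exists (Some j)|exists None].
  by exists xx; split=> [|i]; [apply: (Hxx None) | apply: (Hxx (Some i))].
have [comb Hc] := dep_choice (fun zx : dom N (s ord0) * asg (dom N) (Arity s') => Hcomb zx.1 zx.2).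
have comb_surj (xx : asg (dom N) (Arity s)) : xx = comb (xx ord0, fun i => xx (lift ord0 i)).
  apply: funD => i; case: (unliftP ord0 i) => [j ->|->]; first by rewrite (Hc _).2.
  by rewrite (Hc _).1.
suff HP' : Q (fun z : asg (dom N) (csum (Arity s') (cext d (s ord0))) =>
    P (comb (rpart z None, lpart z)) (fun v => rpart z (Some v))).
  have := cc_ex HQ (IH (cext d (s ord0)) s'
    (fun x y => P (comb (y None, x)) (fun v => y (Some v))) HP').
  apply: (cc_ext HQ) => y; split=> [[z [x Hx]]|[xx Hxx]].
    by exists (comb (z, x)); apply: Hx.
  exists (xx ord0); exists (fun i => xx (lift ord0 i)); move: Hxx; rewrite {1}(comb_surj xx).
  exact.
have g (v : var (csum (Arity s) d)) :
  {g : asg (dom N) (csum (Arity s') (cext d (s ord0))) -> dom N (vsort v) |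
    projection g /\ forall z, g z = xsum (comb (rpart z None, lpart z)) (fun v => rpart z (Some v)) v}.
  case: v => [i|v] /=; last first.
    exists (fun z => z (inr (Some v))); split=> //.
    exact: (@projection_var L N (csum (Arity s') (cext d (s ord0))) (inr (Some v))).
  have [o|e] := pselect (exists j, i = lift ord0 j); last first.
    have ei : i = ord0 by case: (unliftP ord0 i) => [j ej|//]; case: e; exists j.
    subst i; exists (fun z => z (inr None)); split=> [|z]; last by rewrite (Hc _).1.
    exact: (@projection_var L N (csum (Arity s') (cext d (s ord0))) (inr None)).
  case: (cid o) => j ej; subst i; exists (fun z => z (inl j)); split=> [|z]; last by rewrite (Hc _).2.
  exact: (@projection_var L N (csum (Arity s') (cext d (s ord0))) (inl j)).
apply: (cc_ext HQ) (cc_comp HQ (fun v => (svalP (g v)).1) HP) => z.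
rewrite (_ : (fun v => sval (g v) z) =
  xsum (comb (rpart z None, lpart z)) (fun v => rpart z (Some v))) //.
by apply: funD => v; apply: (svalP (g v)).2.
Qed.

Lemma closed_all (c : ctx (srt L)) (k : nat) (P : 'I_k -> asg (dom N) c -> Prop) :
  (forall j, Q (P j)) -> Q (fun x => forall j, P j x).
Proof.
elim: k P => [|k IH] P HP.
  by apply: (cc_ext HQ) (cc_true HQ c) => x; split=> // _ [].
apply: (cc_ext HQ) (cc_and HQ (HP ord0) (IH _ (fun j => HP (lift ord0 j)))) => x.
split=> [[H0 H] j|H]; last by split=> // j; apply: H.
by case: (unliftP ord0 j) => [i ->|->].
Qed.

(* Nested terms are unfolded into existential statements about graphs, so only
   the graphs of the function symbols are needed. *)
Hypothesis Qnot : forall c P, @Q c P -> Q (fun x => ~ P x).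
Hypothesis Qeq : forall s, Q (fun x : asg (dom N) (csum (ctx1 s) (ctx1 s)) =>
  x (inl tt) = x (inr tt) :> dom N s).
Hypothesis Qfun : forall f, Q (fun x : asg (dom N) (cext (fdom f) (fcod f)) =>
  @fint L N f (fun i => x (Some i)) = x None).
Hypothesis Qrel : forall r, Q (fun x : asg (dom N) (rdom r) => @rint L N r x).

Lemma closed_graph (c : ctx (srt L)) s (t : term c s) :
  Q (fun x : asg (dom N) (cext c s) => eval (fun v => x (Some v)) t = x None).
Proof.
elim: t => {s} [v|f ts IH] /=.
  pose g (w : var (csum (ctx1 (vsort v)) (ctx1 (vsort v)))) :=
    match w return asg (dom N) (cext c (vsort v)) -> dom N (@vsort _ (csum (ctx1 (vsort v)) (ctx1 (vsort v))) w) with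
    | inl _ => fun x => x (Some v) | inr _ => fun x => x None end.
  have Hg w : projection (g w).
    case: w => -[] /=.
      exact: (@projection_var L N (cext c (vsort v)) (Some v)).
    exact: (@projection_var L N (cext c (vsort v)) None).
  exact: (cc_comp HQ Hg (@Qeq (vsort v))).
pose e := fdom f; pose s := fcod f.
suff H : Q (fun z : asg (dom N) (csum e (cext c s)) =>
    (forall i, eval (fun v => rpart z (Some v)) (ts i) = lpart z i) /\
    @fint L N f (lpart z) = rpart z None).
  have K := @closed_exs e _ (fun (z : asg (dom N) e) (x : asg (dom N) (cext c s)) =>
    (forall i, eval (fun v => x (Some v)) (ts i) = z i) /\ @fint L N f z = x None) H.
  apply: (cc_ext HQ) K => x.
  split=> [[z [Hz <-]]|<-]; first by congr (fint _); apply: funD => i; apply: Hz.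
  by exists (fun i => eval (fun v => x (Some v)) (ts i)).
apply: (cc_and HQ).
  apply: closed_all => i.
  pose g (w : var (cext c (asort i))) : asg (dom N) (csum e (cext c s)) -> dom N (vsort w) :=
    match w return asg (dom N) (csum e (cext c s)) -> dom N (@vsort _ (cext c (asort i)) w) with
    | Some v => fun z => z (inr (Some v)) | None => fun z => z (inl i) end.
  have Hg w : projection (g w).
    case: w => [v|] /=.
      exact: (@projection_var L N (csum e (cext c s)) (inr (Some v))).
    exact: (@projection_var L N (csum e (cext c s)) (inl i)).
  exact: (cc_comp HQ Hg (IH i)).
pose g (w : var (cext e s)) : asg (dom N) (csum e (cext c s)) -> dom N (vsort w) :=
  match w return asg (dom N) (csum e (cext c s)) -> dom N (@vsort _ (cext e s) w) with
  | Some i => fun z => z (inl i) | None => fun z => z (inr None) end.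
have Hg w : projection (g w).
  case: w => [v|] /=.
    exact: (@projection_var L N (csum e (cext c s)) (inl v)).
  exact: (@projection_var L N (csum e (cext c s)) (inr None)).
exact: (cc_comp HQ Hg (@Qfun f)).
Qed.

Lemma closed_sat (c : ctx (srt L)) (p : formula c) : Q (@sat L N c p).
Proof.
elim: p => [{}c|{}c s t1 t2|{}c r ts|{}c p IHp q IHq|{}c p IHp|{}c s p IHp] /=.
- exact: (cc_true HQ).
- have := cc_ex HQ (cc_and HQ (closed_graph t1) (closed_graph t2)).
  by apply: (cc_ext HQ) => x /=; split=> [[y [<- <-]]|->] //; eexists.
- pose e := rdom r.
  suff H : Q (fun z : asg (dom N) (csum e c) =>
      (forall i, eval (rpart z) (ts i) = lpart z i) /\ @rint L N r (lpart z)).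
    have K := @closed_exs e _ (fun (z : asg (dom N) e) (x : asg (dom N) c) =>
      (forall i, eval x (ts i) = z i) /\ @rint L N r z) H.
    apply: (cc_ext HQ) K => x.
    split=> [[z [Hz]]|H']; first by rewrite (_ : (fun i => eval x (ts i)) = z) //; apply: funD => i; apply: Hz.
    by exists (fun i => eval x (ts i)).
  apply: (cc_and HQ).
    apply: closed_all => i.
    pose g (w : var (cext c (asort i))) : asg (dom N) (csum e c) -> dom N (vsort w) :=
      match w return asg (dom N) (csum e c) -> dom N (@vsort _ (cext c (asort i)) w) with
      | Some v => fun z => z (inr v) | None => fun z => z (inl i) end.
    have Hg w : projection (g w).
      case: w => [v|] /=.
        exact: (@projection_var L N (csum e c) (inr v)).
      exact: (@projection_var L N (csum e c) (inl i)).
    exact: (cc_comp HQ Hg (closed_graph (ts i))).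
  exact: (cc_comp HQ (fun v : var e => @projection_var L N (csum e c) (inl v)) (@Qrel r)).
- exact: (cc_and HQ).
- exact: Qnot.
- exact: (cc_ex HQ).
Qed.
End Closed.

Section DefinableEx.
Variables (L : language) (N : str L).
Implicit Types c d : ctx (srt L).

Lemma projection_term_fun d s (g : asg (dom N) d -> dom N s) : projection g -> term_fun g.
Proof. elim/projectionP: g / => w; exact: term_fun_var. Qed.

Lemma definable_closed : closed_class (@definable L N).
Proof.
split.
- exact: definable_ext.
- exact: definable_and.
- exact: definable_ex.
- by move=> c; exact: definable_true.
- move=> c d P g Hg; apply: definable_comp => v; exact: projection_term_fun.
Qed.

(** The tuple [x] may be infinite, but only the finitely many variables that occur are quantified;
    [x0] supplies values for all the others. *)
Lemma definable_exs c d (x0 : asg (dom N) c) (P : asg (dom N) c -> asg (dom N) d -> Prop) :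
  definable (fun z : asg (dom N) (csum c d) => P (lpart z) (rpart z)) ->
  definable (fun y => exists x, P x y).
Proof.
move=> [p Hp]; have [n [tau [inj [p' Hp']]]] := formula_arity_left p.
have := (definable_parts _).1 (@definable_sat _ N _ p').
move=> /(closed_exs definable_closed (P := fun x y => sat p' (xsum x y))).
apply: definable_ext => y; split=> [[x' Hx']|[x Hx]].
  have [x [Hx _]] := extend_asg (c := c) (tau := tau) x' (fun v _ => x0 v) inj.
  exists x; apply/(Hp (xsum x y)); apply/Hp'.
  by rewrite (_ : pick_vars tau x = x') //; apply: funD.
by exists (pick_vars tau x); apply/Hp'/Hp.
Qed.
End DefinableEx.

(** * Cardinalities *)

Section Small.
Variables (T : Type) (K : set T).

Definition small (I : Type) := exists f : I -> T, injective f /\ forall i, K (f i).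

Lemma small_inj (I J : Type) (f : I -> J) : injective f -> small J -> small I.
Proof.
by move=> fi [g [gi gK]]; exists (g \o f); split=> [|i /=]; [exact: inj_comp | exact: gK].
Qed.

Lemma small_sub : small {x | K x}.
Proof. by exists sval; split=> [|[]//]; exact: eq_sig_hprop. Qed.

Lemma card_le_small (J U : Type) (r : J -> U) (X : set U) :
  X `<=` range r -> small J -> (X #<= K)%card.
Proof.
move=> /subset_card_le XJ [f [fi fK]].
apply: card_le_trans XJ _; apply: card_le_trans (card_image_le _ _) _.
have /card_eqPle[_ H] : (range f #= [set: J])%card by apply: inj_card_eq => x y _ _; apply: fi.
by apply: card_le_trans H _; apply: subset_card_le => _ [j _ <-].
Qed.

Hypothesis Kinf : infinite_set K.

(* A maximal family of disjoint injective sequences covers [K] up to a finite set. *)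
Lemma small_nat_prod : small (nat * {x | K x}).
Proof.
pose T' := {x | K x}.
have T'inf : infinite_set [set: T'].
  move=> fin; apply: Kinf; have := finite_image sval fin; congr finite_set.
  by apply/seteqP; split=> [_ [[x Kx] _ <-]//|x Kx]; exists (exist _ x Kx).
suff [h hi] : exists h : nat * T' -> T', injective h by apply: small_inj hi small_sub.
pose P (F : set (nat -> T')) := (forall f, F f -> injective f) /\
  (forall f g, F f -> F g -> forall n m, f n = g m -> f = g).
have [|F [[Finj Fdisj] Fmax]] := @Zorn_bigcup _ P.
  move=> C CP tot; split=> [f [X CX Xf]|f g [X CX Xf] [Y CY Yg]].
    by apply: (CP _ CX).1.
  by have [XY|YX] := tot _ _ CX CY;
    [apply: (CP _ CY).2 => //; apply: XY | apply: (CP _ CX).2 => //; apply: YX].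
(* The points that no sequence of the family visits. If there were infinitely many, one more
   sequence could be placed among them, against maximality. *)
pose R := [set x : T' | forall f, F f -> forall n, f n <> x].
have Rfin : finite_set R.
  apply/finite_setPn => /card_leP[g].
  pose f n : T' := val (g (SigSub (mem_set (I : [set: nat] n)))).
  have fR n : R (f n) by have := valP (g (SigSub (mem_set (I : [set: nat] n)))) => /set_mem.
  have finj : injective f.
    move=> n m /val_inj/(fun e => @inj _ _ _ g _ _ (mem_set I) (mem_set I) e) /(congr1 val).
    by [].
  apply: (Fmax (F `|` [set f])).
    rewrite properEneq; split; last by left.
    apply/eqP => e; have : F f by rewrite e; right.
    by move=> Ff; apply: (fR 0%N f Ff 0%N).
  split=> [f' [/Finj//|->//]|f1 f2 [F1|->] [F2|->] n m //].
  - exact: Fdisj.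
  - by move=> e; case: (fR m f1 F1 n).
  - by move=> e; case: (fR n f2 F2 m).
have [f0 Ff0] : exists f, F f.
  apply: contrapT => nF; apply: T'inf; apply: sub_finite_set Rfin => x _ f Ff.
  by case: nF; exists f.
have [r rinj] : exists r : T' -> nat, {in R &, injective r}.
  have /finite_setP[n /card_set_bijP[r [_ ri _]]] := Rfin; by exists r.
(* Each point gets a sequence, a flag and an index. The flag is [true] for the finitely many
   unvisited points, which are attached to [f0] and numbered by [r]. *)
have Hd x : exists d : (nat -> T') * bool * nat, F d.1.1 /\
    if d.1.2 then [/\ d.1.1 = f0, R x & r x = d.2] else d.1.1 d.2 = x.
  have [Rx|] := pselect (R x); first by exists (f0, true, r x).
  move=> /existsNP[f /not_implyP[Ff /existsNP[n /contrapT e]]].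
  by exists (f, false, n).
have [d dP] := dep_choice Hd.
(* The pair (m, x) goes to the term, in the sequence of x, whose index codes the flag, m and the
   index of x. Disjointness recovers the sequence and injectivity recovers the code. *)
exists (fun mx => (d mx.2).1.1 (choice.pickle ((d mx.2).1.2, mx.1, (d mx.2).2))).
move=> [m x] [m' x'] /=.
have := dP x; have := dP x'; case: (d x) => -[f b] n; case: (d x') => -[f' b'] n' /= [F1 H1] [F2 H2] e.
have ef := Fdisj _ _ F2 F1 _ _ e; subst f'.
have := Finj _ F1 _ _ e; move=> /(pcan_inj choice.pickleK)[eb em en]; subst b' m' n'.
congr pair; case: b H1 H2 {e} => [[_ Rx' rx'] [_ Rx rx]|<- <- //].
by apply: rinj; rewrite ?inE // rx'.
Qed.

Lemma small_nat_mul (I : Type) : small I -> small (nat * I).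
Proof.
move=> [f [fi fK]].
pose g (ni : nat * I) : nat * {x | K x} := (ni.1, exist _ (f ni.2) (fK ni.2)).
apply: (small_inj (f := g)) small_nat_prod => -[n i] [m j] /= [-> /fi ->] //.
Qed.

Lemma small_unit : small unit.
Proof.
have [x Kx] := infinite_setN0 Kinf.
by exists (fun=> x); split=> // -[] [].
Qed.

Lemma small_sum (I J : Type) : small I -> small J -> small (I + J).
Proof.
move=> [f [fi fK]] [g [gi gK]].
pose h (ij : I + J) : nat * {x | K x} := match ij with
  inl i => (0%N, exist _ (f i) (fK i)) | inr j => (1%N, exist _ (g j) (gK j)) end.
apply: (small_inj (f := h)) small_nat_prod => -[i|j] [i'|j'] //= [] => [/fi|/gi] -> //.
Qed.

Lemma small_count (I : countType) : small I.
Proof.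
apply: (small_inj (f := fun i => (choice.pickle i, tt))) (small_nat_mul small_unit).
by move=> i j [/(pcan_inj choice.pickleK)].
Qed.

Lemma small_sigma_ord (I : Type) (n : I -> nat) : small I -> small {i : I & 'I_(n i)}.
Proof.
move=> /small_nat_mul; apply: (small_inj (f := fun u : {i : I & 'I_(n i)} => (projT2 u : nat, projT1 u))).
by move=> [i a] [j b] /= [e1 e2]; subst j; congr existT; apply: val_inj.
Qed.

End Small.

(** * Saturation and homogeneity *)

Lemma eval_eq_rect (L : language) (N : str L) (c : ctx (srt L)) (x : asg (dom N) c) s s'
    (t : term c s) (e : s = s') :
  eval x (eq_rect s (term c) t s' e) = eq_rect s (dom N) (eval x t) s' e.
Proof. by case: _ / e. Qed.

Lemma automorphism_eval (L : language) (N : str L) h (c : ctx (srt L)) s (t : term c s)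
    (x : asg (dom N) c) :
  automorphism h -> h _ (eval x t) = eval (fun v => h _ (x v)) t.
Proof.
move=> [_ hf _]; elim: t => [//|f ts IH] /=; rewrite hf; congr (fint _).
by apply: funD => i; apply: IH.
Qed.

Lemma automorphism_surj (L : language) (N : str L) h s (y : dom N s) :
  automorphism h -> exists x, h s x = y.
Proof. by move=> [hb _ _]; have [g _ gK] := hb s; exists (g y). Qed.

Lemma automorphism_sat (L : language) (N : str L) h (c : ctx (srt L)) (p : formula c)
    (x : asg (dom N) c) :
  automorphism h -> sat p x <-> sat p (fun v => h _ (x v)).
Proof.
move=> ha; have [hb hf hr] := ha.
elim: p x => [{}c|{}c s t1 t2|{}c r ts|{}c p IHp q IHq|{}c p IHp|{}c s p IHp] x //=.
- rewrite -!automorphism_eval //; split=> [->//|]; exact: (bij_inj (hb s)).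
- rewrite hr (_ : (fun i => h _ (eval x (ts i))) = fun i => eval (fun v => h _ (x v)) (ts i)) //.
  by apply: funD => i; apply: automorphism_eval.
- by rewrite IHp IHq.
- by rewrite IHp.
- have E (y : dom N s) : xext (fun v => h _ (x v)) (h s y) = fun v => h _ (xext x y v).
    by apply: funD => -[v|].
  split=> [[y /IHp Hy]|[y]]; first by exists (h s y); rewrite E.
  have [z <-] := automorphism_surj y ha; by rewrite E => Hz; exists z; apply/IHp.
Qed.

Lemma automorphism_definable (L : language) (N : str L) h (c : ctx (srt L))
    (P : asg (dom N) c -> Prop) (x : asg (dom N) c) :
  automorphism h -> definable P -> P x <-> P (fun v => h _ (x v)).
Proof. by move=> ha [p Hp]; rewrite -!Hp; apply: automorphism_sat. Qed.

Section Saturation.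
Variables (L : language) (N : str L) (T : Type) (K : set T).
Implicit Types c d : ctx (srt L).

(* Saturation, with the parameters given as a tuple and for possibly infinite
   tuples of variables. *)
Definition tuple_saturated := forall c d (y : asg (dom N) d),
  small K (var c) -> small K (var d) ->
  forall (I : Type) (F : I -> asg (dom N) c -> asg (dom N) d -> Prop),
  (forall i, definable (fun z : asg (dom N) (csum c d) => F i (lpart z) (rpart z))) ->
  finitely_satisfiable (fun i => [set x | F i x y]) ->
  exists x, forall i, F i x y.

Definition tuple_homogeneous := forall d (y y' : asg (dom N) d), small K (var d) ->
  (forall p : formula d, sat p y <-> sat p y') ->
  exists h, automorphism h /\ forall v, h _ (y v) = y' v.

(** The map [y v] to [y' v] is well defined because a coincidence [y v = y w] is itself expressed by
    a formula, after transport when the sorts are only provably equal. Off the range of [y] it is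
    extended by the identity, on which elementarity imposes nothing. *)
Lemma tuple_homogeneousP : strongly_homogeneous_above N K -> tuple_homogeneous.
Proof.
move=> Hhom d y y' dK E.
pose X : set (elt N) := range (fun v => mkelt (y v)).
have yy v w : mkelt (y v) = mkelt (y w) -> mkelt (y' v) = mkelt (y' w).
  move=> evw; pose e : vsort w = vsort v := projT1_eq (esym evw).
  pose t : term d (vsort v) := eq_rect _ (term d) (Var w) _ e.
  have Ht (x : asg (dom N) d) : eval x t = eq_rect _ (dom N) (x w) _ e.
    exact: (eval_eq_rect x (Var w) e).
  have : sat (Eq (Var v) t) y.
    by rewrite /= Ht; exact: esym (projT2_eq (esym evw)).
  move=> /E /=; rewrite Ht => ->; rewrite /mkelt; apply/esym.
  exact: (eq_existT_curried e erefl).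
have Hf (se : elt N) : exists z' : dom N (projT1 se),
    forall v, mkelt (y v) = se -> mkelt (y' v) = mkelt z'.
  have [[v ev]|nv] := pselect (exists v, mkelt (y v) = se).
    by case: _ / ev; exists (y' v) => w /yy.
  by exists (projT2 se) => v ev; case: nv; exists v.
have [f0 Hf0] := dep_choice Hf.
pose f s (z : dom N s) : dom N s := f0 (mkelt z).
have fy v : f _ (y v) = y' v.
  have := Hf0 _ v erefl; rewrite /f => /esym ee.
  have := projT2_eq ee; rewrite (Prop_irrelevance (projT1_eq ee) erefl); exact.
have XK : (X #<= K)%card by exact: (@card_le_small _ K _ _ (fun v => mkelt (y v)) X (@subset_refl _ _) dK).
have [|h [ha Hh]] := Hhom X XK f; last first.
  by exists h; split=> // v; rewrite -fy; apply: Hh; exists v.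
move=> p; have sub (e : var (params X)) : exists t : term d (vsort e), 
    eval y t = pval e /\ eval y' t = f _ (pval e).
  case: e => e Xe; have [v _ ev] := Xe; subst e; exists (Var v) => /=; split=> //.
have [t Ht] := dep_choice sub.
have := E (formula_subst p t); rewrite !sat_formula_subst.
rewrite (_ : (fun v => eval y (t v)) = @pval _ _ X); last by apply: funD => v; case: (Ht v).
by rewrite (_ : (fun v => eval y' (t v)) = fun e => f _ (pval e)); last by apply: funD => v; case: (Ht v).
Qed.

Lemma saturated_one (Hsat : saturated_above N K) s d (y : asg (dom N) d) (I : Type)
    (F : I -> dom N s -> asg (dom N) d -> Prop) :
  small K (var d) ->
  (forall i, definable (fun z : asg (dom N) (csum (ctx1 s) d) => F i (z (inl tt)) (rpart z))) ->
  (forall k (g : 'I_k -> I), exists z, forall j, F (g j) z y) ->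
  exists z, forall i, F i z y.
Proof.
move=> dK Fdef Ffs.
pose X : set (elt N) := range (fun v => mkelt (y v)).
have XK : (X #<= K)%card by exact: (@card_le_small _ K _ _ (fun v => mkelt (y v)) X (@subset_refl _ _) dK).
pose q := [set p : formula_over X (ctx1 s) | exists i, forall z : dom N s, sat_over p (xone z) <-> F i z y].
have [|z Hz] := Hsat X XK s q.
  move=> k g; have [i Hi] := dep_choice (fun j => svalP (g j)).
  have [z Hz] := Ffs k i; exists (xone z) => j; exact/Hi.
exists z => i; have [p Hp] := Fdef i.
pose sub (v : var (csum (ctx1 s) d)) : term (csum (ctx1 s) (params X)) (vsort v) :=
  match v return term (csum (ctx1 s) (params X)) (@vsort _ (csum (ctx1 s) d) v) with
  | inl v => @Var L (csum (ctx1 s) (params X)) (inl v)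
  | inr v => @Var L (csum (ctx1 s) (params X))
      (inr (exist _ (mkelt (y v)) (imageT (fun v => mkelt (y v)) v)))
  end.
have Hq (z' : dom N s) : sat_over (formula_subst p sub : formula_over X (ctx1 s)) (xone z') <-> F i z' y.
  rewrite /sat_over /= sat_formula_subst.
  rewrite (_ : (fun v => _) = xsum (xone z' : asg (dom N) (ctx1 s)) y) ?Hp //.
  by apply: funD => -[].
by apply/(Hq z)/Hz; exists i.
Qed.

(* Zorn's lemma, applied to the partial assignments, seen as sets of pairs
   (variable, value), that are finitely satisfiable together with [F]. *)
Lemma tuple_saturatedP : infinite_set K -> saturated_above N K -> tuple_saturated.
Proof.
move=> Kinf Hsat c d y cK dK I F Fdef Ffs.
pose pt := {v : var c & dom N (vsort v)}.
pose G (Z : set pt) := forall k (g : 'I_k -> I) m (w : 'I_m -> {vz | Z vz}),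
  exists x, (forall j, F (g j) x y) /\ forall j, x (projT1 (sval (w j))) = projT2 (sval (w j)).
have [C CG tot|Z [ZG Zmax]] := @Zorn_bigcup _ G.
  move=> k g m w; case: m w => [|m] w.
    by have [x Hx] := Ffs k g; exists x; split=> // -[].
  have [X0 [CX0 Hw]] : exists X, C X /\ forall j, X (sval (w j)).
    elim: m w => [|m IH] w.
      have [X CX wX] := svalP (w ord0); exists X; split=> // j.
      by rewrite (ord1 j).
    have [X [CX HX]] := IH (fun j => w (lift ord0 j)).
    have [Y CY wY] := svalP (w ord0).
    have [XY|YX] := tot _ _ CX CY.
      exists Y; split=> // j; case: (unliftP ord0 j) => [i ->|->//].
      exact/XY/HX.
    exists X; split=> // j; case: (unliftP ord0 j) => [i ->|->]; first exact: HX.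
    exact: YX.
  exact: (CG _ CX0 k g m.+1 (fun j => exist _ (sval (w j)) (Hw j))).
have e0 : 'I_0 -> I by case.
have Zfun v z z' : Z (existT _ v z) -> Z (existT _ v z') -> z = z'.
  move=> Zz Zz'.
  have [x [_ Hx]] := ZG 0%N e0 2%N
    (fun j => if j == ord0 then exist _ _ Zz else exist _ _ Zz').
  by have := Hx ord_max; have := Hx ord0 => /= <- <-.
pose W : ctx (srt L) := Ctx (fun w : {vz | Z vz} => vsort (projT1 (sval w))).
pose yW : asg (dom N) W := fun w => projT2 (sval w).
(* The values already chosen become parameters of the next type. By [Zfun] there is at most one for
   each variable of [c], so there are few enough of them. *)
have WK : small K (var W).
  apply: (small_inj (f := fun w : var W => projT1 (sval w))) cK => -[[v z] Zz] [[v' z'] Zz'] /= e.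
  by subst v'; apply: eq_exist; rewrite (Zfun _ _ _ Zz Zz').
have Ztot v : exists z, Z (existT _ v z).
  pose J := ({k : nat & 'I_k -> I} * {m : nat & 'I_m -> {vz | Z vz}})%type.
  (* The type of the value at [v]: for each finite part of [F] and each finite part of [Z], some
     tuple satisfies both and takes this value at [v]. *)
  pose FF (j : J) (z : dom N (vsort v)) (yy : asg (dom N) (csum d W)) :=
    exists x : asg (dom N) c, (forall i, F (projT2 j.1 i) x (lpart yy)) /\
      ((forall i, x (projT1 (sval (projT2 j.2 i))) = rpart yy (projT2 j.2 i)) /\ x v = z).
  have [x0 _] : exists x : asg (dom N) c, True.
    by have [x _] := Ffs 0%N e0; exists x.
  have [| | |z Hz] := @saturated_one Hsat (vsort v) (csum d W) (xsum y yW) J FF.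
  - exact: small_sum.
  - move=> [[k g] [m w]]; pose s := vsort v.
    apply: (definable_exs x0 (P := fun x (z : asg (dom N) (csum (ctx1 s) (csum d W))) =>
      (forall i, F (g i) x (lpart (rpart z))) /\
      ((forall i, x (projT1 (sval (w i))) = rpart (rpart z) (w i)) /\ x v = z (inl tt)))).
    pose cc := csum c (csum (ctx1 s) (csum d W)).
    apply: definable_and; [|apply: definable_and].
    + apply: (definable_all (P := fun i (z : asg (dom N) cc) => F (g i) (lpart z) (lpart (rpart (rpart z))))) => i.
      pose gg (u : var (csum c d)) : asg (dom N) cc -> dom N (vsort u) :=
        match u return asg (dom N) cc -> dom N (@vsort _ (csum c d) u) with
        | inl u => fun z => z (inl u) | inr u => fun z => z (inr (inr (inl u))) end.
      apply: (definable_comp (g := gg) _ (Fdef (g i))) => -[u|u].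
        exact: (@term_fun_var L N cc (inl u)).
      exact: (@term_fun_var L N cc (inr (inr (inl u)))).
    + apply: (definable_all (P := fun i (z : asg (dom N) cc) => lpart z (projT1 (sval (w i))) = rpart (rpart (rpart z)) (w i))) => i; apply: definable_eq.
        exact: (@term_fun_var L N cc (inl _)).
      exact: (@term_fun_var L N cc (inr (inr (inr (w i))))).
    + apply: definable_eq; first exact: (@term_fun_var L N cc (inl v)).
      exact: (@term_fun_var L N cc (inr (inl tt))).
  - move=> k g.
    pose I1 : finType := {j : 'I_k & 'I_(projT1 (g j).1)}.
    pose I2 : finType := {j : 'I_k & 'I_(projT1 (g j).2)}.
    have [x [Hx1 Hx2]] := ZG #|I1| (fun i => let u := enum_val i in projT2 (g (tag u)).1 (tagged u))
      #|I2| (fun i => let u := enum_val i in projT2 (g (tag u)).2 (tagged u)).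
    exists (x v) => j; exists x; split; last split=> // i; first move=> i.
      by have := Hx1 (enum_rank (Tagged (fun j => 'I_(projT1 (g j).1)) i)); rewrite enum_rankK.
    by have := Hx2 (enum_rank (Tagged (fun j => 'I_(projT1 (g j).2)) i)); rewrite enum_rankK.
  exists z; apply: contrapT => nZ.
  apply: (Zmax (Z `|` [set existT _ v z])).
    rewrite properEneq; split; last by left.
    by apply/eqP => e; apply: nZ; rewrite e; right.
  move=> k g m w.
  (* The selected pairs already in [Z]; any other one is the new pair, which [Hz] takes care of
     through [x v = z]. *)
  pose mw := [set j | Z (sval (w j))].
  have [n [tau [inj Htau]]] := finite_set_enum (finite_finset (X := mw)).
  have tauZ i : Z (sval (w (tau i))) by apply/Htau; exists i.
  have [x [Hx1 [Hx2 Hx3]]] := Hz (existT _ k g, existT (fun m => 'I_m -> {vz | Z vz}) n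
    (fun i => exist _ (sval (w (tau i))) (tauZ i))).
  exists x; split=> // j.
  have [Zj|nZj] := pselect (Z (sval (w j))).
    by have [i <-] := (Htau j).1 Zj; rewrite (Hx2 i).
  by case: (svalP (w j)) => [//|/= ->].
have [x Hx] := dep_choice Ztot.
exists x => i.
(* The condition [F i] involves finitely many variables of [c], and on these [x] agrees with a tuple
   satisfying it. *)
have [l [Fl Hl]] := formula_support (projT1 (cid (Fdef i))).
have Hp := projT2 (cid (Fdef i)); move: Hl; set p := projT1 _ in Hp *.
move=> /(_ _ (@subset_refl _ l)) [p' [_ Hp']].
have Fl' : finite_set (inl @^-1` l : set (var c)).
  by apply: finite_preimage => // u v _ _ [].
have [n [tau [inj Htau]]] := finite_set_enum Fl'.
have [x' [HF Hx']] := ZG 1%N (fun=> i) n (fun j => exist _ (existT _ (tau j) (x (tau j))) (Hx (tau j))).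
have := (Hp (xsum x' y)).2 (HF ord0).
rewrite Hp' => H; apply/(Hp (xsum x y)); rewrite Hp'.
move: H; apply: iffLR; apply: sat_ext => -[[v|v] lv] //=; rewrite /restrict /=.
by have [j <-] := (Htau v).1 lv; rewrite Hx'.
Qed.
End Saturation.

(** * Indiscernible sequences and dividing *)

Section Ramsey.

Definition increasing (k : nat) (f : 'I_k -> nat) := forall i j : 'I_k, (i < j -> f i < f j)%N.
Definition strict (s : nat -> nat) := forall i j : nat, (i < j -> s i < s j)%N.

Lemma strictS (s : nat -> nat) : (forall n, (s n < s n.+1)%N) -> strict s.
Proof. by move=> H i j; apply: (homo_ltn ltn_trans H). Qed.

Lemma strict_comp s t : strict s -> strict t -> strict (s \o t).
Proof. by move=> hs ht i j ij; apply/hs/ht. Qed.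

Lemma strict_increasing s k (f : 'I_k -> nat) : strict s -> increasing f -> increasing (s \o f).
Proof. by move=> hs hf i j ij; apply/hs/hf. Qed.

Lemma strict_mono s : strict s -> forall i j, (s i < s j)%N -> (i < j)%N.
Proof.
move=> hs i j sij; rewrite ltnNge; apply/negP; rewrite leq_eqVlt => /orP[/eqP e|/hs H].
  by move: sij; rewrite e ltnn.
by have := ltn_trans sij H; rewrite ltnn.
Qed.

Lemma constant_subsequence (P : nat -> Prop) :
  exists e, strict e /\ ((forall n, P (e n)) \/ (forall n, ~ P (e n))).
Proof.
have [[n0 Hn0]|H] := pselect (exists n0, forall n, (n0 <= n)%N -> ~ P n).
  exists (addn n0); split; first by move=> i j; rewrite ltn_add2l.
  by right=> n; apply: Hn0; rewrite leq_addr.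
have {}H n : exists m, (n <= m)%N /\ P m.
  apply: contrapT => Hn; apply: H; exists n => m nm Pm; apply: Hn; by exists m.
have [g Hg] := dep_choice H.
pose e n := iter n (fun m => g m.+1) (g 0%N).
exists e; split; first by apply: strictS => n; apply: (Hg _).1.
by left=> -[|n]; apply: (Hg _).2.
Qed.

Definition fcons k (a : nat) (f : 'I_k -> nat) : 'I_k.+1 -> nat :=
  fun i => if unlift ord0 i is Some j then f j else a.

Lemma fconsE k (f : 'I_k.+1 -> nat) : f = fcons (f ord0) (fun j => f (lift ord0 j)).
Proof. by apply: funext => i; rewrite /fcons; case: unliftP => [j|] ->. Qed.

(** Nested subsequences [S n] are thinned so that the colour of a tuple starting at [S n 0] and
    continuing in [S n.+1] is constant. On the diagonal [a] the colour then depends on the least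
    entry alone, and the pigeonhole principle for sequences finishes. *)
Lemma ramsey k (P : ('I_k -> nat) -> Prop) : exists s, strict s /\
  ((forall f, increasing f -> P (s \o f)) \/ (forall f, increasing f -> ~ P (s \o f))).
Proof.
elim: k P => [|k IH] P.
  have f0 : 'I_0 -> nat by case.
  exists id; split=> //; have [Pf|nPf] := pselect (P f0); [left|right] => f _;
    by rewrite (_ : _ \o f = f0) //; apply: funext => -[].
have step (s : nat -> nat) : exists t : nat -> nat, strict t /\
    ((forall f, increasing f -> P (fcons (s 0%N) (s \o succn \o t \o f))) \/
     (forall f, increasing f -> ~ P (fcons (s 0%N) (s \o succn \o t \o f)))).
  exact: (IH (fun f => P (fcons (s 0%N) (s \o succn \o f)))).
have [next Hnext] := dep_choice step.
pose S n := iter n (fun s => s \o succn \o next s) id.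
have Sstrict n : strict (S n).
  elim: n => [//|n IHn]; apply: strict_comp; last exact: (Hnext _).1.
  by apply: strict_comp.
have Ssub n m : (n <= m)%N -> forall i, exists j, S m i = S n j.
  elim: m => [|m IHm]; first by rewrite leqn0 => /eqP -> i; exists i.
  rewrite leq_eqVlt => /orP[/eqP <- i|/IHm H i]; first by exists i.
  exact: H.
pose a n := S n 0%N.
have astrict : strict a by apply: strictS => n; apply: Sstrict.
have [e [es He]] := constant_subsequence
  (fun n => forall f, increasing f -> P (fcons (a n) (S n.+1 \o f))).
have key (f : 'I_k.+1 -> nat) : increasing f -> exists g, increasing g /\
    a \o f = fcons (a (f ord0)) (S (f ord0).+1 \o g).
  move=> finc; have H j : exists m, a (f (lift ord0 j)) = S (f ord0).+1 m.
    by apply: Ssub; apply: finc.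
  have [g Hg] := dep_choice H.
  exists g; split=> [i j ij|].
    apply: (strict_mono (Sstrict (f ord0).+1)); rewrite -!Hg; apply: astrict.
    by apply: finc; rewrite !lift0 ltnS.
  rewrite [LHS]fconsE /=; congr fcons; apply: funext => j /=; exact: Hg.
exists (a \o e); split; first exact: strict_comp.
case: He => He; [left|right] => f finc.
  have [g [ginc E]] := key _ (strict_increasing es finc).
  by rewrite -[a \o e \o f]/(a \o (e \o f)) E; apply: He.
have [g [ginc E]] := key _ (strict_increasing es finc).
rewrite -[a \o e \o f]/(a \o (e \o f)) E.
have [|] := (Hnext (S (e (f ord0)))).2; last exact.
by move=> H; case: (He (f ord0)).
Qed.

Lemma ramsey_all m (k : 'I_m -> nat) (P : forall j, ('I_(k j) -> nat) -> Prop) :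
  exists s, strict s /\ forall j,
  (forall f, increasing f -> P j (s \o f)) \/ (forall f, increasing f -> ~ P j (s \o f)).
Proof.
elim: m k P => [|m IH] k P; first by exists id; split=> // -[].
have [s [ss Hs]] := IH _ (fun j => P (lift ord0 j)).
have [t [ts Ht]] := ramsey (fun f => P ord0 (s \o f)).
exists (s \o t); split=> [|j]; first exact: strict_comp.
case: (unliftP ord0 j) => [i ->|->].
  case: (Hs i) => H; [left|right] => f finc; exact: (H _ (strict_increasing ts finc)).
exact: Ht.
Qed.
End Ramsey.

Lemma formula_arity_right (L : language) (c d : ctx (srt L)) (p : formula (csum c d)) :
  exists n (tau : 'I_n -> var d), injective tau /\
  exists p' : formula (csum c (enum_arity tau)),
    forall (N : str L) (x : asg (dom N) c) y, sat p (xsum x y) <-> sat p' (xsum x (pick_vars tau y)).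
Proof.
pose swap (c d : ctx (srt L)) (v : var (csum c d)) : term (csum d c) (vsort v) :=
  match v return term (csum d c) (@vsort _ (csum c d) v) with
  | inl u => @Var L (csum d c) (inr u) | inr u => @Var L (csum d c) (inl u) end.
have swapE c' d' (q : formula (csum c' d')) (N : str L) (x : asg (dom N) c') y :
    sat (formula_subst q (@swap c' d')) (xsum y x) <-> sat q (xsum x y).
  by rewrite sat_formula_subst; apply: sat_ext => -[].
have [n [tau [inj [p' Hp']]]] := formula_arity_left (formula_subst p (@swap c d)).
exists n, tau; split=> //; exists (formula_subst p' (@swap _ _)) => N x y.
by rewrite swapE -Hp' swapE.
Qed.

Section Indiscernibles.
Variables (L : language) (N : str L) (T : Type) (K : set T).
Hypotheses (Kinf : infinite_set K) (Nsat : tuple_saturated N K) (Nhom : tuple_homogeneous N K).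
Variable G : set (elt N).
Hypothesis Gsmall : small K {e | G e}.
Implicit Types c d : ctx (srt L).

Definition block (I : Type) d : ctx (srt L) := Ctx (fun v : I * var d => vsort v.2).
Definition block_asg (D : srt L -> Type) (I : Type) d (x : I -> asg D d) : asg D (block I d) :=
  fun v => x v.1 v.2.
Definition reblock (D : srt L -> Type) (I J : Type) d (f : I -> J) (z : asg D (block J d)) :
    asg D (block I d) :=
  fun v => z (f v.1, v.2).

Definition same_type d (x y : asg (dom N) d) :=
  forall p : formula_over G d, sat_over p x <-> sat_over p y.

Definition fixes (h : forall s, dom N s -> dom N s) :=
  forall e, G e -> h _ (projT2 e) = projT2 e.

Lemma same_type_conjugate d (x y : asg (dom N) d) :
  small K (var d) -> same_type x y -> conjugate G x y.
Proof.
move=> dK xy.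
have [||h [ha Hh]] := @Nhom (csum d (params G)) (xsum x (@pval _ _ G)) (xsum y (@pval _ _ G)).
- exact: small_sum.
- exact: xy.
exists h; split=> //; first by move=> e Ge; apply: (Hh (inr (exist _ e Ge))).
by apply: funD => v; rewrite (Hh (inl v)).
Qed.

Lemma fixes_sat_over h d (p : formula_over G d) (x : asg (dom N) d) :
  automorphism h -> fixes h -> sat_over p x <-> sat_over p (fun v => h _ (x v)).
Proof.
move=> ha hG; rewrite /sat_over /= (automorphism_sat p _ ha).
by apply: sat_ext => -[v|[e Ge]] //=; apply: hG.
Qed.

Lemma conjugate_same_type d (x y : asg (dom N) d) : conjugate G x y -> same_type x y.
Proof. by move=> [h [ha hG ->]] p; apply: fixes_sat_over. Qed.

Lemma definable_over_block (I : Type) k d (f : 'I_k -> I) (p : formula_over G (block 'I_k d)) :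
  definable (fun z : asg (dom N) (csum (block I d) (params G)) =>
    sat p (xsum (reblock f (lpart z)) (rpart z))).
Proof.
pose g (v : var (csum (block 'I_k d) (params G))) :
    asg (dom N) (csum (block I d) (params G)) -> dom N (vsort v) :=
  match v return asg (dom N) (csum (block I d) (params G)) ->
    dom N (@vsort _ (csum (block 'I_k d) (params G)) v) with
  | inl v => fun z => z (inl (f v.1, v.2)) | inr v => fun z => z (inr v) end.
have Hg v : term_fun (g v).
  case: v => v; first exact: (@term_fun_var L N (csum (block I d) (params G)) (inl (f v.1, v.2))).
  exact: (@term_fun_var L N (csum (block I d) (params G)) (inr v)).
have := definable_comp Hg (@definable_sat L N _ p).
apply: definable_ext => z; by apply: sat_ext => -[].
Qed.

(* By Ramsey's theorem every finite part of the type of such a sequence [y] is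
   realized by a subsequence of [x]. *)
Lemma extract_indiscernible d (x : nat -> asg (dom N) d) :
  small K (var d) -> (forall n, same_type (x 0%N) (x n)) ->
  exists y : nat -> asg (dom N) d,
  [/\ y 0%N = x 0%N, forall n, conjugate G (x 0%N) (y n), indiscernible G y
    & forall k (p : formula_over G (block 'I_k d)),
      (forall f, increasing f -> sat_over p (block_asg (x \o f))) ->
      forall f, increasing f -> sat_over p (block_asg (y \o f))].
Proof.
move=> dK xtp.
(* Conditions from [J1] express indiscernibility; those from [J2] transfer to the new sequence each
   formula that holds on every increasing tuple of [x]. *)
pose J1 := {k : nat & formula_over G (block 'I_k d) *
  ({f : 'I_k -> nat | increasing f} * {f : 'I_k -> nat | increasing f})}%type.
pose J2 := {k : nat & {p : formula_over G (block 'I_k d) |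
   forall f, increasing f -> sat_over p (block_asg (x \o f))} * {f : 'I_k -> nat | increasing f}}%type.
pose F (j : J1 + J2) (z : asg (dom N) (block nat d)) (w : asg (dom N) (params G)) :=
  let S k (p : formula_over G (block 'I_k d)) (f : 'I_k -> nat) :=
    sat p (xsum (reblock f z) w) in
  match j with
  | inl j => let u := projT2 j in S _ u.1 (sval u.2.1) <-> S _ u.1 (sval u.2.2)
  | inr j => let u := projT2 j in S _ (sval u.1) (sval u.2)
  end.
have [||||z Hz] := @Nsat (block nat d) (params G) (@pval _ _ G) _ _ _ F.
- exact: small_nat_mul.
- exact: Gsmall.
- move=> [[k [p [f g]]]|[k [p f]]] /=; last exact: definable_over_block.
  by apply: definable_iff; apply: definable_over_block.
- move=> m g.
  have [s [ss Hs]] := @ramsey_all m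
    (fun j => match g j with inl u => projT1 u | inr u => 0%N end)
    (fun j => match g j as u return
       ('I_(match u with inl u => projT1 u | inr u => 0%N end) -> nat) -> Prop with
     | inl u => fun f => sat_over (projT2 u).1 (block_asg (x \o f)) | inr u => fun=> True end).
  exists (block_asg (x \o s)) => j; have := Hs j; rewrite /F /=.
  case: (g j) => [[k [p [f f']]]|[k [p f]]] /= H; last first.
    exact: (svalP p _ (strict_increasing ss (svalP f))).
  by case: H => H; split=> H'; [apply: H; apply: svalP|apply: H; apply: svalP|
    case: (H _ (svalP f))|case: (H _ (svalP f'))].
pose y n : asg (dom N) d := fun v => z (n, v).
have Hin k (p : formula_over G (block 'I_k d)) f g : increasing f -> increasing g ->
    sat_over p (block_asg (y \o f)) <-> sat_over p (block_asg (y \o g)).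
  by move=> finc ginc; apply: (Hz (inl (existT _ k (p, (exist _ f finc, exist _ g ginc))))).
have Hem k (p : formula_over G (block 'I_k d)) :
    (forall f, increasing f -> sat_over p (block_asg (x \o f))) ->
    forall f, increasing f -> sat_over p (block_asg (y \o f)).
  by move=> Hp f finc; apply: (Hz (inr (existT _ k (exist _ p Hp, exist _ f finc)))).
have ytp n : same_type (y n) (x 0%N).
  suff H (p : formula_over G d) : sat_over p (x 0%N) -> sat_over p (y n).
    move=> p; split; last exact: H.
    by move=> yp; apply: contrapT => /(H (Not p)).
  move=> xp.
  pose sub (v : var (csum d (params G))) : term (csum (block 'I_1 d) (params G)) (vsort v) :=
    match v return term (csum (block 'I_1 d) (params G)) (@vsort _ (csum d (params G)) v) with
    | inl v => @Var L (csum (block 'I_1 d) (params G)) (inl (ord0, v))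
    | inr v => @Var L (csum (block 'I_1 d) (params G)) (inr v) end.
  have E (t : nat -> asg (dom N) d) (f : 'I_1 -> nat) :
      sat_over (formula_subst p sub : formula_over G _) (block_asg (t \o f)) <->
      sat_over p (t (f ord0)).
    by rewrite /sat_over /= sat_formula_subst; apply: sat_ext => -[].
  have := Hem _ (formula_subst p sub) _ (fun=> n); rewrite !E; apply.
    by move=> f _; rewrite E; apply/xtp.
  by move=> i j; rewrite (ord1 i) (ord1 j).
(* So far [y 0] only has the type of [x 0] over [G]. An automorphism fixing [G] moves it onto [x 0]
   and preserves what has been obtained. *)
have [h [ha hG h0]] := same_type_conjugate dK (ytp 0%N).
exists (fun n v => h _ (y n v)); split.
- by rewrite -h0.
- move=> n; apply: same_type_conjugate => // p.
  by rewrite -(ytp n p); apply: fixes_sat_over.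
- move=> k f g finc ginc p.
  have E f' : sat_over p (fun v => h _ (y (f' v.1) v.2)) <-> sat_over p (block_asg (y \o f')).
    by rewrite (fixes_sat_over p (block_asg (y \o f')) ha hG).
  by rewrite !E; apply: Hin.
- move=> k p Hp f finc.
  by apply: (fixes_sat_over p (block_asg (y \o f)) ha hG).1; apply: Hem.
Qed.
End Indiscernibles.

(** * Dividing along sequences of enumerations of the parameter set *)

Section Dividing.
Variables (L : language) (N : str L) (T : Type) (K : set T).
Hypotheses (Kinf : infinite_set K) (Nsat : tuple_saturated N K) (Nhom : tuple_homogeneous N K).
Variable G : set (elt N).
Hypothesis Gsmall : small K {e | G e}.
Implicit Types c d : ctx (srt L).

Definition conjugate_sequence d (x : asg (dom N) d) (y : nat -> asg (dom N) d) :=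
  [/\ y 0%N = x, forall n, conjugate G x (y n) & indiscernible G y].

Lemma finitely_satisfiable_initial c (F : nat -> set (asg (dom N) c)) :
  (forall m, exists x, forall i, (i < m)%N -> F i x) -> finitely_satisfiable F.
Proof.
move=> H k g; have [x Hx] := H (\max_j g j).+1.
by exists x => j; apply: Hx; rewrite ltnS; apply: leq_bigmax.
Qed.

Lemma definable_over c (P : asg (dom N) c -> Prop) :
  definable P -> exists p : formula_over G c, forall x, sat_over p x <-> P x.
Proof.
move=> [p Hp].
exists (formula_subst p (fun v => @Var L (csum c (params G)) (inl v))) => x.
by rewrite /sat_over /= sat_formula_subst -Hp; apply: sat_ext.
Qed.

Lemma definable_jointly_satisfiable c a (p : formula (csum c a)) (x0 : asg (dom N) c) m :
  definable (fun z : asg (dom N) (block 'I_m a) =>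
    exists x, forall i, sat p (xsum x (fun v => z (i, v)))).
Proof.
apply: (definable_exs x0 (P := fun x (z : asg (dom N) (block 'I_m a)) =>
  forall i, sat p (xsum x (fun v => z (i, v))))).
pose e := csum c (block 'I_m a).
apply: (definable_all (P := fun i (z : asg (dom N) e) =>
   sat p (xsum (lpart z) (fun v => rpart z (i, v))))) => i.
pose g (v : var (csum c a)) : asg (dom N) e -> dom N (vsort v) :=
  match v return asg (dom N) e -> dom N (@vsort _ (csum c a) v) with
  | inl v => fun z => z (inl v) | inr v => fun z => z (inr (i, v)) end.
have Hg v : term_fun (g v).
  case: v => v; first exact: (@term_fun_var L N e (inl v)).
  exact: (@term_fun_var L N e (inr (i, v))).
have := definable_comp Hg (@definable_sat L N _ p).
by apply: definable_ext => z; apply: sat_ext => -[].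
Qed.

Lemma formula_divides_of c (a : arity (srt L)) (p : formula (csum c a)) (d : asg (dom N) a) e :
  conjugate_sequence d e -> ~ finitely_satisfiable (fun n => [set x | sat p (xsum x (e n))]) ->
  formula_divides G p d.
Proof. by move=> [e0 ec ei] nfs; exists e. Qed.

(** Only finitely many parameters occur in [p], and restricting [y] to them leaves an indiscernible
    sequence of conjugates of a finite tuple, which is the kind of sequence that dividing is
    about. *)
Lemma nondividing_satisfiable c (D : set (elt N)) (v : asg (dom N) c)
    (y : nat -> asg (dom N) (params D)) (p : formula_over D c) :
  ~ type_divides G (@tp _ N D c v) -> conjugate_sequence (@pval _ N D) y -> sat_over p v ->
  finitely_satisfiable (fun n => [set x | sat p (xsum x (y n))]).
Proof.
move=> nd [y0 yc yi] pv; apply: contrapT => nfs; apply: nd.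
have [n [tau [inj [p' Hp']]]] := formula_arity_right p.
exists (enum_arity tau), p', (pick_vars tau (@pval _ N D)); split.
  exists 1%N, (fun=> p); split=> [_|x /(_ ord0)]; first exact: pv.
  by rewrite /sat_over /= Hp'.
apply: (@formula_divides_of _ _ _ _ (fun n => pick_vars tau (y n))).
  split; first by rewrite y0.
    by move=> m; have [h [ha hG E]] := yc m; exists h; split=> //; rewrite E.
  move=> k f g finc ginc q.
  pose sub (v : var (csum (block 'I_k (enum_arity tau)) (params G))) :
      term (csum (block 'I_k (params D)) (params G)) (vsort v) :=
    match v return term (csum (block 'I_k (params D)) (params G))
      (@vsort _ (csum (block 'I_k (enum_arity tau)) (params G)) v) with
    | inl v => @Var L (csum (block 'I_k (params D)) (params G)) (inl (v.1, tau v.2))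
    | inr v => @Var L (csum (block 'I_k (params D)) (params G)) (inr v) end.
  have E f' : sat_over (formula_subst q sub : formula_over G (block 'I_k (params D)))
      (fun v => y (f' v.1) v.2) <-> sat_over q (fun v => pick_vars tau (y (f' v.1)) v.2).
    by rewrite /sat_over /= sat_formula_subst; apply: sat_ext => -[].
  by rewrite -!E; apply: yi.
move=> fs; apply: nfs => k g; have [x Hx] := fs k g.
by exists x => j; have := Hx j; rewrite /= Hp'.
Qed.

(** A witness of dividing moves a finite tuple [d], which need not lie in [D]. Automorphisms sending
    [d] to [e n] carry along the enumeration of all of [D]; the resulting sequence is not
    indiscernible, so a new one is extracted from it. The formula [p] is the conjunction of the
    formulas of the type that imply [q]. *)
Lemma type_divides_witness c (D : set (elt N)) (v : asg (dom N) c) :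
  small K {e | D e} -> type_divides G (@tp _ N D c v) ->
  exists (y : nat -> asg (dom N) (params D)) (p : formula_over D c),
  [/\ conjugate_sequence (@pval _ N D) y, sat_over p v
    & ~ finitely_satisfiable (fun n => [set x | sat p (xsum x (y n))])].
Proof.
move=> DK [a [q [d [[k [g [gv gq]]] [e [e0 ec ei enfs]]]]]].
have [p Hp] : exists p : formula_over D c, forall x (w : asg (dom N) (params D)),
    sat p (xsum x w) <-> forall j, sat (g j) (xsum x w).
  have [p Hp] := definable_all (fun j => @definable_sat L N _ (g j)).
  by exists p => x w; rewrite Hp.
have [h Hh] := dep_choice ec.
pose x n : asg (dom N) (params D) := fun u => h n _ (@pval _ _ D u).
have xq n z : sat p (xsum z (x n)) -> sat q (xsum z (e n)).
  have [ha hG E] := Hh n; move=> pz.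
  have [z' Ez] : exists z' : asg (dom N) c, z = fun u => h n _ (z' u).
    have [z' Hz'] := dep_choice (fun u => automorphism_surj (z u) ha).
    by exists z'; apply: funD.
  have Ex (b : ctx (srt L)) (r : formula (csum c b)) (w : asg (dom N) b) :
      sat r (xsum z (fun u => h n _ (w u))) <-> sat r (xsum z' w).
    rewrite (automorphism_sat r (xsum z' w) ha); apply: sat_ext => -[u|u] //=.
    by rewrite Ez.
  rewrite E Ex; apply: gq; apply/Hp; exact/Ex.
(* Some initial segment of the instances of [q] is already inconsistent. By indiscernibility of [e]
   the same holds on every increasing [m]-tuple, a property that the extraction hands over to
   [y]. *)
have [m Hm] : exists m, forall z, ~ forall i, (i < m)%N -> sat q (xsum z (e i)).
  apply: contrapT => H; apply: enfs; apply: finitely_satisfiable_initial => m.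
  apply: contrapT => Hm; apply: H; exists m => z Hz; apply: Hm; by exists z.
have Qm (f : 'I_m -> nat) : increasing f -> ~ exists z, forall i, sat q (xsum z (e (f i))).
  move=> finc; have [r Hr] := definable_over (definable_not (definable_jointly_satisfiable q v m)).
  have := @ei m f (fun i => i : nat) finc (fun _ _ => id) r.
  rewrite !Hr /= => H; apply/H => -[z Hz].
  by apply: (Hm z) => i im; apply: (Hz (Ordinal im)).
have xc n : same_type G (x 0%N) (x n).
  move=> r; have [h0 hG0 _] := Hh 0%N; have [hn hGn _] := Hh n.
  by rewrite /x -!fixes_sat_over.
have [y [y0 yc yi yem]] := extract_indiscernible Kinf Nsat Nhom Gsmall (d := params D) DK xc.
(* The extracted sequence starts at the image of the enumeration of [D] under [h 0], which fixes [G]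
   but possibly not [D]; it is moved back. *)
have [hG1 [h1a h1G h1]] : conjugate G (x 0%N) (@pval _ _ D).
  apply: (same_type_conjugate Kinf Nhom Gsmall (d := params D) DK) => r.
  have [h0 hG0 _] := Hh 0%N; by rewrite /x -fixes_sat_over.
pose y' n : asg (dom N) (params D) := fun u => hG1 _ (y n u).
have yy j (r : formula_over G (block 'I_j (params D))) f :
    sat_over r (fun u => y' (f u.1) u.2) <-> sat_over r (block_asg (y \o f)).
  by rewrite (fixes_sat_over r (block_asg (y \o f)) h1a h1G).
exists y', p; split.
- split.
  + by rewrite /y' y0 h1.
  + move=> n; apply: (same_type_conjugate Kinf Nhom Gsmall (d := params D) DK) => r.
    rewrite -(fixes_sat_over r (y n) h1a h1G) -(conjugate_same_type (yc n) r).
    have [h0 hG0 _] := Hh 0%N; by rewrite /x -fixes_sat_over.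
  + by move=> ? f f' finc f'inc r; rewrite !yy; apply: yi.
- by apply/Hp => j; apply: gv.
move=> fs; have [z Hz] := fs m (fun i => i : nat).
have [r Hr] := definable_over (definable_not (definable_jointly_satisfiable p v m)).
have : sat_over r (block_asg (y \o (fun i : 'I_m => i : nat))).
  apply: yem => [f finc|//]; apply/Hr => -[z' Hz']; apply: (Qm f finc).
  by exists z' => i; apply: xq; apply: Hz'.
by rewrite -yy Hr; apply; exists z.
Qed.

(** Instances of [p] at parameters unrelated by [R] contradict each other, so an indiscernible
    sequence of pairwise unrelated conjugates of [d] suffices. Saturation provides unrelated
    realizations of the type of [d] over [G], from which the sequence is extracted. *)
Lemma formula_divides_of_classes c (a : arity (srt L)) (p : formula (csum c a))
    (d : asg (dom N) a) (R : asg (dom N) a -> asg (dom N) a -> Prop) :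
  definable (fun z : asg (dom N) (csum a a) => R (lpart z) (rpart z)) ->
  (forall x y y', sat p (xsum x y) -> sat p (xsum x y') -> R y y') ->
  (forall q : formula_over G a, sat_over q d -> forall m, exists y : 'I_m -> asg (dom N) a,
    (forall i, sat_over q (y i)) /\ forall i j : 'I_m, (i < j)%N -> ~ R (y i) (y j)) ->
  formula_divides G p d.
Proof.
move=> Rdef pR H.
have aK : small K (var a) by apply: small_count.
pose J := ({q : formula_over G a | sat_over q d} * nat + {mn : nat * nat | (mn.1 < mn.2)%N})%type.
pose F (j : J) (z : asg (dom N) (block nat a)) (w : asg (dom N) (params G)) :=
  match j with
  | inl j => sat (sval j.1) (xsum (fun v => z (j.2, v)) w)
  | inr j => ~ R (fun v => z ((sval j).1, v)) (fun v => z ((sval j).2, v))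
  end.
have [||||z Hz] := @Nsat (block nat a) (params G) (@pval _ _ G) _ _ _ F.
- exact: small_nat_mul.
- exact: Gsmall.
- pose e := csum (block nat a) (params G).
  move=> [[[q qd] n]|[[m n] mn]] /=.
    pose g (v : var (csum a (params G))) : asg (dom N) e -> dom N (vsort v) :=
      match v return asg (dom N) e -> dom N (@vsort _ (csum a (params G)) v) with
      | inl v => fun z => z (inl (n, v)) | inr v => fun z => z (inr v) end.
    have Hg v : term_fun (g v).
      case: v => v; first exact: (@term_fun_var L N e (inl (n, v))).
      exact: (@term_fun_var L N e (inr v)).
    have := definable_comp Hg (@definable_sat L N _ q).
    by apply: definable_ext => z; apply: sat_ext => -[].
  pose g (v : var (csum a a)) : asg (dom N) e -> dom N (vsort v) :=
    match v return asg (dom N) e -> dom N (@vsort _ (csum a a) v) with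
    | inl v => fun z => z (inl (m, v)) | inr v => fun z => z (inl (n, v)) end.
  have Hg v : term_fun (g v).
    case: v => v; first exact: (@term_fun_var L N e (inl (m, v))).
    exact: (@term_fun_var L N e (inl (n, v))).
  exact: definable_not (definable_comp Hg Rdef).
- move=> k g.
  have [q Hq] := definable_all (fun j : 'I_k => @definable_sat L N _
    (match g j with inl u => sval u.1 | inr _ => Top end)).
  (* The length exceeds the largest index in play by one, so that [inord] is faithful on these
     indices. *)
  have [|y [Hy1 Hy2]] := H q _ (\max_j (match g j with inl u => u.2 | inr u => (sval u).2 end)).+1.
    by apply/Hq => j; case: (g j) => [[[r rd] n]|].
  exists (fun v => y (inord v.1) v.2) => j; rewrite /F /=.
  have := @leq_bigmax _ (fun j => match g j with inl u => u.2 | inr u => (sval u).2 end) j.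
  have := fun n => (Hq _).1 (Hy1 n) j.
  case: (g j) => [[[r rd] n]|[[m n] /= mn]] Hr le /=; first exact: Hr.
  apply: Hy2; rewrite !inordK // ltnS //.
  exact: leq_trans (ltnW mn) le.
pose x n : asg (dom N) a := fun v => z (n, v).
have xtp n : same_type G (x n) d.
  suff Hs (q : formula_over G a) : sat_over q d -> sat_over q (x n).
    move=> q; split; last exact: Hs.
    by move=> xq; apply: contrapT => /(Hs (Not q)).
  by move=> qd; apply: (Hz (inl (exist _ q qd, n))).
have [|y [y0 yc yi yem]] := extract_indiscernible Kinf Nsat Nhom Gsmall aK (x := x).
  by move=> n q; rewrite !xtp.
have [h [ha hG hd]] := same_type_conjugate Kinf Nhom Gsmall aK (xtp 0%N).
pose y' n : asg (dom N) a := fun u => h _ (y n u).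
have yy j (r : formula_over G (block 'I_j a)) f :
    sat_over r (fun u => y' (f u.1) u.2) <-> sat_over r (block_asg (y \o f)).
  by rewrite (fixes_sat_over r (block_asg (y \o f)) ha hG).
apply: (formula_divides_of (e := y')).
  split.
  + by rewrite /y' y0 hd.
  + move=> n; apply: (same_type_conjugate Kinf Nhom Gsmall aK) => r.
    by rewrite -(fixes_sat_over r (y n) ha hG) -(conjugate_same_type (yc n) r) (xtp 0%N).
  + by move=> ? f f' finc f'inc r; rewrite !yy; apply: yi.
move=> fs; have [w Hw] := fs 2%N (fun i => i : nat).
pose b2 := block 'I_2 a.
pose g (v : var (csum a a)) : asg (dom N) b2 -> dom N (vsort v) :=
  match v return asg (dom N) b2 -> dom N (@vsort _ (csum a a) v) with
  | inl v => fun z => z (ord0, v) | inr v => fun z => z (ord_max, v) end.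
have Hg v : term_fun (g v).
  case: v => v; first exact: (@term_fun_var L N b2 (ord0, v)).
  exact: (@term_fun_var L N b2 (ord_max, v)).
have [r Hr] := definable_over (definable_not (definable_comp Hg Rdef)).
have : sat_over r (block_asg (y \o (fun i : 'I_2 => i : nat))).
  apply: yem => [f finc|//]; apply/Hr.
  by apply: (Hz (inr (exist _ (f ord0, f ord_max) (finc ord0 ord_max isT)))).
rewrite -yy Hr; apply; exact: pR (Hw ord0) (Hw ord_max).
Qed.
End Dividing.

(** * Imaginaries *)

Section Transfer.
Variables (L1 L2 : language) (N1 : str L1) (N2 : str L2) (m : srt L1 -> srt L2).
Variables (i : forall s, dom N1 s -> dom N2 (m s)) (j : forall s, dom N2 (m s) -> dom N1 s).
Hypothesis ij : forall s, cancel (@i s) (@j s).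
Hypothesis ji : forall s, cancel (@j s) (@i s).
Hypothesis Hfun : forall f : fsym L1,
  term_fun (fun x : asg (dom N2) (cmap m (fdom f)) => i (@fint L1 N1 f (fun v => j (x v)))).
Hypothesis Hrel : forall r : rsym L1,
  definable (fun x : asg (dom N2) (cmap m (rdom r)) => @rint L1 N1 r (fun v => j (x v))).

Lemma transfer_term (c : ctx (srt L1)) s (t : term c s) :
  term_fun (fun x : asg (dom N2) (cmap m c) => i (@eval L1 N1 c (fun v => j (x v)) s t)).
Proof.
elim: t => {s} [v|f ts IH].
  by apply: term_fun_ext (@term_fun_var L2 N2 (cmap m c) v) => x /=; rewrite ji.
apply: term_fun_ext (term_fun_comp (c := cmap m (fdom f)) IH (Hfun f)) => x /=.
by congr i; congr fint; apply: funD => k; rewrite ij.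
Qed.

(** In the applications [i] and [j] are the identity: the carriers of A, B and C in the larger
    structures agree with the original ones only by conversion, and the maps keep the two typings
    apart. *)
Lemma transfer_definable (c : ctx (srt L1)) (p : formula c) :
  definable (fun x : asg (dom N2) (cmap m c) => @sat L1 N1 c p (fun v => j (x v))).
Proof.
elim: p => {c} [c|c s t1 t2|c r ts|c p IHp q IHq|c p IHp|c s p IHp] /=.
- exact: definable_true.
- apply: definable_ext (definable_eq (transfer_term t1) (transfer_term t2)) => x.
  by split=> [/(can_inj (@ij s))|->].
- have := definable_comp (c := cmap m (rdom r)) (fun k => transfer_term (ts k)) (Hrel r).
  apply: definable_ext => x.
  by rewrite (_ : (fun v => j _) = fun k => @eval L1 N1 c (fun v => j (x v)) _ (ts k)) //; apply: funD => k; rewrite ij.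
- exact: definable_and.
- exact: definable_not.
- pose g (v : var (cmap m (cext c s))) :
    asg (dom N2) (cext (cmap m c) (m s)) -> dom N2 (@vsort _ (cmap m (cext c s)) v) :=
    match v return asg (dom N2) (cext (cmap m c) (m s)) -> dom N2 (@vsort _ (cmap m (cext c s)) v) with
    | Some v => fun x => x (Some v) | None => fun x => x None end.
  have Hg v : term_fun (g v).
    case: v => [v|]; first exact: (@term_fun_var L2 N2 (cext (cmap m c) (m s)) (Some v)).
    exact: (@term_fun_var L2 N2 (cext (cmap m c) (m s)) None).
  have := definable_ex (definable_comp Hg IHp); apply: definable_ext => x.
  split=> [[y Hy]|[y Hy]]; [exists (j y)|exists (i y)]; move: Hy; apply: iffLR; apply: sat_ext => -[v|] //=.
  by rewrite ij.
Qed.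
End Transfer.

(** * Representatives of imaginaries; saturation and homogeneity of the eq-structure *)

Section Imaginaries.
Variables (L : language) (N : str L).
Local Notation Leq := (eq_lang N).
Local Notation Neq := (eq_str N).

Lemma home_definable (c : ctx (srt L)) (p : formula c) :
  definable (fun x : asg (dom Neq) (@cmap _ (srt Leq) inl c) => @sat L N c p x).
Proof.
apply: (@transfer_definable L Leq N Neq inl (fun _ => id) (fun _ => id)) => // [f|r].
  exact: (term_fun_sym Neq (inl f)).
exact: (definable_sym Neq (inl r)).
Qed.

(* A representative of an element of sort [s] is a tuple of elements of [N]. *)
Definition rep_arity (s : srt Leq) : arity (srt L) :=
  match s with inl s => Arity (fun _ : 'I_1 => s) | inr im => im_ar im end.

Definition rep_class (s : srt Leq) : asg (dom N) (rep_arity s) -> dom Neq s :=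
  match s return asg (dom N) (rep_arity s) -> dom Neq s with
  | inl s => fun y => y ord0
  | inr im => fun y => @fint Leq Neq (inr im) y
  end.

Lemma rep_class_surj s (z : dom Neq s) : exists y, rep_class y = z.
Proof.
case: s z => [s|im] z; first by exists (fun=> z).
by case: z => z Hz; have [y ey] := Hz; exists y; apply: eq_exist.
Qed.

Lemma rep_class_eq im (x y : asg (dom N) (im_ar im)) :
  @rep_class (inr im) x = @rep_class (inr im) y <-> sat (im_fm im) (xsum x y).
Proof.
have [Er Es Et] := im_equiv im.
split=> [/(congr1 sval) /= E|xy].
  have : [set z | sat (im_fm im) (xsum y z)] y by apply: Er.
  by rewrite -E.
apply: eq_exist; apply/seteqP; split=> z /= Hz; first exact: Et (Es _ _ xy) Hz.
exact: Et xy Hz.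
Qed.

Definition rep_ctx (c : ctx (srt Leq)) : ctx (srt L) :=
  Ctx (fun v : {v : var c & 'I_(alen (rep_arity (vsort v)))} => asort (tagged v)).

Definition rep_var (c : ctx (srt Leq)) (v : var c) (k : 'I_(alen (rep_arity (vsort v)))) :
    var (rep_ctx c) := existT _ v k.

Definition rep_asg (c : ctx (srt Leq)) (y : asg (dom N) (rep_ctx c)) : asg (dom Neq) c :=
  fun v => rep_class (fun k => y (rep_var k)).

Lemma rep_asg_surj (c : ctx (srt Leq)) (x : asg (dom Neq) c) : exists y, rep_asg y = x.
Proof.
have [y Hy] := dep_choice (fun v => rep_class_surj (x v)).
exists (fun v => y (tag v) (tagged v)); apply: funD => v; rewrite -Hy /rep_asg.
by congr rep_class.
Qed.

(** Function symbols of the eq-language take home-sort arguments only. A term of imaginary sort is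
    thus a variable or a class map applied to home terms, and these terms are its representative. *)
Lemma rep_term (c : ctx (srt Leq)) s (t : term c s) :
  exists tau : forall k : 'I_(alen (rep_arity s)), @term L (rep_ctx c) (asort k),
  forall y : asg (dom N) (rep_ctx c),
    eval (rep_asg y) t = rep_class (fun k => eval y (tau k)).
Proof.
elim: t => {s} [v|[f|im] ts IH].
- by exists (fun k => @Var L (rep_ctx c) (rep_var k)).
- have [tau Htau] := dep_choice IH.
  exists (fun _ => App f (fun k => tau k ord0)) => y /=.
  congr (@fint L N f); apply: funD => k; exact: Htau.
- have [tau Htau] := dep_choice IH.
  exists (fun k => tau k ord0) => y /=.
  congr (@fint Leq Neq (inr im)); apply: funD => k; exact: Htau.
Qed.

(** On representatives, equality in an imaginary sort becomes the defining equivalence relation, and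
    a quantifier over the sort becomes quantifiers over the coordinates of a representative. *)
Lemma rep_definable (c : ctx (srt Leq)) (p : formula c) :
  definable (fun y : asg (dom N) (rep_ctx c) => sat p (rep_asg y)).
Proof.
elim: p => {c} [c|c s t1 t2|c [r|[]] ts|c p IHp q IHq|c p IHp|c s p IHp] /=.
- exact: definable_true.
- have [tau1 H1] := rep_term t1; have [tau2 H2] := rep_term t2.
  case: s t1 t2 tau1 H1 tau2 H2 => [s|im] t1 t2 tau1 H1 tau2 H2.
    by exists (Eq (tau1 ord0) (tau2 ord0)) => y; rewrite H1 H2.
  pose g (v : var (csum (im_ar im) (im_ar im))) : term (rep_ctx c) (vsort v) :=
    match v return term (rep_ctx c) (@vsort _ (csum (im_ar im) (im_ar im)) v) with
    | inl k => tau1 k | inr k => tau2 k end.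
  exists (formula_subst (im_fm im) g) => y.
  rewrite sat_formula_subst H1 H2 rep_class_eq; by apply: sat_ext => -[].
- have [tau Htau] := dep_choice (fun k => rep_term (ts k)).
  exists (@Rel L (rep_ctx c) r (fun k => tau k ord0)) => y /=.
  have -> : (fun k => eval y (tau k ord0)) = fun k => eval (rep_asg y) (ts k) => //.
  by apply: funD => k; rewrite Htau.
- exact: definable_and.
- exact: definable_not.
- pose cc := csum (rep_arity s) (rep_ctx c).
  pose g (v : var (rep_ctx (cext c s))) : asg (dom N) cc -> dom N (vsort v) :=
    match v return asg (dom N) cc -> dom N (@vsort _ (rep_ctx (cext c s)) v) with
    | existT (Some v) k => fun z => z (inr (@rep_var c v k))
    | existT None k => fun z => z (inl k) end.
  have Hg v : term_fun (g v).
    case: v => -[v|] k; first exact: (@term_fun_var L N cc (inr (@rep_var c v k))).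
    exact: (@term_fun_var L N cc (inl k)).
  have := definable_comp Hg IHp.
  have E (z : asg (dom N) cc) : rep_asg (fun v => g v z) = xext (rep_asg (rpart z)) (rep_class (lpart z)).
    by apply: funD => -[v|].
  move=> H; have {}H : definable (fun z : asg (dom N) cc =>
      sat p (xext (rep_asg (rpart z)) (rep_class (lpart z)))).
    by apply: definable_ext H => z; rewrite E.
  have := closed_exs (@definable_closed L N) (P := fun x y => sat p (xext (rep_asg y) (rep_class x))) H.
  apply: definable_ext => y; split=> [[x Hx]|[z Hz]]; first by exists (rep_class x).
  by have [x ex] := rep_class_surj z; exists x; rewrite ex.
Qed.

Lemma rep_definable2 (c d : ctx (srt Leq)) (P : asg (dom Neq) c -> asg (dom Neq) d -> Prop) :
  definable (fun z : asg (dom Neq) (csum c d) => P (lpart z) (rpart z)) ->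
  definable (fun z : asg (dom N) (csum (rep_ctx c) (rep_ctx d)) =>
    P (rep_asg (lpart z)) (rep_asg (rpart z))).
Proof.
move=> [p Hp]; pose cc := csum (rep_ctx c) (rep_ctx d).
pose g (v : var (rep_ctx (csum c d))) : asg (dom N) cc -> dom N (vsort v) :=
  match v return asg (dom N) cc -> dom N (@vsort _ (rep_ctx (csum c d)) v) with
  | existT (inl v) k => fun z => z (inl (@rep_var c v k))
  | existT (inr v) k => fun z => z (inr (@rep_var d v k)) end.
have Hg v : term_fun (g v).
  case: v => -[v|v] k; first exact: (@term_fun_var L N cc (inl (@rep_var c v k))).
  exact: (@term_fun_var L N cc (inr (@rep_var d v k))).
have := definable_comp Hg (rep_definable p); apply: definable_ext => z.
have -> : rep_asg (fun v => g v z) = xsum (rep_asg (lpart z)) (rep_asg (rpart z)).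
  by apply: funD => -[].
exact: Hp.
Qed.

Lemma home_formula (c : ctx (srt L)) (p : @formula Leq (cmap inl c)) :
  definable (fun x : asg (dom N) c => @sat Leq Neq _ p x).
Proof.
pose g (v : var (rep_ctx (cmap inl c))) : asg (dom N) c -> dom N (vsort v) :=
  match v return asg (dom N) c -> dom N (@vsort _ (rep_ctx (cmap inl c)) v) with
  | existT v k => fun x => x v end.
have Hg v : term_fun (g v) by case: v => v k; exact: (@term_fun_var L N c v).
have := definable_comp Hg (rep_definable p); apply: definable_ext => x.
by apply: sat_ext => v.
Qed.

Section Monster.
Variables (T : Type) (K : set T).
Hypotheses (Kinf : infinite_set K) (Nsat : tuple_saturated N K) (Nhom : tuple_homogeneous N K).

Lemma small_rep_ctx c : small K (var c) -> small K (var (rep_ctx c)).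
Proof. exact: small_sigma_ord. Qed.

Lemma eq_saturated : tuple_saturated Neq K.
Proof.
move=> c d y cK dK I F Fdef Ffs.
have [y' ey] := rep_asg_surj y.
have [||||x Hx] := @Nsat (rep_ctx c) (rep_ctx d) y' _ _ I
  (fun i x z => F i (rep_asg x) (rep_asg z)).
- exact: small_rep_ctx.
- exact: small_rep_ctx.
- by move=> i; apply: rep_definable2.
- move=> k g; have [x Hx] := Ffs k g; have [x' ex] := rep_asg_surj x.
  by exists x' => j /=; rewrite ex ey; apply: Hx.
by exists (rep_asg x) => i; have := Hx i; rewrite ey.
Qed.

Lemma eq_automorphism (h : forall s, dom N s -> dom N s) : automorphism h ->
  exists h' : forall s, dom Neq s -> dom Neq s, automorphism h' /\
    (forall s (y : asg (dom N) (rep_arity s)), h' s (rep_class y) = rep_class (fun k => h _ (y k))).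
Proof.
move=> ha; have [hb hf hr] := ha.
have H s (z : dom Neq s) : exists z', forall y, rep_class y = z -> rep_class (fun k => h _ (y k)) = z'.
  have [y0 <-] := rep_class_surj z.
  exists (rep_class (fun k => h _ (y0 k))) => y.
  case: s z y0 y => [s|im] z y0 y; first by move=> /= ->.
  move=> /(rep_class_eq y y0) H; apply/rep_class_eq.
  have := (automorphism_sat _ (xsum y y0) ha).1 H; apply: iffLR; by apply: sat_ext => -[].
have [h' Hh'] := dep_choice (fun s => dep_choice (@H s)).
have E s (y : asg (dom N) (rep_arity s)) : h' s (rep_class y) = rep_class (fun k => h _ (y k)).
  exact: esym (Hh' s _ y erefl).
have Eh s (z : dom N s) : h' (inl s) z = h s z by apply: (E (inl s) (fun=> z)).
exists h'; split=> //; split.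
- move=> s.
  have inj : injective (h' s).
    move=> z1 z2; have [y1 <-] := rep_class_surj z1; have [y2 <-] := rep_class_surj z2.
    rewrite !E; case: s {z1 z2} y1 y2 => [s|im] y1 y2; first exact: (bij_inj (hb s)).
    move/rep_class_eq => H1; apply/rep_class_eq; apply/(automorphism_sat _ _ ha).
    by move: H1; apply: iffLR; apply: sat_ext => -[].
  have surj z : exists z', h' s z' = z.
    have [y <-] := rep_class_surj z.
    have [y' Hy'] := dep_choice (fun k => automorphism_surj (y k) ha).
    exists (rep_class y'); rewrite E; congr rep_class; exact: funD.
  have [g Hg] := dep_choice surj; exists g => // z; apply: inj; exact: Hg.
- move=> [f|im] x.
    rewrite [LHS]Eh /= hf; congr (@fint L N f); apply: funD => k; exact/esym/Eh.
  rewrite [LHS](E (inr im) x) /=; congr (@fint Leq Neq (inr im)); apply: funD => k; exact/esym/Eh.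
- move=> [r|[]] x; rewrite [X in X <-> _]hr /=.
  have -> // : (fun i => h _ (x i)) = (fun i => h' _ (x i)).
  by apply: funD => k; rewrite -Eh.
Qed.

Lemma rep_class_term_fun (d : ctx (srt Leq)) s
    (g : forall k : 'I_(alen (rep_arity s)), asg (dom Neq) d -> dom N (asort k)) :
  (forall k, @term_fun Leq Neq d (inl (asort k)) (g k)) ->
  term_fun (fun x => @rep_class s (fun k => g k x)).
Proof.
case: s g => [s|im] g H; first exact: H.
exact: (@term_fun_app Leq Neq d (inr im) g H).
Qed.

Lemma eq_homogeneous : tuple_homogeneous Neq K.
Proof.
move=> d y y' dK E.
have [z ez] := rep_asg_surj y; have [z0 ez0] := rep_asg_surj y'.
pose F (j : {p : @formula L (rep_ctx d) | sat p z} + var d) (x w : asg (dom N) (rep_ctx d)) :=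
  match j with
  | inl p => sat (sval p) x
  | inr v => rep_asg x v = rep_asg w v
  end.
have rK := small_rep_ctx dK.
have [||z' Hz'] := @Nsat (rep_ctx d) (rep_ctx d) z0 rK rK _ F.
- move=> [[p pz]|v] /=.
    apply: (definable_comp (g := fun v (x : asg (dom N) (csum (rep_ctx d) (rep_ctx d))) => x (inl v)) _
      (@definable_sat L N _ p)) => v.
    exact: (@term_fun_var L N (csum (rep_ctx d) (rep_ctx d)) (inl v)).
  have := @rep_definable2 d d (fun x y => x v = y v); apply.
  apply: definable_eq; first exact: (@term_fun_var Leq Neq (csum d d) (inl v)).
  exact: (@term_fun_var Leq Neq (csum d d) (inr v)).
- move=> k g.
  pose R j (x : asg (dom Neq) (cmap inl (rep_ctx d))) (w : asg (dom Neq) d) :=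
    match g j with inl p => sat (sval p) x | inr v => @rep_asg d x v = w v end.
  have Rdef : definable (fun w : asg (dom Neq) d =>
      exists x : asg (dom Neq) (cmap inl (rep_ctx d)), forall j, R j x w).
    pose e := csum (cmap inl (rep_ctx d)) d.
    apply: (@definable_exs Leq Neq (cmap inl (rep_ctx d)) d z (fun x w => forall j, R j x w)).
    apply: (definable_all (P := fun j (x : asg (dom Neq) e) => R j (lpart x) (rpart x))) => j.
    rewrite /R; case: (g j) => [[p pz]|v] /=.
      apply: (definable_comp (g := fun v (x : asg (dom Neq) e) => x (inl v)) _ (home_definable p)) => v.
      exact: (@term_fun_var Leq Neq e (inl v)).
    apply: definable_eq; last exact: (@term_fun_var Leq Neq e (inr v)).
    apply: (rep_class_term_fun (g := fun k (x : asg (dom Neq) e) => x (inl (rep_var k)))) => u.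
    exact: (@term_fun_var Leq Neq e (inl (rep_var u))).
  have [q Hq] := Rdef.
  have [|x Hx] := (Hq y').1.
    apply/E/Hq; exists z => j; rewrite /R; case: (g j) => [[p pz]|v] //=.
    by rewrite ez.
  exists x => j; have := Hx j; rewrite /R /F /=; by case: (g j) => // v; rewrite ez0.
have [||h [ha Hh]] := @Nhom (rep_ctx d) z z'.
- exact: rK.
- move=> p; have H q : sat q z -> sat q z' by move=> qz; apply: (Hz' (inl (exist _ q qz))).
  split; first exact: H.
  by move=> pz'; apply: contrapT => /(H (Not p)).
have [h' [h'a Hh']] := eq_automorphism ha.
exists h'; split=> // v.
rewrite -ez -ez0 -(Hz' (inr v)) [LHS]Hh'; congr rep_class; apply: funD => k; exact: (Hh (rep_var k)).
Qed.
End Monster.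
End Imaginaries.

(** * Abelian structures and pure sequences *)

Lemma sat_imp (L : language) (N : str L) (c : ctx (srt L)) (p : formula c)
  (x y : asg (dom N) c) : (forall v, x v = y v) -> sat p x -> sat p y.
Proof. by move=> h; have -> : x = y by apply: funD. Qed.

Definition of_ord0 (T : 'I_0 -> Type) (k : 'I_0) : T k :=
  match k with Ordinal _ h => match notF h with end end.

Section AbelianStructures.
Variables (L0 : language).
Local Notation L := (ab_lang L0).

Section OneStructure.
Variable A : ab_str L0.
Local Notation asgA c := (asg (car A) c).

Lemma eval_add (c : ctx (srt L)) s (t : term c s) (x y : asgA c) :
  @eval L A c (tadd x y) s t = (@eval L A c x s t + @eval L A c y s t)%R.
Proof.
elim: t => {s} [v|f ts IH] //=.
have H := @ab_hom L0 A (fdom f) (fcod f) (@App L (fdom f) f (fun k => @Var L (fdom f) k))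
  (fun k => @eval L A c x _ (ts k)) (fun k => @eval L A c y _ (ts k)).
have -> : (fun i => @eval L A c (tadd x y) _ (ts i)) =
    @tadd _ (car A) (fdom f) (fun k => @eval L A c x _ (ts k)) (fun k => @eval L A c y _ (ts k)).
  by apply: funD => k; apply: IH.
exact: H.
Qed.

Lemma eval_sub (c : ctx (srt L)) s (t : term c s) (x y : asgA c) :
  @eval L A c (tsub x y) s t = (@eval L A c x s t - @eval L A c y s t)%R.
Proof.
have e : tadd (tsub x y) y = x by apply: funD => v; rewrite /tadd /tsub subrK.
by have := eval_add t (tsub x y) y; rewrite e => ->; rewrite addrK.
Qed.

Lemma pp_subgroup (c : ctx (srt L)) (p : formula c) : is_pp p ->
  @sat L A c p (@tzero _ (car A) c) /\
  forall x y : asgA c, @sat L A c p x -> @sat L A c p y -> @sat L A c p (tsub x y).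
Proof.
move=> ppp; have [n [tau [inj [p' [e Hp']]]]] := formula_arity p.
rewrite ppp in e; have [H0 Hs] := @ab_subgroup L0 A (PPF e).
split; first by apply/(Hp' A); apply: H0.
move=> x y /(Hp' A) px /(Hp' A) py; apply/(Hp' A); exact: Hs px py.
Qed.

Lemma pp_zero (c : ctx (srt L)) (p : formula c) : is_pp p ->
  @sat L A c p (@tzero _ (car A) c).
Proof. by case/pp_subgroup. Qed.

Lemma pp_sub (c : ctx (srt L)) (p : formula c) (x y : asgA c) : is_pp p ->
  @sat L A c p x -> @sat L A c p y -> @sat L A c p (tsub x y).
Proof. by case/pp_subgroup => _; apply. Qed.

Lemma pp_add (c : ctx (srt L)) (p : formula c) (x y : asgA c) : is_pp p ->
  @sat L A c p x -> @sat L A c p y -> @sat L A c p (tadd x y).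
Proof.
move=> ppp px py; have := pp_sub ppp px (pp_sub ppp (pp_zero ppp) py); apply: sat_imp => v.
by rewrite /tsub /tzero /tadd sub0r opprK.
Qed.

End OneStructure.

Lemma morphism_eval (N1 N2 : str L) h (c : ctx (srt L)) s (t : term c s) (x : asg (dom N1) c) :
  @morphism L N1 N2 h -> h _ (eval x t) = eval (fun v => h _ (x v)) t.
Proof.
move=> [hf _]; elim: t => {s} [//|f ts IH] /=; rewrite hf; congr (fint _).
by apply: funD => k; apply: IH.
Qed.

Lemma morphism_add (A B : ab_str L0) h s (x y : car A s) : @morphism L A B h ->
  h s (x + y)%R = (h s x + h s y)%R.
Proof.
move=> [hf _].
by have := hf (@Add L0 s : fsym L) (fun k : 'I_2 => if k == ord0 then x else y).
Qed.

Lemma morphism_zero (A B : ab_str L0) h s : @morphism L A B h -> h s (0 : car A s)%R = (0 : car B s)%R.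
Proof.
by move=> hm; have := morphism_add (0 : car A s)%R 0%R hm; rewrite addr0 => /esym/eqP; rewrite -subr_eq0 addrK => /eqP.
Qed.

Lemma morphism_sub (A B : ab_str L0) h s (x y : car A s) : @morphism L A B h ->
  h s (x - y)%R = (h s x - h s y)%R.
Proof. by move=> hm; apply/eqP; rewrite eq_sym subr_eq -(morphism_add _ _ hm) subrK. Qed.

Lemma pp_conj (c : ctx (srt L)) k (q : 'I_k -> formula c) :
  (forall j, is_pp (q j)) -> exists p : formula c, is_pp p /\
    forall (N : str L) (x : asg (dom N) c), sat p x <-> forall j, sat (q j) x.
Proof.
elim: k q => [|k IH] q Hq; first by exists Top; split=> // N x; split=> // _ [].
have [p [ppp Hp]] := IH _ (fun j => Hq (lift ord0 j)).
exists (And (q ord0) p); split=> [|N x] /=; first by rewrite Hq.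
rewrite Hp; split=> [[H0 H] j|H]; last by split=> // j; apply: H.
by case: (unliftP ord0 j) => [i ->|->].
Qed.

Section Sequence.
Variables (Phi : set (ppf L)) (A B C : ab_str L0) (E : pure_ses Phi A B C).
Hypothesis HPhi : fundamental_system Phi B.

Definition incs (c : ctx (srt L)) (x : asg (car A) c) : asg (car B) c := fun v => inc E (x v).
Definition nus (c : ctx (srt L)) (y : asg (car B) c) : asg (car C) c := fun v => prj E (y v).

Lemma inc_morph : @morphism L A B (inc E).
Proof. by case: (inc_pure E) => -[]. Qed.

Lemma prj_inc s (x : car A s) : prj E (inc E x) = 0%R.
Proof. by apply/ses_exact; exists x. Qed.

Lemma evals_nus (c d : ctx (srt L)) (t : asg (@term L c) d) (y : asg (car B) c) :
  (fun v => @eval L C c (nus y) _ (t v)) = nus (fun v => @eval L B c y _ (t v)).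
Proof. by apply: funD => v; rewrite /nus (@morphism_eval B C _ _ _ (t v) y (prj_morph E)). Qed.

Lemma nus_tadd_incs (c : ctx (srt L)) (y : asg (car B) c) (x : asg (car A) c) :
  nus (tadd y (incs x)) = nus y.
Proof.
by apply: funD => v; rewrite /nus /tadd (morphism_add _ _ (prj_morph E)) prj_inc addr0.
Qed.

Lemma nus_sub (c : ctx (srt L)) (y z : asg (car B) c) : nus (tsub y z) = tsub (nus y) (nus z).
Proof. by apply: funD => v; rewrite /nus /tsub (morphism_sub _ _ (prj_morph E)). Qed.

Lemma pp_incs (c : ctx (srt L)) (p : formula c) (x : asg (car A) c) : is_pp p ->
  @sat L B c p (incs x) <-> @sat L A c p x.
Proof.
move=> ppp; have [n [tau [inj [p' [e Hp']]]]] := formula_arity p.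
rewrite ppp in e; rewrite (Hp' A) (Hp' B).
exact: ((inc_pure E).2 (PPF e) (pick_vars tau x)).
Qed.

Lemma pp_nus (c : ctx (srt L)) (p : formula c) (y : asg (car B) c) : is_pp p ->
  @sat L C c p (nus y) <->
  exists b (x : asg (car A) c), @sat L B c p b /\ y = tadd b (incs x).
Proof.
move=> ppp; have [n [tau [inj [p' [e Hp']]]]] := formula_arity p.
rewrite ppp in e; rewrite (Hp' C).
split=> [/((prj_pp E (p := PPF e)) (pick_vars tau y))|].
  move=> [b' [x' [Hb' ey]]].
  (* The axiom decomposes only the variables occurring in [p]; elsewhere [x] is 0 and [b] takes the
     whole value. *)
  have [x [Hx x0]] := extend_asg (D := car A) (c := c) (tau := tau) x' (fun v _ => 0%R) inj.
  exists (tsub y (incs x)), x; split; last first.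
    by apply: funD => v; rewrite /tadd /tsub subrK.
  apply/(Hp' B); rewrite (_ : pick_vars tau _ = b') //; apply: funD => k.
  have := congr1 (fun f => f k) ey; rewrite /pick_vars /tsub /tadd /incs /= => ->.
  by rewrite Hx addrK.
move=> [b [x [Hb ->]]]; apply/((prj_pp E (p := PPF e)) (pick_vars tau (tadd b (incs x)))).
by exists (pick_vars tau b), (pick_vars tau x); split=> //; apply/(Hp' B).
Qed.

Lemma pp_nus_of (c : ctx (srt L)) (p : formula c) (y : asg (car B) c) : is_pp p ->
  @sat L B c p y -> @sat L C c p (nus y).
Proof.
move=> ppp py; apply/pp_nus => //; exists y, (@tzero _ (car A) c); split=> //.
by apply: funD => v; rewrite /tadd /incs /tzero (morphism_zero _ inc_morph) addr0.
Qed.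

Lemma fundamental_ctx (c : ctx (srt L)) (p : formula c) : is_pp p ->
  exists k (g : 'I_k -> phi_term Phi c), forall x : asg (car B) c,
    @sat L B c p x <->
    forall j, ppset B (sval (projT1 (g j))) (evals (N := B) (projT2 (g j)) x).
Proof.
move=> ppp; have [n [tau [inj [p' [e Hp']]]]] := formula_arity p.
rewrite ppp in e; have [k [g Hg]] := HPhi (PPF e).
pose sub (v : var (enum_arity tau)) : @term L c (vsort v) := @Var L c (tau v).
exists k, (fun j => existT (fun p => terms c (pp_ar (sval p))) (projT1 (g j))
  (fun i => term_subst sub (projT2 (g j) i))) => x.
rewrite (Hp' B); have := Hg (pick_vars tau x); rewrite /ppset /= => ->.
have H j : evals (N := B) (projT2 (g j)) (pick_vars tau x) =
   evals (N := B) (fun i => term_subst sub (projT2 (g j) i)) x.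
  by apply: funD => i; rewrite /evals eval_term_subst.
by split=> Hj j; have := Hj j; rewrite H.
Qed.

Lemma ppset_phi_term (N : str L) (c : ctx (srt L)) (pt : phi_term Phi c) (x : asg (dom N) c) :
  sat (formula_subst (pp_fm (sval (projT1 pt))) (projT2 pt)) x <->
  ppset N (sval (projT1 pt)) (evals (projT2 pt) x).
Proof. exact: sat_formula_subst. Qed.

(** By purity, a decomposition of [p] over B restricts to A, since each of its conditions is pp as
    well. *)
Lemma fundamental_sub (c : ctx (srt L)) (p : formula c) k (g : 'I_k -> phi_term Phi c) :
  is_pp p -> (forall x : asg (car B) c, @sat L B c p x <->
    forall j, ppset B (sval (projT1 (g j))) (evals (N := B) (projT2 (g j)) x)) ->
  forall x : asg (car A) c, @sat L A c p x <->
    forall j, ppset A (sval (projT1 (g j))) (evals (N := A) (projT2 (g j)) x).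
Proof.
move=> ppp Hg x; rewrite -pp_incs // Hg.
by split=> H j; have := H j; rewrite -!ppset_phi_term pp_incs // is_pp_formula_subst pp_ok.
Qed.

Lemma pi_phi_eq (p : {p | Phi p}) (x y : asg (car A) (phi_ar p)) :
  pi_phi x = pi_phi y <-> ppset A (sval p) (tsub x y).
Proof.
have pp := pp_ok (sval p).
split=> [/(congr1 sval) /= e|xy].
  have : [set z : asg (car A) (phi_ar p) | ppset A (sval p) (tsub y z)] y.
    have := pp_zero A pp; apply: sat_imp => v; by rewrite /tsub subrr.
  by rewrite -e.
apply: eq_exist; apply/seteqP; split=> z /= Hz.
  have := pp_sub pp Hz xy; apply: sat_imp => v.
  by rewrite /tsub opprB addrC addrA subrK.
have := pp_add pp xy Hz; apply: sat_imp => v.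
by rewrite /tadd /tsub addrA subrK.
Qed.

Lemma rho_outside (p : {p | Phi p}) (y : asg (car B) (phi_ar p)) :
  ~ ppset C (sval p) (nus y) -> rho E y = pi_phi (@tzero _ (car A) (phi_ar p)).
Proof. by move=> H; apply: rho_out => H'; apply: H; apply/(pp_nus y (pp_ok _)). Qed.

Lemma rho_inside (p : {p | Phi p}) (b : asg (car B) (phi_ar p)) (x : asg (car A) (phi_ar p)) :
  ppset B (sval p) b -> rho E (tadd b (incs x)) = pi_phi x.
Proof. exact: rho_in. Qed.

(** Two arguments differing by an element of phi(B) are both inside or both outside the domain of
    rho. Inside, the difference is absorbed into the phi(B)-summand. *)
Lemma rho_congr (p : {p | Phi p}) (y z : asg (car B) (phi_ar p)) :
  ppset B (sval p) (tsub y z) -> rho E y = rho E z.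
Proof.
move=> yz; have pp := pp_ok (sval p).
have H : ppset C (sval p) (nus y) <-> ppset C (sval p) (nus z).
  have := pp_nus_of pp yz; rewrite nus_sub => Hyz.
  split=> [Hy|Hz]; [have := pp_sub pp Hy Hyz|have := pp_add pp Hyz Hz]; apply: sat_imp => v.
    by rewrite /tsub opprB addrC subrK.
  by rewrite /tadd /tsub subrK.
have [Hz|nHz] := pselect (ppset C (sval p) (nus z)); last first.
  by rewrite !rho_outside // H.
have [b [x [Hb ez]]] := (pp_nus z pp).1 Hz.
rewrite [in RHS]ez rho_inside //.
rewrite (_ : y = tadd (tadd b (tsub y z)) (incs x)).
  by rewrite rho_inside //; apply: pp_add.
apply: funD => v; rewrite ez /tadd /tsub opprD !addrA subrK.
by rewrite (addrC (b v)) addrK.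
Qed.

(** If [nu y] satisfies [p], then y = b + iota(x) with b in p(B). The rho-values of y are the
    classes of the terms at x, so their vanishing says that iota(x) is in p(B) too. The condition in
    C is what distinguishes a true 0 from the default value of rho. *)
Lemma pp_B (c : ctx (srt L)) (p : formula c) k (g : 'I_k -> phi_term Phi c)
    (y : asg (car B) c) :
  is_pp p -> (forall x : asg (car B) c, @sat L B c p x <->
    forall j, ppset B (sval (projT1 (g j))) (evals (N := B) (projT2 (g j)) x)) ->
  @sat L B c p y <-> @sat L C c p (nus y) /\
    forall j, @rho _ _ _ _ _ E (projT1 (g j)) (evals (N := B) (projT2 (g j)) y) =
      pi_phi (@tzero _ (car A) (phi_ar (projT1 (g j)))).
Proof.
move=> ppp Hg; split=> [py|[py Hr]].
  split=> [|j]; first exact: pp_nus_of.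
  rewrite -(rho_inside _ ((Hg y).1 py j)); congr (rho E); apply: funD => v.
  by rewrite /tadd /incs /tzero (morphism_zero _ inc_morph) addr0.
have [b [x [Hb ey]]] := (pp_nus y ppp).1 py.
suff Hx : @sat L B c p (incs x) by rewrite ey; apply: pp_add.
apply/Hg => j; apply/(@ppset_phi_term B c (g j)); apply/pp_incs.
  by rewrite is_pp_formula_subst pp_ok.
apply/ppset_phi_term; have := Hr j.
rewrite ey (_ : evals (N := B) _ _ = tadd (evals (N := B) (projT2 (g j)) b) (incs (evals (N := A) (projT2 (g j)) x))).
  rewrite rho_inside; last exact: ((Hg b).1 Hb j).
  move=> /pi_phi_eq; apply: sat_imp => v; by rewrite /tsub /tzero subr0.
apply: funD => v; rewrite /evals eval_add /tadd; congr (_ + _)%R.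
by rewrite /incs (@morphism_eval A B _ _ _ _ x inc_morph).
Qed.

End Sequence.
End AbelianStructures.

(** * Relative quantifier elimination *)

Section QuantifierElimination.
Variables (L0 : language) (Phi : set (ppf (ab_lang L0))) (A B C : ab_str L0).
Variables (E : pure_ses Phi A B C).
Variables (XA : expansion (quot_lang Phi)) (YA : exp_str (quot_ab Phi A) XA).
Variables (XC : expansion (ab_lang L0)) (YC : exp_str C XC).
Hypothesis HPhi : fundamental_system Phi B.
Local Notation L := (ab_lang L0).
Local Notation As := (Astar YA).
Local Notation Cs := (Cstar YC).
Local Notation M := (M E YA YC).

Lemma A_term_fun (c : ctx (srt L)) s (t : term c s) :
  @term_fun _ As (cmap (A_sort XA) c) (A_sort XA s) (fun x => @eval L A c x s t).
Proof.
apply: (@transfer_term L (LA XA) A As (A_sort XA) (fun _ => id) (fun _ => id)) => // f.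
exact: (term_fun_sym As (inl (inl f))).
Qed.

Lemma C_term_fun (c : ctx (srt L)) s (t : term c s) :
  @term_fun _ Cs (cmap (C_sort XC) c) (C_sort XC s) (fun x => @eval L C c x s t).
Proof.
apply: (@transfer_term L (LC XC) C Cs (C_sort XC) (fun _ => id) (fun _ => id)) => // f.
exact: (term_fun_sym Cs (inl f)).
Qed.

Lemma C_definable (c : ctx (srt L)) (p : formula c) :
  @definable _ Cs (cmap (C_sort XC) c) (fun x => @sat L C c p x).
Proof.
apply: (@transfer_definable L (LC XC) C Cs (C_sort XC) (fun _ => id) (fun _ => id)) => // [f|r].
  exact: (term_fun_sym Cs (inl f)).
exact: (definable_sym Cs (inl r)).
Qed.

Lemma pi_term_fun (d : ctx (srt (LA XA))) (p : {p | Phi p})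
    (g : forall i, asg (dom As) d -> car A (@asort _ (phi_ar p) i)) :
  (forall i, @term_fun _ As d (A_sort XA (asort i)) (g i)) ->
  @term_fun _ As d (Aquot_sort XA p) (fun x => pi_phi (fun i => g i x)).
Proof. exact: (@term_fun_app (LA XA) As d (inl (inr p)) g). Qed.

(** No constants beta appear: parameters from B are treated as additional variables of [cB] and
    separated again in [Adef_A_formula]. *)
Definition rctx (cB : ctx (srt L)) : ctx (srt (LA XA)) :=
  Ctx (fun r : phi_term Phi cB => Aquot_sort XA (projT1 r)).
Definition rval (cB : ctx (srt L)) (y : asg (car B) cB) : asg (dom As) (rctx cB) :=
  fun r => @rho _ _ _ _ _ E (projT1 r) (evals (N := B) (projT2 r) y).

Section Predicates.
Variables (cA : ctx (srt (LA XA))) (cB : ctx (srt L)) (cC : ctx (srt (LC XC))).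

Definition Adef (P : asg (dom As) cA -> asg (car B) cB -> Prop) :=
  exists p : formula (csum cA (rctx cB)),
  forall xA xB, @sat _ As _ p (xsum xA (rval xB)) <-> P xA xB.
Definition Cdef (P : asg (dom Cs) cC -> asg (car B) cB -> Prop) :=
  exists p : formula (csum cC (cmap (C_sort XC) cB)),
  forall xC xB, @sat _ Cs _ p (xsum xC (nus E xB : asg (dom Cs) (cmap (C_sort XC) cB))) <-> P xC xB.

(* Finite disjunctions of conjunctions of an [A]- and a [C]-condition. *)
Definition qe (P : asg (dom As) cA -> asg (car B) cB -> asg (dom Cs) cC -> Prop) :=
  exists (J : finType) PA PC, [/\ forall j : J, Adef (PA j), forall j : J, Cdef (PC j)
    & forall xA xB xC, P xA xB xC <-> exists j : J, PA j xA xB /\ PC j xC xB].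

Lemma Adef_of (P : asg (dom As) (csum cA (rctx cB)) -> Prop) : definable P ->
  Adef (fun xA xB => P (xsum xA (rval xB))).
Proof. by move=> [p Hp]; exists p => xA xB; apply: Hp. Qed.

Lemma Cdef_of (P : asg (dom Cs) (csum cC (cmap (C_sort XC) cB)) -> Prop) : definable P ->
  Cdef (fun xC xB => P (xsum xC (nus E xB : asg (dom Cs) (cmap (C_sort XC) cB)))).
Proof. by move=> [p Hp]; exists p => xA xB; apply: Hp. Qed.

Lemma Adef_ext P P' : (forall xA xB, P xA xB <-> P' xA xB) -> Adef P -> Adef P'.
Proof. by move=> e [p Hp]; exists p => xA xB; rewrite Hp. Qed.
Lemma Cdef_ext P P' : (forall xA xB, P xA xB <-> P' xA xB) -> Cdef P -> Cdef P'.
Proof. by move=> e [p Hp]; exists p => xA xB; rewrite Hp. Qed.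

Lemma Adef_not P : Adef P -> Adef (fun xA xB => ~ P xA xB).
Proof. by move=> [p Hp]; exists (Not p) => xA xB /=; rewrite Hp. Qed.
Lemma Cdef_not P : Cdef P -> Cdef (fun xA xB => ~ P xA xB).
Proof. by move=> [p Hp]; exists (Not p) => xA xB /=; rewrite Hp. Qed.

Lemma Adef_true (P : Prop) : P -> Adef (fun _ _ => P).
Proof. by move=> h; exists Top. Qed.
Lemma Cdef_true (P : Prop) : P -> Cdef (fun _ _ => P).
Proof. by move=> h; exists Top. Qed.

Lemma Adef_and P P' : Adef P -> Adef P' -> Adef (fun xA xB => P xA xB /\ P' xA xB).
Proof. by move=> [p Hp] [q Hq]; exists (And p q) => xA xB /=; rewrite Hp Hq. Qed.
Lemma Cdef_and P P' : Cdef P -> Cdef P' -> Cdef (fun xA xB => P xA xB /\ P' xA xB).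
Proof. by move=> [p Hp] [q Hq]; exists (And p q) => xA xB /=; rewrite Hp Hq. Qed.

Lemma Adef_all (J : finType) P : (forall j : J, Adef (P j)) -> Adef (fun xA xB => forall j, P j xA xB).
Proof.
move=> /dep_choice[p Hp].
have [q Hq] := definable_allT (fun j => @definable_sat _ As _ (p j)).
by exists q => xA xB; rewrite Hq; split=> H j; apply/Hp.
Qed.
Lemma Cdef_all (J : finType) P : (forall j : J, Cdef (P j)) -> Cdef (fun xA xB => forall j, P j xA xB).
Proof.
move=> /dep_choice[p Hp].
have [q Hq] := definable_allT (fun j => @definable_sat _ Cs _ (p j)).
by exists q => xA xB; rewrite Hq; split=> H j; apply/Hp.
Qed.

Lemma qe_ext P P' : (forall xA xB xC, P xA xB xC <-> P' xA xB xC) -> qe P -> qe P'.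
Proof. by move=> e [J [PA [PC [HA HC H]]]]; exists J, PA, PC; split=> // *; rewrite -e H. Qed.

Lemma qe_AC P P' : Adef P -> Cdef P' -> qe (fun xA xB xC => P xA xB /\ P' xC xB).
Proof.
move=> HP HP'; exists unit, (fun=> P), (fun=> P'); split=> // xA xB xC.
by split=> [H|[]//]; exists tt.
Qed.

Lemma qe_A P : Adef P -> qe (fun xA xB xC => P xA xB).
Proof.
move=> HP; apply: qe_ext (qe_AC HP (Cdef_true I)) => xA xB xC; by split=> [[]|].
Qed.
Lemma qe_C P : Cdef P -> qe (fun xA xB xC => P xC xB).
Proof.
move=> HP; apply: qe_ext (qe_AC (Adef_true I) HP) => xA xB xC; by split=> [[]|].
Qed.

Lemma qe_exT (J : finType) P : (forall j : J, qe (P j)) ->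
  qe (fun xA xB xC => exists j, P j xA xB xC).
Proof.
move=> /dep_choice[K /dep_choice[PA /dep_choice[PC H]]].
exists {j : J & K j}, (fun u => PA (tag u) (tagged u)), (fun u => PC (tag u) (tagged u)).
split=> [u|u|xA xB xC]; [by case: (H (tag u))..|].
split=> [[j]|[[j k] /= Hjk]].
  by have [_ _ ->] := H j => -[k Hk]; exists (Tagged (fun j => K j : Type) k).
by exists j; have [_ _ ->] := H j; exists k.
Qed.

Lemma qe_and P P' : qe P -> qe P' -> qe (fun xA xB xC => P xA xB xC /\ P' xA xB xC).
Proof.
move=> [J [PA [PC [HA HC H]]]] [J' [PA' [PC' [HA' HC' H']]]].
have Hjk (u : J * J') := qe_AC (Adef_and (HA u.1) (HA' u.2)) (Cdef_and (HC u.1) (HC' u.2)).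
apply: qe_ext (qe_exT Hjk) => xA xB xC; rewrite H H'.
split=> [[[j k] /= [[? ?] [? ?]]]|[[j [? ?]] [k [? ?]]]]; last by exists (j, k).
by split; [exists j|exists k].
Qed.

(** Negating a disjunction of conjunctions gives a disjunction over the functions [s] that choose,
    for each disjunct, which side fails: [true] stands for the A-side. *)
Lemma qe_not P : qe P -> qe (fun xA xB xC => ~ P xA xB xC).
Proof.
move=> [J [PA [PC [HA HC H]]]].
have Hs (s : {ffun J -> bool}) : qe (fun xA xB xC =>
   (forall j, if s j then ~ PA j xA xB else True) /\ (forall j, if s j then True else ~ PC j xC xB)).
  apply: qe_AC.
    by apply: Adef_all => j; case: (s j); [apply: Adef_not|apply: Adef_true].
  by apply: Cdef_all => j; case: (s j); [apply: Cdef_true|apply: Cdef_not].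
apply: qe_ext (qe_exT Hs) => xA xB xC; rewrite H; split=> [[s [H1 H2]] [j [HjA HjC]]|nH].
  by move: (H1 j) (H2 j); case: (s j).
exists [ffun j => `[< ~ PA j xA xB >]]; split=> j; rewrite ffunE; case: asboolP => //.
by move=> /contrapT HjA HjC; apply: nH; exists j.
Qed.

End Predicates.

Lemma qe_exA cA cB cC s P : @qe (cext cA s) cB cC P ->
  qe (fun xA xB xC => exists y : dom As s, P (xext xA y) xB xC).
Proof.
move=> [J [PA [PC [HA HC H]]]].
have Hj j : Adef (fun xA xB => exists y : dom As s, PA j (xext xA y) xB).
  have [p Hp] := HA j.
  pose g (v : var (csum (cext cA s) (rctx cB))) : asg (dom As) (cext (csum cA (rctx cB)) s) -> dom As (vsort v) :=
    match v return asg (dom As) (cext (csum cA (rctx cB)) s) -> dom As (@vsort _ (csum (cext cA s) (rctx cB)) v) with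
    | inl (Some v) => fun x => x (Some (inl v)) | inl None => fun x => x None
    | inr v => fun x => x (Some (inr v)) end.
  have Hg v : term_fun (g v).
    case: v => [[v|]|v].
    - exact: (@term_fun_var _ As (cext (csum cA (rctx cB)) s) (Some (inl v))).
    - exact: (@term_fun_var _ As (cext (csum cA (rctx cB)) s) None).
    - exact: (@term_fun_var _ As (cext (csum cA (rctx cB)) s) (Some (inr v))).
  have := Adef_of (definable_ex (definable_comp Hg (@definable_sat _ As _ p))).
  apply: Adef_ext => xA xB; split=> -[y Hy]; exists y; move: Hy; rewrite -Hp; apply: sat_imp => -[[v|]|v] //.
apply: qe_ext (qe_exT (fun j => qe_AC (Hj j) (HC j))) => xA xB xC.
split=> [[j [[y Hy] Hj']]|[y]]; first by exists y; apply/H; exists j.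
by rewrite H => -[j [HjA HjC]]; exists j; split=> //; exists y.
Qed.

Lemma qe_exC cA cB cC s P : @qe cA cB (cext cC s) P ->
  qe (fun xA xB xC => exists y : dom Cs s, P xA xB (xext xC y)).
Proof.
move=> [J [PA [PC [HA HC H]]]].
have Hj j : Cdef (fun xC xB => exists y : dom Cs s, PC j (xext xC y) xB).
  have [p Hp] := HC j.
  pose rC := cmap (C_sort XC) cB.
  pose g (v : var (csum (cext cC s) rC)) : asg (dom Cs) (cext (csum cC rC) s) -> dom Cs (vsort v) :=
    match v return asg (dom Cs) (cext (csum cC rC) s) -> dom Cs (@vsort _ (csum (cext cC s) rC) v) with
    | inl (Some v) => fun x => x (Some (inl v)) | inl None => fun x => x None
    | inr v => fun x => x (Some (inr v)) end.
  have Hg v : term_fun (g v).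
    case: v => [[v|]|v].
    - exact: (@term_fun_var _ Cs (cext (csum cC rC) s) (Some (inl v))).
    - exact: (@term_fun_var _ Cs (cext (csum cC rC) s) None).
    - exact: (@term_fun_var _ Cs (cext (csum cC rC) s) (Some (inr v))).
  have := Cdef_of (definable_ex (definable_comp Hg (@definable_sat _ Cs _ p))).
  apply: Cdef_ext => xA xB; split=> -[y Hy]; exists y; move: Hy; rewrite -Hp; apply: sat_imp => -[[v|]|v] //.
apply: qe_ext (qe_exT (fun j => qe_AC (HA j) (Hj j))) => xA xB xC.
split=> [[j [Hj' [y Hy]]]|[y]]; first by exists y; apply/H; exists j.
by rewrite H => -[j [HjA HjC]]; exists j; split=> //; exists y.
Qed.
End QuantifierElimination.

(** * Eliminating a quantifier over a sort of B *)

Section EliminationB.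
Variables (L0 : language) (Phi : set (ppf (ab_lang L0))) (A B C : ab_str L0).
Variables (E : pure_ses Phi A B C).
Variables (XA : expansion (quot_lang Phi)) (YA : exp_str (quot_ab Phi A) XA).
Variables (XC : expansion (ab_lang L0)) (YC : exp_str C XC).
Hypothesis HPhi : fundamental_system Phi B.
Local Notation L := (ab_lang L0).
Local Notation As := (Astar YA).
Local Notation Cs := (Cstar YC).
Local Notation M := (M E YA YC).
Local Notation Adef := (Adef E (YA := YA)).
Local Notation Cdef := (Cdef E (YC := YC)).
Local Notation qe := (qe E (YA := YA) (YC := YC)).
Local Notation rctx := (rctx XA).
Local Notation rval := (rval E YA).
Local Notation rhoT pt y := (@rho _ _ _ _ _ E (projT1 pt) (evals (N := B) (projT2 pt) y)).

Lemma term_fun_zero (d : ctx (srt (LA XA))) s : @term_fun _ As d (A_sort XA s) (fun=> (0 : car A s)%R).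
Proof.
exists (@App (LA XA) d (inl (inl (@Zero L0 s : fsym L))) (@of_ord0 _)).
by [].
Qed.

Lemma Adef_rho_zero cA cB (pt : phi_term Phi cB) :
  Adef (fun (xA : asg (dom As) cA) xB =>
    rhoT pt xB =
      pi_phi (@tzero _ (car A) (phi_ar (projT1 pt)))).
Proof.
apply: (Adef_of E (cA := cA) (P := fun x : asg (dom As) (csum cA (rctx cB)) =>
  x (inr pt) = pi_phi (@tzero _ (car A) (phi_ar (projT1 pt))))).
apply: definable_eq; first exact: (@term_fun_var _ As (csum cA (rctx cB)) (inr pt)).
apply: (pi_term_fun (g := fun i _ => 0%R)) => i; exact: term_fun_zero.
Qed.

Lemma Cdef_sat cC cB (p : @formula L cB) : Cdef (fun (xC : asg (dom Cs) cC) xB => @sat L C cB p (nus E xB)).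
Proof.
pose g v (x : asg (dom Cs) (csum cC (cmap (C_sort XC) cB))) := x (inr v).
have Hg v : term_fun (g v) by exact: (@term_fun_var _ Cs (csum cC (cmap (C_sort XC) cB)) (inr v)).
exact: (Cdef_of E (cC := cC) (definable_comp Hg (C_definable YC p))).
Qed.

Lemma qe_pp cA cB cC (p : @formula L cB) : is_pp p ->
  qe (fun (xA : asg (dom As) cA) xB (xC : asg (dom Cs) cC) => @sat L B cB p xB).
Proof.
move=> ppp; have [k [g Hg]] := fundamental_ctx HPhi ppp.
have HA := Adef_all (fun j => Adef_rho_zero cA (g j)).
apply: qe_ext (qe_AC HA (Cdef_sat cC p)) => xA xB xC.
by rewrite (pp_B E xB ppp Hg); split=> -[].
Qed.

Section Exists.
Variables (cA : ctx (srt (LA XA))) (cB : ctx (srt L)) (cC : ctx (srt (LC XC))) (s : srt L).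
Variables (n : nat) (tau : 'I_n -> phi_term Phi (cext cB s)).

Definition in_domain (I : {ffun 'I_n -> bool}) (z : asg (car C) (cext cB s)) :=
  forall i, ppset C (sval (projT1 (tau i))) (evals (N := C) (projT2 (tau i)) z) <-> I i.

(** The rho-values at b + iota(aa) under the pattern [I], where b satisfies the positive conditions
    of [I]. They do not depend on b. *)
Definition rho_tau (I : {ffun 'I_n -> bool}) (aa : asg (car A) (cext cB s)) :
    asg (dom As) (Arity (fun i => Aquot_sort XA (projT1 (tau i)))) :=
  fun i => @pi_phi _ _ A (projT1 (tau i)) (if I i then evals (N := A) (projT2 (tau i)) aa
    else @tzero _ (car A) (phi_ar (projT1 (tau i)))).

(** Only the positive conditions of the pattern are collected, which keeps the formula pp; the
    negative ones are left to the C-side. *)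
Lemma domain_formula (I : {ffun 'I_n -> bool}) : exists p : @formula L (cext cB s), is_pp p /\
  forall (N : str L) x, @sat L N _ p x <->
    forall i, I i -> ppset N (sval (projT1 (tau i))) (evals (projT2 (tau i)) x).
Proof.
have [|p [ppp Hp]] := @pp_conj L0 (cext cB s) n
  (fun i => if I i then formula_subst (pp_fm (sval (projT1 (tau i)))) (projT2 (tau i)) else Top).
  by move=> i; case: (I i) => //; rewrite is_pp_formula_subst pp_ok.
exists p; split=> // N x; rewrite Hp.
split=> H i; have := H i; case: (I i) => //; first by rewrite ppset_phi_term.
by move=> /(_ isT); rewrite -ppset_phi_term.
Qed.

(* Projection along a variable [y] of [B]: the values of the rho-terms at
   [(x, y)] that occur are those of the form pi(t(a', a)), where [a'] is
   determined by [x] up to the pp-formula "exists y". *)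
Lemma exists_B_split (I : {ffun 'I_n -> bool}) : exists k (g : 'I_k -> phi_term Phi cB),
  forall (xB : asg (car B) cB) (Q : asg (dom As) (Arity (fun i => Aquot_sort XA (projT1 (tau i)))) -> Prop)
    (R : asg (car C) (cext cB s) -> Prop),
  (exists y, [/\ Q (fun i => rhoT (tau i) (xext xB y)),
      R (nus E (xext xB y)) & in_domain I (nus E (xext xB y))]) <->
  (exists aa : asg (car A) (cext cB s),
    (forall j, pi_phi (evals (N := A) (projT2 (g j)) (fun v => aa (Some v))) =
       rhoT (g j) xB) /\
    Q (rho_tau I aa)) /\
  (exists z, R (xext (nus E xB) z) /\ in_domain I (xext (nus E xB) z)).
Proof.
have [chi [ppchi Hchi]] := domain_formula I.
have ppEx : is_pp (Ex chi) by [].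
(* Once [nu x] satisfies the quantified formula in C, matching the values pi(g(a)) and rho(g(x))
   amounts to x - iota(a) lying in its solution group in B. *)
have [k [g Hg]] := fundamental_ctx HPhi ppEx.
exists k, g => xB Q R.
have nus_xext (y : car B s) : nus E (xext xB y) = xext (nus E xB) (prj E y).
  by apply: funD => -[v|].
have xext_eq (x : asg (car B) (cext cB s)) : xext (fun v => x (Some v)) (x None) = x.
  by apply: funD => -[v|].
have evalsS (b : asg (car B) cB) (x : asg (car A) cB) j :
    evals (N := B) (projT2 (g j)) (tadd b (incs E x)) =
    tadd (evals (N := B) (projT2 (g j)) b) (incs E (evals (N := A) (projT2 (g j)) x)).
  apply: funD => v; rewrite /evals eval_add /tadd; congr (_ + _)%R.
  by rewrite /incs (@morphism_eval _ A B _ _ _ _ x (inc_morph E)).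
have rho_val (y : car B s) (bb : asg (car B) (cext cB s)) (aa : asg (car A) (cext cB s)) :
    in_domain I (nus E (xext xB y)) -> @sat L B _ chi bb -> xext xB y = tadd bb (incs E aa) ->
    (fun i => rhoT (tau i) (xext xB y)) = rho_tau I aa.
  move=> Hdom Hbb exy; apply: funD => i; rewrite /rho_tau.
  case Ii: (I i).
    have -> : evals (N := B) (projT2 (tau i)) (xext xB y) =
        tadd (evals (N := B) (projT2 (tau i)) bb) (incs E (evals (N := A) (projT2 (tau i)) aa)).
      rewrite exy; apply: funD => v; rewrite /evals eval_add /tadd; congr (_ + _)%R.
      by rewrite /incs (@morphism_eval _ A B _ _ _ _ aa (inc_morph E)).
    by apply: rho_inside; apply: (Hchi B bb).1.
  apply: rho_outside => H; have := (Hdom i).1; rewrite Ii => H'.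
  suff : false by []. apply: H'; move: H; apply: sat_imp => v.
  by rewrite /nus /evals (@morphism_eval _ B C _ _ _ _ (xext xB y) (prj_morph E)).
have dom_chi (z : asg (car C) (cext cB s)) : in_domain I z -> @sat L C _ chi z.
  by move=> H; apply/(Hchi C) => i Ii; apply/H.
split=> [[y [HQ HR Hdom]]|[[aa [Haa HQ]] [z [HR Hdom]]]].
  have [bb [aa [Hbb exy]]] := (pp_nus E (xext xB y) ppchi).1 (dom_chi _ Hdom).
  split; last by exists (prj E y); rewrite -nus_xext.
  exists aa; split; last by rewrite -(rho_val _ _ _ Hdom Hbb exy).
  move=> j; have exB : xB = tadd (fun v => bb (Some v)) (incs E (fun v => aa (Some v))).
    by apply: funD => v; have := congr1 (fun f => f (Some v)) exy.
  rewrite exB evalsS rho_inside //; apply: (Hg _).1.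
  by exists (bb None); rewrite xext_eq.
have [y0 ey0] := prj_surj E z.
have Hdom0 : in_domain I (nus E (xext xB y0)) by rewrite nus_xext ey0.
have [bb [aa0 [Hbb exy]]] := (pp_nus E (xext xB y0) ppchi).1 (dom_chi _ Hdom0).
(* Both [aa] and [aa0] match the rho-values of x on [g], so by purity their difference solves the
   quantified formula in A. The witness [a1] corrects the last coordinate. *)
pose a' : asg (car A) cB := fun v => (aa (Some v) - aa0 (Some v))%R.
have Ha' : @sat L A cB (Ex chi) a'.
  apply/(fundamental_sub E ppEx Hg) => j.
  have := Haa j; have exB : xB = tadd (fun v => bb (Some v)) (incs E (fun v => aa0 (Some v))).
    by apply: funD => v; have := congr1 (fun f => f (Some v)) exy.
  rewrite exB evalsS rho_inside; last first.
    by apply: (Hg _).1; exists (bb None); rewrite xext_eq.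
  move=> /pi_phi_eq; apply: sat_imp => v.
  exact: esym (eval_sub (projT2 (g j) v) (fun v => aa (Some v)) (fun v => aa0 (Some v))).
have [a1 Ha1] := Ha'.
(* y0 is corrected by an element of A so that (x, y) becomes bb' + inc aa *)
pose y : car B s := (y0 + inc E (aa None - aa0 None - a1))%R.
pose bb' := tsub bb (incs E (xext a' a1)).
have Hbb' : @sat L B _ chi bb' by apply: pp_sub => //; apply/pp_incs.
have exy' : xext xB y = tadd bb' (incs E aa).
  apply: funD => -[v|] /=; rewrite /tadd /bb' /tsub /incs /=.
    have := congr1 (fun f => f (Some v)) exy; rewrite /tadd /incs /= => ->.
    by rewrite /a' (morphism_sub _ _ (inc_morph E)) opprB addrA subrK.
  have := congr1 (fun f => f None) exy; rewrite /tadd /incs /y /= => ->.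
  rewrite !(morphism_sub _ _ (inc_morph E)) -(addrA (bb None)).
  by rewrite (addrAC (inc E (aa None))) (addrC (inc E (aa0 None))) subrK addrA addrAC.
have ny : prj E y = z.
  by rewrite /y (morphism_add _ _ (prj_morph E)) prj_inc addr0.
exists y; rewrite nus_xext ny; split=> //.
by rewrite (rho_val _ _ _ _ Hbb' exy') // nus_xext ny.
Qed.

Lemma Adef_exists_B (I : {ffun 'I_n -> bool}) k (g : 'I_k -> phi_term Phi cB)
    (p : formula (csum cA (Arity (fun i => Aquot_sort XA (projT1 (tau i)))))) :
  Adef (fun (xA : asg (dom As) cA) xB => exists aa : asg (car A) (cext cB s),
    (forall j, pi_phi (evals (N := A) (projT2 (g j)) (fun v => aa (Some v))) =
       rhoT (g j) xB) /\
    @sat _ As _ p (xsum xA (rho_tau I aa))).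
Proof.
pose ca := cmap (A_sort XA) (cext cB s); pose d := csum cA (rctx cB); pose e := csum ca d.
have HtS i v : @term_fun _ As e (A_sort XA (asort v)) (fun x => @eval L A _ (lpart x : asg (car A) (cext cB s)) _ (projT2 (tau i) v)).
  apply: (term_fun_comp (g := fun u (x : asg (dom As) e) => x (inl u)) _ (A_term_fun YA (projT2 (tau i) v))) => u.
  exact: (@term_fun_var _ As e (inl u)).
have Htg j v : @term_fun _ As e (A_sort XA (asort v))
    (fun x => @eval L A cB (fun u => (lpart x : asg (car A) (cext cB s)) (Some u)) _ (projT2 (g j) v)).
  apply: (@term_fun_comp _ As (cmap (A_sort XA) cB) e _ (fun u x => x (inl (Some u))) _ _ (A_term_fun YA (projT2 (g j) v))) => u.
  exact: (@term_fun_var _ As e (inl (Some u))).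
have D1 : definable (fun x : asg (dom As) e => forall j,
    pi_phi (evals (N := A) (projT2 (g j)) (fun v => (lpart x : asg (car A) (cext cB s)) (Some v))) = rpart (rpart x) (g j)).
  apply: (definable_all (P := fun j (x : asg (dom As) e) =>
    pi_phi (evals (N := A) (projT2 (g j)) (fun v => (lpart x : asg (car A) (cext cB s)) (Some v))) = rpart (rpart x) (g j))) => j.
  apply: (@definable_eq _ As e (Aquot_sort XA (projT1 (g j)))); last exact: (@term_fun_var _ As e (inr (inr (g j)))).
  exact: (pi_term_fun (YA := YA) (d := e) (Htg j)).
have D2 : definable (fun x : asg (dom As) e => @sat _ As _ p (xsum (lpart (rpart x)) (rho_tau I (lpart x)))).
  pose G (v : var (csum cA (Arity (fun i => Aquot_sort XA (projT1 (tau i)))))) :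
      asg (dom As) e -> dom As (vsort v) :=
    match v return asg (dom As) e -> dom As (@vsort _ (csum cA (Arity (fun i => Aquot_sort XA (projT1 (tau i))))) v) with
    | inl v => fun x => x (inr (inl v)) | inr i => fun x => rho_tau I (lpart x) i end.
  have HG v : term_fun (G v).
    case: v => [v|i]; first exact: (@term_fun_var _ As e (inr (inl v))).
    rewrite /G /rho_tau; case: (I i); first exact: (pi_term_fun (YA := YA) (d := e) (HtS i)).
    apply: (pi_term_fun (YA := YA) (g := fun i _ => 0%R)) => v; exact: term_fun_zero.
  have := definable_comp HG (@definable_sat _ As _ p); apply: definable_ext => x.
  by apply: sat_ext => -[].
pose P (aa : asg (dom As) ca) (x : asg (dom As) d) := (forall j,
    pi_phi (evals (N := A) (projT2 (g j)) (fun v => (aa : asg (car A) (cext cB s)) (Some v))) = rpart x (g j)) /\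
  @sat _ As _ p (xsum (lpart x) (rho_tau I aa)).
exact: (Adef_of E (@definable_exs _ As ca d (@tzero _ (car A) (cext cB s)) P (definable_and D1 D2))).
Qed.

Lemma Cdef_exists_B (I : {ffun 'I_n -> bool}) (q : formula (csum cC (cmap (C_sort XC) (cext cB s)))) :
  Cdef (fun (xC : asg (dom Cs) cC) xB => exists z : car C s,
    @sat _ Cs _ q (xsum xC (xext (nus E xB) z : asg (dom Cs) (cmap (C_sort XC) (cext cB s)))) /\
    in_domain I (xext (nus E xB) z)).
Proof.
pose rC := cmap (C_sort XC) cB; pose e := cext (csum cC rC) (C_sort XC s).
pose ext (x : asg (dom Cs) e) : asg (car C) (cext cB s) :=
  fun o => match o return car C (@vsort _ (cext cB s) o) with
    | Some v => x (Some (inr v)) | None => x None end.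
have Hext o : @term_fun _ Cs e (C_sort XC (vsort o)) (fun x => ext x o).
  case: o => [v|]; first exact: (@term_fun_var _ Cs e (Some (inr v))).
  exact: (@term_fun_var _ Cs e None).
have D1 : definable (fun x : asg (dom Cs) e => @sat _ Cs _ q
    (xsum (fun v => x (Some (inl v))) (ext x : asg (dom Cs) (cmap (C_sort XC) (cext cB s))))).
  pose G (v : var (csum cC (cmap (C_sort XC) (cext cB s)))) : asg (dom Cs) e -> dom Cs (vsort v) :=
    match v return asg (dom Cs) e -> dom Cs (@vsort _ (csum cC (cmap (C_sort XC) (cext cB s))) v) with
    | inl v => fun x => x (Some (inl v)) | inr o => fun x => ext x o end.
  have HG v : term_fun (G v).
    case: v => [v|o]; first exact: (@term_fun_var _ Cs e (Some (inl v))).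
    exact: Hext.
  have := definable_comp HG (@definable_sat _ Cs _ q); apply: definable_ext => x.
  by apply: sat_ext => -[].
have D2 : definable (fun x : asg (dom Cs) e => in_domain I (ext x)).
  apply: definable_all => i; apply: definable_iff; last exact: definable_cst.
  have := definable_comp (c := cmap (C_sort XC) (cext cB s)) Hext
    (C_definable YC (formula_subst (pp_fm (sval (projT1 (tau i)))) (projT2 (tau i)))).
  apply: definable_ext => x; exact: sat_formula_subst.
have := Cdef_of E (definable_ex (definable_and D1 D2)).
apply: Cdef_ext => xC xB.
have ex z : ext (xext (xsum xC (nus E xB : asg (dom Cs) rC)) z) = xext (nus E xB) z.
  by apply: funD => -[].
by split=> -[z [H1 H2]]; exists z; move: H1 H2; rewrite ex.
Qed.
End Exists.

(** An A-condition involves finitely many rho-terms. Splitting into the 2^n patterns of which of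
    them are in their domain makes the quantifier fall apart into an A-quantifier and a
    C-quantifier. *)
Lemma qe_exB cA cB cC s (P : asg (dom As) cA -> asg (car B) (cext cB s) -> asg (dom Cs) cC -> Prop) :
  qe P -> qe (fun xA xB xC => exists y : car B s, P xA (xext xB y) xC).
Proof.
move=> [J [PA [PC [HA HC H]]]].
have Hj j : qe (fun (xA : asg (dom As) cA) xB (xC : asg (dom Cs) cC) =>
    exists y : car B s, PA j xA (xext xB y) /\ PC j xC (xext xB y)).
  have [p Hp] := HA j; have [q Hq] := HC j.
  have [n [tau [inj [p' Hp']]]] := formula_arity_right p.
  have HI (I : {ffun 'I_n -> bool}) : qe (fun (xA : asg (dom As) cA) xB (xC : asg (dom Cs) cC) =>
      exists y : car B s, [/\ @sat _ As _ p' (xsum xA (pick_vars tau (rval (xext xB y)))),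
        @sat _ Cs _ q (xsum xC (nus E (xext xB y) : asg (dom Cs) (cmap (C_sort XC) (cext cB s))))
        & in_domain tau I (nus E (xext xB y))]).
    have [k [g Hg]] := exists_B_split tau I.
    apply: qe_ext (qe_AC (Adef_exists_B I g p') (Cdef_exists_B tau I q)) => xA xB xC.
    exact: (iff_sym (Hg xB (fun w => @sat _ As _ p' (xsum xA w))
      (fun z => @sat _ Cs _ q (xsum xC (z : asg (dom Cs) (cmap (C_sort XC) (cext cB s))))))).
  apply: qe_ext (qe_exT HI) => xA xB xC; split=> [[I [y [Hy1 Hy2 _]]]|[y [Hy1 Hy2]]].
    by exists y; rewrite -Hp -Hq Hp'.
  exists [ffun i => `[< ppset C (sval (projT1 (tau i))) (evals (N := C) (projT2 (tau i)) (nus E (xext xB y))) >]].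
  exists y; split; first by apply/Hp'/Hp.
    exact/Hq.
  by move=> i; rewrite ffunE; split=> [/asboolP|/asboolP].
apply: qe_ext (qe_exT Hj) => xA xB xC.
split=> [[j [y Hy]]|[y]]; first by exists y; apply/H; exists j.
by rewrite H => -[j Hy]; exists j, y.
Qed.
End EliminationB.

(** * Elimination for all formulas of the expanded sequence *)

Section RelativeElimination.
Variables (L0 : language) (Phi : set (ppf (ab_lang L0))) (A B C : ab_str L0).
Variables (E : pure_ses Phi A B C).
Variables (XA : expansion (quot_lang Phi)) (YA : exp_str (quot_ab Phi A) XA).
Variables (XC : expansion (ab_lang L0)) (YC : exp_str C XC).
Hypothesis HPhi : fundamental_system Phi B.
Local Notation L := (ab_lang L0).
Local Notation As := (Astar YA).
Local Notation Cs := (Cstar YC).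
Local Notation LM := (LM XA XC).
Local Notation M := (M E YA YC).
Local Notation Adef := (Adef E (YA := YA)).
Local Notation Cdef := (Cdef E (YC := YC)).
Local Notation qe := (qe E (YA := YA) (YC := YC)).

Definition tri (cA : ctx (srt (LA XA))) (cB : ctx (srt L)) (cC : ctx (srt (LC XC))) : ctx (srt LM) :=
  csum (csum (cmap (SA XC) cA) (cmap (SB XA XC) cB)) (cmap (SC XA (XC:=XC)) cC).

Definition tri_asg cA cB cC (xA : asg (dom As) cA) (xB : asg (car B) cB) (xC : asg (dom Cs) cC) :
    asg (dom M) (tri cA cB cC) :=
  fun v => match v return dom M (@vsort _ (tri cA cB cC) v) with
    | inl (inl v) => xA v | inl (inr v) => xB v | inr v => xC v end.

(* Quantifying over all distributions of the variables of [c] among the three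
   sorts makes the class stable under the quantifiers of each sort. *)
Definition Qe (c : ctx (srt LM)) (P : asg (dom M) c -> Prop) :=
  forall cA cB cC (g : forall v : var c, asg (dom M) (tri cA cB cC) -> dom M (vsort v)),
  (forall v, projection (g v)) ->
  qe (fun xA xB xC => P (fun v => g v (tri_asg xA xB xC))).

(* The new variable is adjoined to one of the three contexts, by [h]. *)
Lemma Qe_shift c s P cA cB cC cA' cB' cC'
    (g : forall v : var c, asg (dom M) (tri cA cB cC) -> dom M (vsort v))
    (h : forall w : var (tri cA cB cC), asg (dom M) (tri cA' cB' cC') -> dom M (vsort w))
    (n : asg (dom M) (tri cA' cB' cC') -> dom M s) :
  @Qe (cext c s) P -> (forall v, projection (g v)) -> (forall w, projection (h w)) ->
  projection n ->
  qe (fun xA xB xC => P (xext (fun v => g v (fun w => h w (tri_asg xA xB xC)))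
    (n (tri_asg xA xB xC)))).
Proof.
move=> HP Hg Hh Hn.
pose g' (o : var (cext c s)) : asg (dom M) (tri cA' cB' cC') -> dom M (vsort o) :=
  match o return asg (dom M) (tri cA' cB' cC') -> dom M (@vsort _ (cext c s) o) with
  | Some v => fun x => g v (fun w => h w x) | None => n end.
have Hg' o : projection (g' o).
  by case: o => [v|]; [exact: (projection_comp Hh (Hg v)) | exact: Hn].
apply: qe_ext (HP _ _ _ g' Hg') => xA xB xC.
by rewrite (_ : (fun o => g' o _) = xext (fun v => g v (fun w => h w (tri_asg xA xB xC)))
  (n (tri_asg xA xB xC))) //; apply: funD => -[].
Qed.

Lemma Qe_ex c s P : @Qe (cext c s) P -> Qe (fun x => exists y, P (xext x y)).
Proof.
move=> HP cA cB cC g Hg; case: s P HP => s P HP.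
- pose t := tri (cext cA s) cB cC.
  pose h (w : var (tri cA cB cC)) : asg (dom M) t -> dom M (vsort w) :=
    match w return asg (dom M) t -> dom M (@vsort _ (tri cA cB cC) w) with
    | inl (inl v) => fun x => x (inl (inl (Some v)))
    | inl (inr v) => fun x => x (inl (inr v)) | inr v => fun x => x (inr v) end.
  have Hh w : projection (h w).
    case: w => [[v|v]|v]; [exact: (@projection_var _ M t (inl (inl (Some v))))
      |exact: (@projection_var _ M t (inl (inr v)))|exact: (@projection_var _ M t (inr v))].
  apply: qe_ext (qe_exA (Qe_shift HP Hg Hh (@projection_var _ M t (inl (inl None))))) => xA xB xC.
  have ee (y : dom As s) : (fun w => h w (tri_asg (xext xA y) xB xC)) = tri_asg xA xB xC.
    by apply: funD => -[[w|w]|w].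
  by split=> -[y Hy]; exists y; move: Hy; rewrite ee.
- pose t := tri cA (cext cB s) cC.
  pose h (w : var (tri cA cB cC)) : asg (dom M) t -> dom M (vsort w) :=
    match w return asg (dom M) t -> dom M (@vsort _ (tri cA cB cC) w) with
    | inl (inl v) => fun x => x (inl (inl v))
    | inl (inr v) => fun x => x (inl (inr (Some v))) | inr v => fun x => x (inr v) end.
  have Hh w : projection (h w).
    case: w => [[v|v]|v]; [exact: (@projection_var _ M t (inl (inl v)))
      |exact: (@projection_var _ M t (inl (inr (Some v))))|exact: (@projection_var _ M t (inr v))].
  apply: qe_ext (qe_exB HPhi (Qe_shift HP Hg Hh (@projection_var _ M t (inl (inr None))))) => xA xB xC.
  have ee (y : car B s) : (fun w => h w (tri_asg xA (xext xB y) xC)) = tri_asg xA xB xC.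
    by apply: funD => -[[w|w]|w].
  by split=> -[y Hy]; exists y; move: Hy; rewrite ee.
- pose t := tri cA cB (cext cC s).
  pose h (w : var (tri cA cB cC)) : asg (dom M) t -> dom M (vsort w) :=
    match w return asg (dom M) t -> dom M (@vsort _ (tri cA cB cC) w) with
    | inl (inl v) => fun x => x (inl (inl v))
    | inl (inr v) => fun x => x (inl (inr v)) | inr v => fun x => x (inr (Some v)) end.
  have Hh w : projection (h w).
    case: w => [[v|v]|v]; [exact: (@projection_var _ M t (inl (inl v)))
      |exact: (@projection_var _ M t (inl (inr v)))|exact: (@projection_var _ M t (inr (Some v)))].
  apply: qe_ext (qe_exC (Qe_shift HP Hg Hh (@projection_var _ M t (inr None)))) => xA xB xC.
  have ee (y : dom Cs s) : (fun w => h w (tri_asg xA xB (xext xC y))) = tri_asg xA xB xC.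
    by apply: funD => -[[w|w]|w].
  by split=> -[y Hy]; exists y; move: Hy; rewrite ee.
Qed.

Lemma Qe_closed : closed_class Qe.
Proof.
split.
- move=> c P P' e HP cA cB cC g Hg; apply: qe_ext (HP _ _ _ _ Hg) => xA xB xC; exact: e.
- move=> c P P' HP HP' cA cB cC g Hg; exact: (qe_and (HP _ _ _ _ Hg) (HP' _ _ _ _ Hg)).
- exact: Qe_ex.
- move=> c cA cB cC g Hg; exact: qe_A (Adef_true _ _ _ _ I).
- move=> c d P g Hg HP cA cB cC h Hh.
  exact: (HP _ _ _ (fun v x => g v (fun w => h w x)) (fun v => projection_comp Hh (Hg v))).
Qed.

Section Projections.
Variables (cA : ctx (srt (LA XA))) (cB : ctx (srt L)) (cC : ctx (srt (LC XC))).

(** The tag of the sort forces the selected variable to belong to [cA]. The match on the sort states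
    this for every sort, so that the transport inside [projection] can be eliminated. *)
Lemma projection_A s (g : asg (dom M) (tri cA cB cC) -> dom As s) :
  @projection _ M _ (SA XC s) g -> exists h : asg (dom As) cA -> dom As s,
    term_fun h /\ forall xA xB xC, g (tri_asg xA xB xC) = h xA.
Proof.
apply: (@projectionP _ M (tri cA cB cC) (fun s => match s return (asg (dom M) (tri cA cB cC) -> dom M s) -> Prop with
  | SA s => fun g => exists h : asg (dom As) cA -> dom As s,
    term_fun h /\ forall xA xB xC, g (tri_asg xA xB xC) = h xA | _ => fun _ => True end)) => -[[v|v]|v] //=.
by exists (fun x => x v); split=> //; exact: term_fun_var.
Qed.

Lemma projection_B s (g : asg (dom M) (tri cA cB cC) -> car B s) :
  @projection _ M _ (SB XA XC s) g -> exists t : @term L cB s,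
    forall xA xB xC, g (tri_asg xA xB xC) = @eval L B cB xB s t.
Proof.
apply: (@projectionP _ M (tri cA cB cC) (fun s => match s return (asg (dom M) (tri cA cB cC) -> dom M s) -> Prop with
  | SB s => fun g => exists t : @term L cB s,
    forall xA xB xC, g (tri_asg xA xB xC) = @eval L B cB xB s t | _ => fun _ => True end)) => -[[v|v]|v] //=.
by exists (@Var L cB v).
Qed.

Lemma projection_C s (g : asg (dom M) (tri cA cB cC) -> dom Cs s) :
  @projection _ M _ (SC XA s) g -> exists h : asg (dom Cs) cC -> dom Cs s,
    term_fun h /\ forall xA xB xC, g (tri_asg xA xB xC) = h xC.
Proof.
apply: (@projectionP _ M (tri cA cB cC) (fun s => match s return (asg (dom M) (tri cA cB cC) -> dom M s) -> Prop with
  | SC s => fun g => exists h : asg (dom Cs) cC -> dom Cs s,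
    term_fun h /\ forall xA xB xC, g (tri_asg xA xB xC) = h xC | _ => fun _ => True end)) => -[[v|v]|v] //=.
by exists (fun x => x v); split=> //; exact: term_fun_var.
Qed.

Lemma term_fun_A s (h : asg (dom As) cA -> dom As s) : term_fun h ->
  @term_fun _ As (csum cA (rctx XA cB)) s (fun x => h (lpart x)).
Proof.
apply: (term_fun_comp (g := fun v (x : asg (dom As) (csum cA (rctx XA cB))) => x (inl v))) => v.
exact: (@term_fun_var _ As (csum cA (rctx XA cB)) (inl v)).
Qed.

Lemma term_fun_C s (h : asg (dom Cs) cC -> dom Cs s) : term_fun h ->
  @term_fun _ Cs (csum cC (cmap (C_sort XC) cB)) s (fun x => h (lpart x)).
Proof.
apply: (term_fun_comp (g := fun v (x : asg (dom Cs) (csum cC (cmap (C_sort XC) cB))) => x (inl v))) => v.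
exact: (@term_fun_var _ Cs (csum cC (cmap (C_sort XC) cB)) (inl v)).
Qed.

Lemma term_fun_rho (p : {p | Phi p}) (t : terms cB (phi_ar p)) :
  @term_fun _ As (csum cA (rctx XA cB)) (Aquot_sort XA p)
    (fun x => rpart x (existT (fun p => terms cB (pp_ar (sval p))) p t)).
Proof. exact: (@term_fun_var _ As (csum cA (rctx XA cB)) (inr (existT _ p t))). Qed.

Lemma term_fun_nu s (t : @term L cB s) :
  @term_fun _ Cs (csum cC (cmap (C_sort XC) cB)) (C_sort XC s)
    (fun x => @eval L C cB (rpart x) s t).
Proof.
apply: (@term_fun_comp _ Cs (cmap (C_sort XC) cB) _ _ (fun v x => rpart x v) _ _ (C_term_fun YC t)) => v.
exact: (@term_fun_var _ Cs (csum cC (cmap (C_sort XC) cB)) (inr v)).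
Qed.

Lemma eval_nus s (t : @term L cB s) (y : asg (car B) cB) :
  @eval L C cB (nus E y) s t = prj E (@eval L B cB y s t).
Proof. by rewrite (@morphism_eval _ B C _ _ _ t y (prj_morph E)). Qed.

(* The graph of [inc] is read off from the decomposition of the pp-formula
   [y = 0] along the fundamental system. *)
Lemma qe_inc s (h : asg (dom As) cA -> car A s) (t : @term L cB s) :
  @term_fun _ As cA (A_sort XA s) h ->
  qe (fun xA xB (xC : asg (dom Cs) cC) => inc E (h xA) = @eval L B cB xB s t).
Proof.
move=> Hh; pose z : ctx (srt L) := ctx1 s.
pose p : @formula L z := @Eq L z s (@Var L z tt) (@App L z (@Zero L0 s : fsym L) (@of_ord0 _)).
have pB (x : asg (car B) z) : @sat L B z p x <-> x tt = 0%R by [].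
have [k [g Hg]] := fundamental_ctx HPhi (p := p) isT.
pose gt j : terms cB (phi_ar (projT1 (g j))) := fun i => @term_subst L z cB (fun _ => t) _ (projT2 (g j) i).
have D1 : Cdef (fun (xC : asg (dom Cs) cC) xB => prj E (@eval L B cB xB s t) = 0%R).
  have D : definable (fun x : asg (dom Cs) (csum cC (cmap (C_sort XC) cB)) =>
      @eval L C cB (rpart x) s t = 0%R).
    apply: (@definable_eq _ Cs _ (C_sort XC s) _ (fun=> 0%R)); first exact: term_fun_nu.
    by exists (@App (LC XC) _ (inl (@Zero L0 s : fsym L)) (@of_ord0 _)).
  by apply: Cdef_ext (Cdef_of E D) => xC xB; rewrite /= [rpart _](_ : _ = nus E xB) // eval_nus.
have D2 : Adef (fun (xA : asg (dom As) cA) xB => forall j,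
    @rho _ _ _ _ _ E (projT1 (g j)) (evals (N := B) (gt j) xB) =
    pi_phi (evals (N := A) (projT2 (g j)) (fun _ => h xA))).
  apply: Adef_all => j.
  apply: (Adef_of E (P := fun x : asg (dom As) (csum cA (rctx XA cB)) =>
    rpart x (existT (fun p => terms cB (pp_ar (sval p))) (projT1 (g j)) (gt j)) =
    pi_phi (evals (N := A) (projT2 (g j)) (fun _ => h (lpart x))))).
  apply: (@definable_eq _ As _ (Aquot_sort XA (projT1 (g j)))); first exact: term_fun_rho.
  apply: (pi_term_fun (YA := YA)) => i.
  apply: (@term_fun_comp _ As (cmap (A_sort XA) z) _ _ (fun v x => h (lpart x)) _ _
    (A_term_fun YA (projT2 (g j) i))) => v.
  exact: term_fun_A.
apply: qe_ext (qe_AC D2 D1) => xA xB xC.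
have Egt j : evals (N := B) (gt j) xB = evals (N := B) (projT2 (g j)) (fun _ => @eval L B cB xB s t).
  by apply: funD => i; rewrite /evals eval_term_subst.
have rin (x : car A s) j : @rho _ _ _ _ _ E (projT1 (g j)) (evals (N := B) (projT2 (g j)) (fun _ => inc E x)) =
    pi_phi (evals (N := A) (projT2 (g j)) (fun _ => x)).
  rewrite (_ : evals (N := B) _ _ = tadd (@tzero _ (car B) (phi_ar (projT1 (g j)))) (incs E (evals (N := A) (projT2 (g j)) (fun _ => x)))).
    by rewrite rho_inside //; apply: pp_zero; apply: pp_ok.
  apply: funD => i; rewrite /tadd /tzero add0r /incs.
  by rewrite /evals (@morphism_eval _ A B _ z _ _ (fun _ => x) (inc_morph E)).
split=> [[H1 H2]|e]; last first.
  by split=> [j|]; [rewrite Egt -e rin | rewrite -e prj_inc].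
(* Exactness gives a preimage x of the term in A. The rho-conditions then say that x - h satisfies
   the decomposition of the formula y = 0, which by purity is valid in A. *)
have [x ex] := (ses_exact E _).2 H2; rewrite ex; congr (inc E).
have HA := fundamental_sub E (p := p) isT Hg.
apply/esym/eqP; rewrite -subr_eq0; apply/eqP.
apply: ((HA (fun _ => x - h xA)%R).2 _) => j.
have := H1 j; rewrite Egt ex rin => /pi_phi_eq; apply: sat_imp => v.
exact: esym (@eval_sub _ A z _ (projT2 (g j) v) (fun _ => x) (fun _ => h xA)).
Qed.
End Projections.

(** In the sorts of B the atomic conditions are pp-formulas, hence covered by [qe_pp]; the same
    applies to the symbols of B in [Qe_fun] and [Qe_rel]. *)
Lemma Qe_eq s : Qe (fun x : asg (dom M) (csum (ctx1 s) (ctx1 s)) => x (inl tt) = x (inr tt) :> dom M s).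
Proof.
move=> cA cB cC g Hg; have H1 := Hg (inl tt); have H2 := Hg (inr tt).
case: s g {Hg} H1 H2 => s g H1 H2.
- have [h1 [T1 E1]] := projection_A H1; have [h2 [T2 E2]] := projection_A H2.
  have D := Adef_of E (cB := cB) (definable_eq (term_fun_A cB T1) (term_fun_A cB T2)).
  by apply: qe_ext (qe_A YC cC D) => xA xB xC; rewrite E1 E2.
- have [t1 E1] := projection_B H1; have [t2 E2] := projection_B H2.
  apply: qe_ext (qe_pp E YA YC HPhi cA cC (p := Eq t1 t2) isT) => xA xB xC.
  by rewrite E1 E2.
- have [h1 [T1 E1]] := projection_C H1; have [h2 [T2 E2]] := projection_C H2.
  have D := Cdef_of E (cB := cB) (definable_eq (term_fun_C cB T1) (term_fun_C cB T2)).
  by apply: qe_ext (qe_C YA cA D) => xA xB xC; rewrite E1 E2.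
Qed.

Lemma Qe_fun f : Qe (fun x : asg (dom M) (cext (fdom f) (fcod f)) =>
  @fint LM M f (fun i => x (Some i)) = x None).
Proof.
move=> cA cB cC g Hg; have H0 := Hg None; have H i := Hg (Some i).
case: f g {Hg} H0 H => [f|f|f|s|s|p] g H0 H.
- have [h0 [T0 E0]] := projection_A H0.
  have [h Hh] := dep_choice (fun i => projection_A (H i)).
  have D := Adef_of E (cB := cB) (definable_eq (term_fun_app (f := f) (fun i => term_fun_A cB (Hh i).1)) (term_fun_A cB T0)).
  apply: qe_ext (qe_A YC cC D) => xA xB xC /=; rewrite E0.
  rewrite (_ : (fun i => g (Some i) _) = (fun i => h i xA)) //.
  by apply: funD => i; apply: (Hh i).2.
- have [t0 E0] := projection_B H0.
  have [t Ht] := dep_choice (fun i => projection_B (H i)).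
  apply: qe_ext (qe_pp E YA YC HPhi cA cC (p := Eq (App f t) t0) isT) => xA xB xC /=.
  rewrite E0 (_ : (fun i => g (Some i) _) = (fun i => @eval L B cB xB _ (t i))) //.
  by apply: funD => i; apply: Ht.
- have [h0 [T0 E0]] := projection_C H0.
  have [h Hh] := dep_choice (fun i => projection_C (H i)).
  have D := Cdef_of E (cB := cB) (definable_eq (term_fun_app (f := f) (fun i => term_fun_C cB (Hh i).1)) (term_fun_C cB T0)).
  apply: qe_ext (qe_C YA cA D) => xA xB xC /=; rewrite E0.
  rewrite (_ : (fun i => g (Some i) _) = (fun i => h i xC)) //.
  by apply: funD => i; apply: (Hh i).2.
- have [t E0] := projection_B H0; have [h [T1 E1]] := projection_A (H ord0).
  by apply: qe_ext (qe_inc cC t T1) => xA xB xC /=; rewrite E0 E1.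
- have [h0 [T0 E0]] := projection_C H0; have [t E1] := projection_B (H ord0).
  have D := Cdef_of E (cB := cB) (definable_eq (term_fun_nu cC t) (term_fun_C cB T0)).
  apply: qe_ext (qe_C YA cA D) => xA xB xC /=; rewrite E0 E1.
  by rewrite [rpart _](_ : _ = nus E xB) // eval_nus.
- have [h0 [T0 E0]] := projection_A H0.
  have [t Ht] := dep_choice (fun i => projection_B (H i)).
  have D := Adef_of E (cB := cB) (definable_eq (term_fun_rho cA (p := p) t) (term_fun_A cB T0)).
  apply: qe_ext (qe_A YC cC D) => xA xB xC /=; rewrite E0.
  rewrite (_ : (fun i => g (Some i) _) = evals (N := B) t xB) //.
  by apply: funD => i; apply: Ht.
Qed.

Lemma Qe_rel r : Qe (fun x : asg (dom M) (rdom r) => @rint LM M r x).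
Proof.
move=> cA cB cC g Hg; case: r g Hg => r g Hg.
- have [h Hh] := dep_choice (fun i => projection_A (Hg i)).
  have D := Adef_of E (cB := cB) (definable_rel (r := r) (fun i => term_fun_A cB (Hh i).1)).
  apply: qe_ext (qe_A YC cC D) => xA xB xC /=.
  rewrite (_ : (fun i => g i _) = (fun i => h i xA)) //.
  by apply: funD => i; apply: (Hh i).2.
- have [t Ht] := dep_choice (fun i => projection_B (Hg i)).
  apply: qe_ext (qe_pp E YA YC HPhi cA cC (p := @Rel L cB r t) isT) => xA xB xC /=.
  rewrite (_ : (fun i => g i _) = (fun i => @eval L B cB xB _ (t i))) //.
  by apply: funD => i; apply: Ht.
- have [h Hh] := dep_choice (fun i => projection_C (Hg i)).
  have D := Cdef_of E (cB := cB) (definable_rel (r := r) (fun i => term_fun_C cB (Hh i).1)).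
  apply: qe_ext (qe_C YA cA D) => xA xB xC /=.
  rewrite (_ : (fun i => g i _) = (fun i => h i xC)) //.
  by apply: funD => i; apply: (Hh i).2.
Qed.

Lemma qe_formula cA cB cC (p : @formula LM (tri cA cB cC)) :
  qe (fun xA xB xC => @sat _ M _ p (tri_asg xA xB xC)).
Proof.
have Qnot c P : @Qe c P -> Qe (fun x => ~ P x).
  move=> HP dA dB dC g Hg; exact: qe_not (HP _ _ _ _ Hg).
have H := closed_sat Qe_closed Qnot Qe_eq Qe_fun Qe_rel p.
exact: (H _ _ _ (fun v x => x v) (fun v => @projection_var _ M (tri cA cB cC) v)).
Qed.
End RelativeElimination.

(** * Formulas over a definably closed set *)

Section DefinableClosure.
Variables (L : language) (N : str L).

Lemma dcl_term (D : set (elt N)) (HD : D = dcl D) s (t : term (params D) s) :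
  D (mkelt (eval (@pval _ N D) t)).
Proof.
suff : dcl D (mkelt (eval (@pval _ N D) t)) by rewrite -HD.
pose c := csum (ctx1 s) (params D).
exists (Eq (@Var L c (inl tt)) (term_subst (fun v => @Var L c (inr v)) t)).
by apply/seteqP; split=> y; rewrite /sat_over /= eval_term_subst.
Qed.

(** The finitely many parameters that occur become bound variables, each constrained by the formula
    over [H] that defines it. *)
Lemma dcl_formula (D H : set (elt N)) (HD : D `<=` dcl H) (c : ctx (srt L)) (p : formula_over D c) :
  exists q : formula_over H c, forall x, sat_over p x <-> sat_over q x.
Proof.
have [n [tau [inj [p' Hp']]]] := formula_arity_right p.
have Hq i : exists q : formula_over H (ctx1 (projT1 (sval (tau i)))),
    [set y | sat_over q (xone y)] = [set projT2 (sval (tau i))].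
  exact: (HD _ (svalP (tau i))).
have {Hq} [q Hq] := dep_choice Hq.
pose d := csum c (params H); pose e := csum (enum_arity tau) d.
pose R (y : asg (dom N) (enum_arity tau)) (z : asg (dom N) d) :=
  (forall i, sat (q i) (xsum (xone (y i)) (rpart z))) /\ sat p' (xsum (lpart z) y).
have Rdef : definable (fun z : asg (dom N) e => R (lpart z) (rpart z)).
  apply: definable_and.
    apply: (definable_all (P := fun i (z : asg (dom N) e) => sat (q i) (xsum (xone (lpart z i)) (rpart (rpart z))))) => i.
    pose g (v : var (csum (ctx1 (projT1 (sval (tau i)))) (params H))) : asg (dom N) e -> dom N (vsort v) :=
      match v return asg (dom N) e -> dom N (@vsort _ (csum (ctx1 (projT1 (sval (tau i)))) (params H)) v) with
      | inl _ => fun z => z (inl i) | inr v => fun z => z (inr (inr v)) end.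
    have Hg v : term_fun (g v).
      case: v => v; first exact: (@term_fun_var L N e (inl i)).
      exact: (@term_fun_var L N e (inr (inr v))).
    have := definable_comp Hg (@definable_sat _ N _ (q i)); apply: definable_ext => z.
    by apply: sat_ext => -[].
  pose g (v : var (csum c (enum_arity tau))) : asg (dom N) e -> dom N (vsort v) :=
    match v return asg (dom N) e -> dom N (@vsort _ (csum c (enum_arity tau)) v) with
    | inl v => fun z => z (inr (inl v)) | inr i => fun z => z (inl i) end.
  have Hg v : term_fun (g v).
    case: v => v; first exact: (@term_fun_var L N e (inr (inl v))).
    exact: (@term_fun_var L N e (inl v)).
  have := definable_comp Hg (@definable_sat _ N _ p'); apply: definable_ext => z.
  by apply: sat_ext => -[].
have [r Hr] := closed_exs (@definable_closed L N) Rdef.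
exists r => x; rewrite /sat_over /= Hr Hp'; split=> [Hx|[y [Hy1 Hy2]]].
  exists (pick_vars tau (@pval _ N D)); split=> // i.
  have : [set projT2 (sval (tau i))] (projT2 (sval (tau i))) by [].
  by rewrite -Hq.
rewrite (_ : pick_vars tau _ = y) //; apply: funD => i.
have : [set y | sat_over (q i) (xone y)] (y i) by apply: Hy1.
by rewrite Hq => ->.
Qed.
End DefinableClosure.

(* Witnesses: imaginaries of arity 0 with defining formula [Top /\ ... /\ Top]. *)
Lemma dcl_infinite (L : language) (N : str L) (D : set (elt (eq_str N))) :
  D = dcl D -> infinite_set D.
Proof.
move=> HD.
have z0 (s : 'I_0 -> srt L) : asg (dom N) (Arity s) by case.
have [s0 _] : exists s : 'I_0 -> srt L, True.
  by exists (@of_ord0 _).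
pose a0 : arity (srt L) := Arity s0.
pose fix f n : formula (csum a0 a0) := if n is n'.+1 then And Top (f n') else Top.
(* The depth of the defining formula tells the sorts apart, and so the elements [e n]; each of them
   is definable because its sort has a single element. *)
pose fix depth (c : ctx (srt L)) (p : formula c) : nat := if p is And _ q then (depth c q).+1 else 0%N.
have df n : depth _ (f n) = n by elim: n => //= n ->.
have fT n x : @sat L N _ (f n) x by elim: n.
have eqv n : is_equivalence (fun x y : asg (dom N) a0 => sat (f n) (xsum x y)) by split=> *; apply: fT.
pose im n := Imaginary (eqv n).
pose e n : elt (eq_str N) := @mkelt _ (eq_str N) (inr (im n)) (@fint _ (eq_str N) (inr (im n)) (z0 s0)).
have De n : D (e n).
  rewrite HD; exists Top; apply/seteqP; split=> y //= _.
  have [y' <-] := @rep_class_surj _ N (inr (im n)) y.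
  by rewrite (_ : y' = z0 s0) //; apply: funD => -[].
have einj : injective e.
  move=> n m /(congr1 (@projT1 _ _)) es.
  have := congr1 (fun s : srt (eq_lang N) => match s with inr i => depth _ (im_fm i) | _ => 0%N end) es.
  by rewrite /= !df.
apply/infiniteP.
have /card_eqPle[_ H] : (range e #= [set: nat])%card by apply: inj_card_eq => x y _ _; apply: einj.
by apply: card_le_trans H _; apply: subset_card_le => _ [j _ <-].
Qed.

(** * A-formulas and C-formulas over a definably closed set *)

Section FormulasOver.
Variables (L0 : language) (Phi : set (ppf (ab_lang L0))) (A B C : ab_str L0).
Variables (E : pure_ses Phi A B C).
Variables (XA : expansion (quot_lang Phi)) (YA : exp_str (quot_ab Phi A) XA).
Variables (XC : expansion (ab_lang L0)) (YC : exp_str C XC).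
Hypothesis HPhi : fundamental_system Phi B.
Local Notation L := (ab_lang L0).
Local Notation As := (Astar YA).
Local Notation Cs := (Cstar YC).
Local Notation LM := (LM XA XC).
Local Notation M := (M E YA YC).
Local Notation Meq := (Meq E YA YC).
Variable D : set (elt Meq).
Hypothesis HD : D = dcl D.

Definition sortA (s : srt (LA XA)) : srt (eq_lang M) := inl (SA XC s).
Definition sortB (s : srt L) : srt (eq_lang M) := inl (SB XA XC s).
Definition sortC (s : srt (LC XC)) : srt (eq_lang M) := inl (SC XA s).

Lemma A_definable_eq (c : ctx (srt (LA XA))) (p : formula c) :
  @definable _ Meq (cmap sortA c) (fun x => @sat _ As c p x).
Proof.
apply: (@transfer_definable (LA XA) _ As Meq sortA (fun _ => id) (fun _ => id)) => // [f|r].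
  exact: (term_fun_sym Meq (inl (FA XC f : fsym LM))).
exact: (definable_sym Meq (inl (RA XC r : rsym LM))).
Qed.

Lemma C_definable_eq (c : ctx (srt (LC XC))) (p : formula c) :
  @definable _ Meq (cmap sortC c) (fun x => @sat _ Cs c p x).
Proof.
apply: (@transfer_definable (LC XC) _ Cs Meq sortC (fun _ => id) (fun _ => id)) => // [f|r].
  exact: (term_fun_sym Meq (inl (FC XA f : fsym LM))).
exact: (definable_sym Meq (inl (RC XA r : rsym LM))).
Qed.

Lemma B_term_fun_eq (c : ctx (srt L)) s (t : term c s) :
  @term_fun _ Meq (cmap sortB c) (sortB s) (fun x => @eval L B c x s t).
Proof.
apply: (@transfer_term L _ B Meq sortB (fun _ => id) (fun _ => id)) => // f.
exact: (term_fun_sym Meq (inl (FB XA XC f : fsym LM))).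
Qed.

Lemma sub_term_fun (d : ctx (srt (eq_lang M))) s (g h : asg (dom Meq) d -> car B s) :
  @term_fun _ Meq d (sortB s) g -> @term_fun _ Meq d (sortB s) h ->
  @term_fun _ Meq d (sortB s) (fun z => (g z - h z)%R).
Proof.
move=> Hg Hh; pose e : ctx (srt L) := Ctx (fun _ : bool => s).
pose t : @term L e s := @App L e (@Add L0 s : fsym L) (fun k : 'I_2 =>
  if k == ord0 then @Var L e true else @App L e (@Opp L0 s : fsym L) (fun _ : 'I_1 => @Var L e false)).
apply: (@term_fun_comp _ Meq (cmap sortB e) d _ (fun (v : bool) z => if v then g z else h z) _ _
  (B_term_fun_eq t)) => -[].
  exact: Hg.
exact: Hh.
Qed.

Lemma C_of_B_definable_eq (c : ctx (srt L)) (p : formula c) :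
  @definable _ Meq (cmap sortB c) (fun x => @sat L C c p (nus E (x : asg (car B) c))).
Proof.
have := @definable_comp _ Meq (cmap (fun s => sortC (C_sort XC s)) c) (cmap sortB c)
  (fun v x => prj E (x v : car B (@vsort _ c v))) (fun x => @sat L C c p x); apply.
  move=> v.
  exact: (@term_fun_app _ Meq (cmap sortB c) (inl (Fprj XA XC (@vsort _ c v) : fsym LM))
    (fun (_ : 'I_1) x => x v) (fun _ => @term_fun_var _ Meq (cmap sortB c) v)).
apply: (@transfer_definable L _ C Meq (fun s => sortC (C_sort XC s)) (fun _ => id) (fun _ => id)) => // [f|r].
  exact: (term_fun_sym Meq (inl (FC XA (inl f) : fsym LM))).
exact: (definable_sym Meq (inl (RC XA (inl r) : rsym LM))).
Qed.

Lemma B_part_term s (t : term (params (B_part D)) s) :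
  B_part D (@mkelt _ B _ (@eval L B _ (@pval _ _ (B_part D)) s t)).
Proof.
have [t' Ht'] := B_term_fun_eq t.
pose h (v : var (cmap sortB (params (B_part D)))) : @term (eq_lang M) (params D) (vsort v) :=
  @Var (eq_lang M) (params D) (exist _ (B_elt E YA YC (sval v)) (svalP v)).
have := dcl_term HD (term_subst h t').
rewrite eval_term_subst.
have -> : (fun v => eval (@pval _ _ D) (h v)) = (@pval _ _ (B_part D) : asg (dom Meq) (cmap sortB (params (B_part D)))).
  by apply: funD => v.
by rewrite Ht'.
Qed.

Lemma C_part_prj s (y : car B s) : B_part D (@mkelt _ B _ y) ->
  C_part D (@mkelt _ Cs (C_sort XC s) (prj E y)).
Proof.
move=> Dy; have := dcl_term HD (@App (eq_lang M) (params D) (inl (Fprj XA XC s : fsym LM))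
  (fun _ : 'I_1 => @Var (eq_lang M) (params D) (exist _ (B_elt E YA YC (@mkelt _ B _ y)) Dy))).
by [].
Qed.

Section Variables_abc.
Variables (a : arity (srt (LA XA))) (b : arity (srt L)) (c : arity (srt (LC XC))).
Local Notation uc := (uctx a b c).
Local Notation ucq := (uctx_eq E YA YC a b c).
Local Notation withA x := (xsum (part_A x) (@pval _ As (A_part D))).
Local Notation withB x :=
  (xsum (part_B x) (@pval _ B (B_part D) : asg (car B) (params (B_part D)))).
Local Notation withC x := (xsum (part_C x) (@pval _ Cs (C_part D))).

(* [A_sat] and [C_sat] with the parameters of [D] replaced by arbitrary values *)
Definition A_params (w : asg (dom Meq) (params D)) : asg (dom As) (params (A_part D)) :=
  fun e => w (exist _ (A_elt E YC (sval e)) (svalP e)).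
Definition C_params (w : asg (dom Meq) (params D)) : asg (dom Cs) (params (C_part D)) :=
  fun e => w (exist _ (C_elt E YA (sval e)) (svalP e)).
Definition rt_beta_at (w : asg (dom Meq) (params D)) (r : rho_term b D) :
    asg (car B) (phi_ar (rt_phi r)) :=
  fun i => w (exist _ (B_elt E YA YC (@mkelt _ B _ (rt_beta (r := r) i))) (rt_beta_in i)).
Arguments rt_beta_at w r v : clear implicits.
Definition rt_val (xB : asg (car B) b) (r : rho_term b D) : asg (car B) (phi_ar (rt_phi r)) :=
  evals (N := B) (rt_term (r := r)) xB.
Arguments rt_val xB r v : clear implicits.
Definition rho_at (xB : asg (car B) b) (w : asg (dom Meq) (params D)) : asg (dom As) (rho_ctx b D) :=
  fun r => @rho _ _ _ _ _ E (rt_phi r) (tsub (rt_val xB r) (rt_beta_at w r)).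

Definition A_sat_at (p : A_formula a b D) (x : asg (dom M) uc) (w : asg (dom Meq) (params D)) : Prop :=
  @sat _ As _ p (xsum (xsum (A_params w) (part_A x)) (rho_at (part_B x) w)).

Definition C_sat_at (p : C_formula b c D) (x : asg (dom M) uc) (w : asg (dom Meq) (params D)) : Prop :=
  @sat _ Cs _ p (xsum (xsum (C_params w) (part_C x))
    (prjs E (part_B x) : asg (dom Cs) (amap (C_sort XC) b))).

(** The equivalence holds for every value [w] of the parameters, not just for the enumeration of
    [D], so that an A-formula can be followed along a sequence of conjugates. *)
Lemma A_sat_formula (p : A_formula a b D) : exists q : @formula_over _ Meq D ucq,
  forall x w, @sat _ Meq _ q (xsum x w) <-> A_sat_at p x w.
Proof.
pose d : ctx (srt (eq_lang M)) := csum ucq (params D).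
have [q Hq] := A_definable_eq p.
pose G v : asg (dom Meq) d -> dom As (@vsort _ (csum (csum (params (A_part D)) a) (rho_ctx b D)) v) :=
  fun z => xsum (xsum (A_params (rpart z)) (part_A (lpart z : asg (dom M) uc))) (rho_at (part_B (lpart z : asg (dom M) uc)) (rpart z)) v.
have HG v : @term_fun _ Meq d (sortA (vsort v)) (G v).
  case: v => [[e|i]|r].
  - exact: (@term_fun_var _ Meq d (inr (exist _ (A_elt E YC (sval e)) (svalP e)))).
  - exact: (@term_fun_var _ Meq d (inl (inl (inl i)))).
  - apply: (@term_fun_app _ Meq d (inl (Frho XA XC (rt_phi r) : fsym LM))
      (fun i z => (rt_val (part_B (lpart z : asg (dom M) uc)) r i - rt_beta_at (rpart z) r i)%R)) => i.
    apply: sub_term_fun.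
      apply: (@term_fun_comp _ Meq (cmap sortB b) d _ (fun v z => z (inl (inl (inr v)))) _ _
        (B_term_fun_eq (rt_term (r := r) i))) => v.
      exact: (@term_fun_var _ Meq d (inl (inl (inr v)))).
    exact: (@term_fun_var _ Meq d (inr (exist _ (B_elt E YA YC (@mkelt _ B _ (rt_beta (r := r) i))) (rt_beta_in i)))).
have [q' Hq'] := @definable_comp _ Meq (cmap sortA _) d G (fun x => @sat _ As _ p x) HG (A_definable_eq p).
by exists q' => x w; rewrite Hq'.
Qed.

Lemma C_sat_formula (p : C_formula b c D) : exists q : @formula_over _ Meq D ucq,
  forall x w, @sat _ Meq _ q (xsum x w) <-> C_sat_at p x w.
Proof.
pose d : ctx (srt (eq_lang M)) := csum ucq (params D).
pose G v : asg (dom Meq) d -> dom Cs (@vsort _ (csum (csum (params (C_part D)) c) (amap (C_sort XC) b)) v) :=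
  fun z => xsum (xsum (C_params (rpart z)) (part_C (lpart z : asg (dom M) uc)))
    (prjs E (part_B (lpart z : asg (dom M) uc)) : asg (dom Cs) (amap (C_sort XC) b)) v.
have HG v : @term_fun _ Meq d (sortC (vsort v)) (G v).
  case: v => [[e|i]|i].
  - exact: (@term_fun_var _ Meq d (inr (exist _ (C_elt E YA (sval e)) (svalP e)))).
  - exact: (@term_fun_var _ Meq d (inl (inr i))).
  - exact: (@term_fun_app _ Meq d (inl (Fprj XA XC (@asort _ b i) : fsym LM))
      (fun (_ : 'I_1) z => z (inl (inl (inr i)))) (fun _ => @term_fun_var _ Meq d (inl (inl (inr i))))).
have [q' Hq'] := @definable_comp _ Meq (cmap sortC _) d G (fun x => @sat _ Cs _ p x) HG (C_definable_eq p).
by exists q' => x w; rewrite Hq'.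
Qed.

(** With all parameters taken from A*, B and C*, they become extra variables of the three contexts,
    and no imaginary variable is left free. *)
Lemma formula_over_home (H2 : D = dcl (home D)) (p : @formula_over _ Meq D ucq) :
  exists q : @formula LM (tri (csum a (params (A_part D))) (csum b (params (B_part D)))
      (csum c (params (C_part D)))),
  forall x : asg (dom M) uc, @sat_over _ Meq D ucq p x <->
    @sat _ M _ q (@tri_asg _ _ _ _ _ E _ YA _ YC _ _ _
      (withA x)
      (withB x)
      (withC x)).
Proof.
have HDd : D `<=` dcl (home D) by rewrite -H2.
have [p1 Hp1] := dcl_formula HDd p.
set t0 := tri _ _ _.
have sub (v : var (csum ucq (params (home D)))) :
    exists t : @term (eq_lang M) (cmap inl t0) (vsort v), forall x : asg (dom M) uc,
    @eval _ Meq _ (@tri_asg _ _ _ _ _ E _ YA _ YC _ _ _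
      (withA x)
      (withB x)
      (withC x) : asg (dom Meq) (cmap inl t0)) _ t =
    xsum (x : asg (dom Meq) ucq) (@pval _ Meq (home D)) v.
  case: v => [[[i|i]|i]|[e He]].
  - by exists (@Var (eq_lang M) (cmap inl t0) (inl (inl (inl i)))).
  - by exists (@Var (eq_lang M) (cmap inl t0) (inl (inr (inl i)))).
  - by exists (@Var (eq_lang M) (cmap inl t0) (inr (inl i))).
  - have [[[e' De' ee]|[e' De' ee]]|[e' De' ee]] := He; subst e.
    + by exists (@Var (eq_lang M) (cmap inl t0) (inl (inl (inr (exist _ e' De'))))).
    + by exists (@Var (eq_lang M) (cmap inl t0) (inl (inr (inr (exist _ e' De'))))).
    + by exists (@Var (eq_lang M) (cmap inl t0) (inr (inr (exist _ e' De')))).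
have [t Ht] := dep_choice sub.
have [q Hq] := home_formula (formula_subst p1 t).
exists q => x; rewrite Hq Hp1 sat_formula_subst; apply: sat_ext => v.
by rewrite Ht.
Qed.

(** Terms are additive, so t(x, beta) = t(x, 0) - (-t(0, beta)). The subtracted element lies in B(D)
    because [D] is definably closed, which gives the required form of a rho-term. *)
Lemma Adef_A_formula P : Adef E (YA := YA) (cA := csum a (params (A_part D)))
    (cB := csum b (params (B_part D))) P ->
  exists p : A_formula a b D, forall x : asg (dom M) uc, A_sat p x <->
    P (withA x)
      (withB x).
Proof.
move=> [p Hp].
pose cb := csum b (params (B_part D)); pose c0 := csum (csum (params (A_part D)) a) (rho_ctx b D).
pose zero (d : ctx (srt L)) s : @term L d s :=
  @App L d (@Zero L0 s : fsym L) (@of_ord0 _).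
pose opp (d : ctx (srt L)) s (t : @term L d s) : @term L d s :=
  @App L d (@Opp L0 s : fsym L) (fun _ : 'I_1 => t).
have zeroE d s (x : asg (car B) d) : @eval L B d x s (zero d s) = 0%R by [].
pose sx (v : var cb) : @term L b (vsort v) :=
  match v return @term L b (@vsort _ cb v) with inl v => @Var L b v | inr v => zero b _ end.
pose sp (v : var cb) : @term L (params (B_part D)) (vsort v) :=
  match v return @term L (params (B_part D)) (@vsort _ cb v) with
  | inl v => zero _ _ | inr v => @Var L (params (B_part D)) v end.
have split_term s (t : @term L cb s) (x : asg (car B) b) :
    @eval L B cb (xsum x (@pval _ B (B_part D) : asg (car B) (params (B_part D)))) s t =
    (@eval L B b x s (term_subst sx t) -
     @eval L B (params (B_part D)) (@pval _ B (B_part D)) s (opp _ _ (term_subst sp t)))%R.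
  rewrite /= opprK !eval_term_subst -eval_add; apply: (@eval_ext L B) => -[v|v] /=.
    by rewrite /tadd /= addr0.
  by rewrite /tadd /= add0r.
have sub (v : var (csum (csum a (params (A_part D))) (rctx XA cb))) :
    exists t : @term (LA XA) c0 (vsort v), forall x : asg (dom M) uc,
    @eval _ As c0 (xsum (xsum (@pval _ As (A_part D)) (part_A x)) (rho_val x)) _ t =
    xsum (withA x)
      (rval E YA (withB x)) v.
  case: v => [[i|e]|[p0 t]].
  - by exists (@Var (LA XA) c0 (inl (inr i))).
  - by exists (@Var (LA XA) c0 (inl (inl e))).
  - pose r : rho_term b D := @RhoTerm _ _ _ _ _ E _ YA _ YC b D p0 (fun i => term_subst sx (t i))
      (fun i => @eval L B (params (B_part D)) (@pval _ B (B_part D)) _ (opp _ _ (term_subst sp (t i))))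
      (fun i => B_part_term (opp _ _ (term_subst sp (t i)))).
    exists (@Var (LA XA) c0 (inr r)) => x.
    rewrite /= /rho_val /rval /=; congr (rho E); apply: funD => i.
    by rewrite /tsub /= /evals -split_term.
have [t Ht] := dep_choice sub.
exists (formula_subst p t : A_formula a b D) => x.
rewrite /A_sat sat_formula_subst -Hp; apply: sat_ext => v; exact: Ht.
Qed.

Lemma Cdef_C_formula P : Cdef E (YC := YC) (cC := csum c (params (C_part D)))
    (cB := csum b (params (B_part D))) P ->
  exists p : C_formula b c D, forall x : asg (dom M) uc, C_sat p x <->
    P (withC x)
      (withB x).
Proof.
move=> [p Hp]; pose cb := csum b (params (B_part D)).
pose c0 := csum (csum (params (C_part D)) c) (amap (C_sort XC) b).
have sub (v : var (csum (csum c (params (C_part D))) (cmap (C_sort XC) cb))) :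
    exists t : @term (LC XC) c0 (vsort v), forall x : asg (dom M) uc,
    @eval _ Cs c0 (xsum (xsum (@pval _ Cs (C_part D)) (part_C x))
       (prjs E (part_B x) : asg (dom Cs) (amap (C_sort XC) b))) _ t =
    xsum (withC x)
      (nus E (withB x) :
         asg (dom Cs) (cmap (C_sort XC) cb)) v.
  case: v => [[i|e]|[i|[[s y] De]]].
  - by exists (@Var (LC XC) c0 (inl (inr i))).
  - by exists (@Var (LC XC) c0 (inl (inl e))).
  - by exists (@Var (LC XC) c0 (inr i)).
  - by exists (@Var (LC XC) c0 (inl (inl (exist _ (@mkelt _ Cs (C_sort XC s) (prj E y)) (C_part_prj De))))).
have [t Ht] := dep_choice sub.
exists (formula_subst p t : C_formula b c D) => x.
rewrite /C_sat sat_formula_subst -Hp; apply: sat_ext => v; exact: Ht.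
Qed.

(** The two formulas come from the disjunct that holds at [v] in the relative elimination. They are
    used both for the injectivity of the map to pairs of types and for the continuity of its
    inverse. *)
Lemma isolate_AC (H2 : D = dcl (home D)) (p : @formula_over _ Meq D ucq) (v : asg (dom M) uc) :
  @sat_over _ Meq D ucq p v -> exists (pA : A_formula a b D) (pC : C_formula b c D),
  [/\ A_sat pA v, C_sat pC v & forall x : asg (dom M) uc, A_sat pA x -> C_sat pC x ->
    @sat_over _ Meq D ucq p x].
Proof.
have [q Hq] := formula_over_home H2 p.
have [J [PA [PC [HA HC H]]]] := qe_formula E YA YC HPhi q.
rewrite Hq H => -[j [HjA HjC]].
have [pA HpA] := Adef_A_formula (HA j); have [pC HpC] := Cdef_C_formula (HC j).
exists pA, pC; split; [exact/HpA|exact/HpC|] => x /HpA xA /HpC xC.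
by apply/Hq/H; exists j.
Qed.
End Variables_abc.
End FormulasOver.
Arguments rt_val {L0 Phi A B C E XA YA XC YC D b} xB r v.
Arguments rt_beta_at {L0 Phi A B C E XA YA XC YC D b} w r v.

(** * The homeomorphism *)

Lemma type_space_open (F : Type) (Q : set (set F)) (p : F) :
  open [set q : type_space Q | sval q p].
Proof.
set O := (X in open X); have HO : type_subbase O by exists p.
exists [set O]; last by apply/seteqP; split=> [x [_ -> //]|x Ox]; exists O.
move=> _ ->; exists [fset O]%fset; first by move=> i /fset1P ->; rewrite inE.
apply/seteqP; split=> x Hx; first by apply: (Hx O); apply/fset1P.
by move=> i /fset1P ->.
Qed.

Lemma type_space_inj (F : Type) (Q : set (set F)) (q q' : type_space Q) :
  sval q = sval q' -> q = q'.
Proof. by case: q q' => [q Hq] [q' Hq'] /= e; apply: eq_exist. Qed.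

Lemma type_space_continuous (F : Type) (Q : set (set F)) (X : topologicalType) (f : X -> type_space Q) :
  (forall p, open [set x | sval (f x) p]) -> continuous f.
Proof.
move=> H; apply/continuousP => _ [Bs HBs <-].
rewrite openE => x [B BsB fB]; rewrite /interior.
have [I HI eB] := HBs _ BsB.
have HB : nbhs x (f @^-1` B).
  rewrite -eB preimage_bigcap; apply: filter_bigI => O OI.
  have /set_mem [p eO] := HI _ OI.
  have Op := H p; rewrite eO; apply: open_nbhs_nbhs; split; first exact: Op.
  suff : O (f x) by rewrite eO.
  by move: fB; rewrite -eB; apply.
by apply: filterS HB => y By; exists B.
Qed.

(** * Merging realizations of nondividing types *)

Section Main.
Variables (L0 : language) (Phi : set (ppf (ab_lang L0))) (A B C : ab_str L0).
Variables (E : pure_ses Phi A B C).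
Variables (XA : expansion (quot_lang Phi)) (YA : exp_str (quot_ab Phi A) XA).
Variables (XC : expansion (ab_lang L0)) (YC : exp_str C XC).
Hypothesis HPhi : fundamental_system Phi B.
Local Notation L := (ab_lang L0).
Local Notation As := (Astar YA).
Local Notation Cs := (Cstar YC).
Local Notation LM := (LM XA XC).
Local Notation M := (M E YA YC).
Local Notation Meq := (Meq E YA YC).
Local Notation sortB := (sortB E YA YC).
Local Notation tm pt y := (evals (N := B) (projT2 pt) y).
Local Notation inC pt y := (ppset C (sval (projT1 pt)) (nus E y)).
Variables G D : set (elt Meq).
Hypotheses (HGD : G `<=` D) (HD : D = dcl D).
Hypotheses (Hsat : saturated_above M D) (Hhom : strongly_homogeneous_above M D).
Variables (a : arity (srt (LA XA))) (b : arity (srt L)) (c : arity (srt (LC XC))).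
Local Notation uc := (uctx a b c).
Local Notation ucq := (uctx_eq E YA YC a b c).
Local Notation as_pt r := 
  (existT (fun p => terms b (pp_ar (sval p))) (rt_phi r) (rt_term (r := r))).
Variable u : asg (dom M) uc.
Hypothesis H1 : forall p : ppf L, Phi p -> forall X : dom Meq (cquot_sort E YA YC p),
  acl G (@mkelt _ Meq _ X) -> G (@mkelt _ Meq _ X).
Hypothesis H2 : D = dcl (home D).

Let Dinf : infinite_set D. Proof. exact: dcl_infinite HD. Qed.
Let Msat : tuple_saturated M D. Proof. exact: tuple_saturatedP Dinf Hsat. Qed.
Let Mhom : tuple_homogeneous M D. Proof. exact: tuple_homogeneousP Hhom. Qed.
Let Qsat : tuple_saturated Meq D. Proof. exact: eq_saturated Dinf Msat. Qed.
Let Qhom : tuple_homogeneous Meq D. Proof. exact: eq_homogeneous Dinf Msat Mhom. Qed.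
Let Dsmall : small D {e | D e}. Proof. exact: small_sub. Qed.
Let Gsmall : small D {e | G e}.
Proof. by exists sval; split=> [|[e /HGD]//]; exact: eq_sig_hprop. Qed.

Lemma c_coset_eq (p : ppf L) (z z' : asg (car C) (pp_ar p)) :
  c_coset E YA YC z = c_coset E YA YC z' <-> ppset C p (tsub z z').
Proof.
rewrite -(@sat_c_cong _ _ _ _ _ E XA YA XC YC p z z').
exact: (@rep_class_eq _ M (c_imag E YA YC p) z z').
Qed.

Lemma coset_term_fun (d : ctx (srt (eq_lang M))) (p : ppf L)
    (g : forall i, asg (dom Meq) d -> car B (@asort _ (pp_ar p) i)) :
  (forall i, @term_fun _ Meq d (sortB (asort i)) (g i)) ->
  @term_fun _ Meq d (cquot_sort E YA YC p) (fun x => c_coset E YA YC (fun i => prj E (g i x))).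
Proof.
move=> Hg; apply: (@term_fun_app _ Meq d (inr (c_imag E YA YC p)) (fun i x => prj E (g i x))) => i.
exact: (@term_fun_app _ Meq d (inl (Fprj XA XC (@asort _ (pp_ar p) i) : fsym LM))
  (fun (_ : 'I_1) x => g i x) (fun _ => Hg i)).
Qed.

Lemma evals_term_fun (d : ctx (srt (eq_lang M))) s (t : @term L b s) (h : forall v, asg (dom Meq) d -> car B (@vsort _ b v)) :
  (forall v, @term_fun _ Meq d (sortB (vsort v)) (h v)) ->
  @term_fun _ Meq d (sortB s) (fun x => @eval L B b (fun v => h v x) s t).
Proof. by move=> Hh; apply: (@term_fun_comp _ Meq (cmap sortB b) d _ h _ Hh (B_term_fun_eq E YA YC t)). Qed.

(** If the coset were not algebraic over [G], each formula in the type of [beta] over [G] would be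
    realized in infinitely many cosets. The condition nu(t(x) - y) in phi(C) fixes the coset of y,
    so it would divide by [formula_divides_of_classes]. *)
Lemma nondividing_coset (v : asg (dom M) uc) (p : ppf L) (t : terms b (pp_ar p))
    (beta : asg (car B) (pp_ar p)) :
  ~ type_divides G (tp_M D v) ->
  (forall i, B_part D (@mkelt _ B _ (beta i))) ->
  ppset C p (nus E (tsub (evals (N := B) t (part_B v)) beta)) ->
  acl G (@mkelt _ Meq _ (c_coset E YA YC (nus E beta))).
Proof.
move=> nd Dbeta Hv; apply: contrapT => nacl; apply: nd.
pose a' : arity (srt (eq_lang M)) := amap sortB (pp_ar p).
pose d := csum ucq a'.
have Hdiff i : @term_fun _ Meq d (sortB (asort i)) (fun z =>
    (evals (N := B) t (part_B (lpart z : asg (dom M) uc)) i - (rpart z i : car B _))%R).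
  apply: sub_term_fun; last exact: (@term_fun_var _ Meq d (inr i)).
  apply: (@evals_term_fun d _ (t i) (fun v z => z (inl (inl (inr v))))) => k.
  exact: (@term_fun_var _ Meq d (inl (inl (inr k)))).
have [q Hq] := definable_comp (c := cmap sortB (pp_ar p)) Hdiff (C_of_B_definable_eq E YA YC (pp_fm p)).
have {}Hq (x : asg (dom M) uc) (y : asg (car B) (pp_ar p)) :
    @sat _ Meq d q (@xsum _ (dom Meq) ucq a' x y) <->
    ppset C p (nus E (tsub (evals (N := B) t (part_B x)) y)) by rewrite Hq.
exists a', q, (beta : asg (dom Meq) a'); split.
  pose sub (w : var d) : @term (eq_lang M) (csum ucq (params D)) (vsort w) :=
    match w return @term (eq_lang M) (csum ucq (params D)) (@vsort _ d w) with
    | inl w => @Var (eq_lang M) (csum ucq (params D)) (inl w)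
    | inr i => @Var (eq_lang M) (csum ucq (params D))
        (inr (exist _ (B_elt E YA YC (@mkelt _ B _ (beta i))) (Dbeta i))) end.
  have Esub (x : asg (dom Meq) ucq) : @sat_over _ Meq D ucq (formula_subst q sub) x <->
      @sat _ Meq d q (@xsum _ (dom Meq) ucq a' x beta).
    by rewrite /sat_over /= sat_formula_subst; apply: sat_ext => -[].
  exists 1%N, (fun=> formula_subst q sub); split=> [_|x /(_ ord0)]; last by rewrite Esub.
  by apply/Esub/Hq.
pose R (y y' : asg (car B) (pp_ar p)) := ppset C p (nus E (tsub y y')).
apply: (@formula_divides_of_classes _ Meq _ D Dinf Qsat Qhom G Gsmall _ a' q beta R).
- have Hd i : @term_fun _ Meq (csum a' a') (sortB (@asort _ (pp_ar p) i)) (fun z => ((lpart z i : car B _) - (rpart z i : car B _))%R).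
    by apply: sub_term_fun; [exact: (@term_fun_var _ Meq (csum a' a') (inl i)) |
      exact: (@term_fun_var _ Meq (csum a' a') (inr i))].
  exact: (definable_comp (c := cmap sortB (pp_ar p)) Hd (C_of_B_definable_eq E YA YC (pp_fm p))).
- move=> x y y' /(Hq x y) Hy /(Hq x y') Hy'; rewrite /R.
  have := pp_sub (pp_ok p) Hy' Hy; apply: sat_imp => i.
  rewrite /nus /tsub -(morphism_sub _ _ (prj_morph E)); congr (prj E).
  by rewrite opprB addrCA addrAC subrr add0r addrC.
- move=> r rbeta m.
  pose e := csum a' (csum (ctx1 (cquot_sort E YA YC p)) (params G)).
  have Dr : definable (fun z : asg (dom Meq) e => @sat _ Meq _ r (xsum (lpart z) (rpart (rpart z))) /\
      c_coset E YA YC (nus E (lpart z : asg (car B) (pp_ar p))) = lpart (rpart z) tt).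
    apply: definable_and.
      pose g (w : var (csum a' (params G))) : asg (dom Meq) e -> dom Meq (vsort w) :=
        match w return asg (dom Meq) e -> dom Meq (@vsort _ (csum a' (params G)) w) with
        | inl i => fun z => z (inl i) | inr w => fun z => z (inr (inr w)) end.
      have Hg w : term_fun (g w).
        case: w => w; first exact: (@term_fun_var _ Meq e (inl w)).
        exact: (@term_fun_var _ Meq e (inr (inr w))).
      have := definable_comp Hg (@definable_sat _ Meq _ r); apply: definable_ext => z.
      by apply: sat_ext => -[].
    apply: definable_eq; last exact: (@term_fun_var _ Meq e (inr (inl tt))).
    exact: (@coset_term_fun e p (fun i z => z (inl i)) (fun i => @term_fun_var _ Meq e (inl i))).
  have [r' Hr'] := closed_exs (@definable_closed _ Meq) (P := fun (y : asg (dom Meq) a') (z : asg (dom Meq) (csum (ctx1 (cquot_sort E YA YC p)) (params G))) =>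
    @sat _ Meq _ r (xsum y (rpart z)) /\ c_coset E YA YC (nus E (y : asg (car B) (pp_ar p))) = lpart z tt) Dr.
  (* The cosets met by realizations of [r]. This set is defined by [r'] over [G] and contains the
     coset of [beta], so its finiteness would make that coset algebraic. *)
  pose S := [set X : dom Meq (cquot_sort E YA YC p) | exists y : asg (dom Meq) a', @sat_over _ Meq G a' r y /\
    c_coset E YA YC (nus E (y : asg (car B) (pp_ar p))) = X].
  have Sinf : infinite_set S.
    move=> Sfin; apply: nacl; exists r'; split; last by apply/Hr'; exists beta.
    apply: sub_finite_set Sfin => X HX; have [y [Hy1 Hy2]] := (Hr' _).1 HX; by exists y.
  have /infiniteP/card_leP[f] := Sinf.
  pose X (i : 'I_m) := val (f (SigSub (mem_set (I : [set: nat] i)))).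
  have XS i : S (X i) by have := valP (f (SigSub (mem_set (I : [set: nat] i)))) => /set_mem.
  have Xinj : injective X.
    move=> i j /val_inj/(fun e => @inj _ _ _ f _ _ (mem_set I) (mem_set I) e) /(congr1 val) /= eij.
    exact: val_inj.
  have [y Hy] := dep_choice XS.
  exists y; split=> [i|i j ij Rij]; first by case: (Hy i).
  have eX : X i = X j.
    by rewrite -(Hy i).2 -(Hy j).2; apply/c_coset_eq; rewrite -nus_sub.
  by move: ij; rewrite (Xinj _ _ eX) ltnn.
Qed.

Lemma nus_evals_sub (d : arity (srt L)) (t : terms b d) (x y : asg (car B) b) :
  nus E (evals (N := B) t (tsub x y)) = tsub (nus E (evals (N := B) t x)) (nus E (evals (N := B) t y)).
Proof.
by rewrite -nus_sub; congr (nus E _); apply: funD => i; rewrite /evals eval_sub.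
Qed.

Lemma p0_coset (v w : asg (dom M) uc) (pt : phi_term Phi b) : E0_plus G u pt -> p0 G u v -> p0 G u w ->
  inC pt (tm pt (tsub (part_B w) (part_B v))).
Proof.
move=> Hpt [/(_ pt Hpt) Hv _] [/(_ pt Hpt) Hw _].
have {}Hv : inC pt (tm pt (tsub (part_B v) (part_B u))) by exact: Hv.
have {}Hw : inC pt (tm pt (tsub (part_B w) (part_B u))) by exact: Hw.
have := pp_sub (pp_ok _) Hw Hv; apply: sat_imp => i.
by rewrite !nus_evals_sub /tsub opprB addrA subrK.
Qed.

(* For a pair outside of [E0_plus], the coset of [beta] would be algebraic over
   [G], hence in [G] by (H1), contradicting the second part of [p0]. *)
Lemma nondividing_domain (v w : asg (dom M) uc) (pt : phi_term Phi b)
    (beta : asg (car B) (pp_ar (sval (projT1 pt)))) :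
  p0 G u v -> p0 G u w -> ~ type_divides G (tp_M D v) ->
  (forall i, B_part D (@mkelt _ B _ (beta i))) ->
  inC pt (tsub (tm pt (part_B v)) beta) ->
  inC pt (tsub (tm pt (part_B w)) beta).
Proof.
move=> pv pw nd Dbeta Hv.
have [Hpt|nHpt] := pselect (E0_plus G u pt).
  have := pp_add (pp_ok _) (p0_coset Hpt pv pw) Hv; apply: sat_imp => i.
  by rewrite nus_evals_sub !nus_sub /tadd /tsub addrA subrK.
have HX := nondividing_coset nd Dbeta Hv.
have GX := H1 (svalP (projT1 pt)) HX.
by case: (pv.2 pt nHpt _ GX); apply/c_coset_eq; rewrite -nus_sub.
Qed.

Lemma B_definable_eq (d : ctx (srt L)) (p : formula d) :
  @definable _ Meq (cmap sortB d) (fun x => @sat L B d p x).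
Proof.
apply: (@transfer_definable L _ B Meq sortB (fun _ => id) (fun _ => id)) => // [f|r].
  exact: (term_fun_sym Meq (inl (FB XA XC f : fsym LM))).
exact: (definable_sym Meq (inl (RB XA XC r : rsym LM))).
Qed.

(* Purity of the sequence, extended by saturation to all pp-formulas at once. *)
Lemma translate_by_A (y : asg (car B) b) : exists x : asg (car A) b,
  forall pt : phi_term Phi b,
    inC pt (tm pt y) ->
    ppset B (sval (projT1 pt)) (tm pt (tsub y (incs E x))).
Proof.
pose I := {pt : phi_term Phi b | inC pt (tm pt y)}.
pose cA := cmap (fun s => sortA E YA YC (A_sort XA s)) b; pose cB := cmap sortB b.
pose F (i : I) (x : asg (dom Meq) cA) (z : asg (dom Meq) cB) :=
  @sat L B b (formula_subst (pp_fm (sval (projT1 (sval i)))) (projT2 (sval i)))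
    (@tsub _ (car B) b z (incs E (x : asg (car A) b))).
have [||||x Hx] := @Qsat cA cB y _ _ I F.
- exact: small_count.
- exact: small_count.
- move=> i; pose e := csum cA cB.
  have Hd v : @term_fun _ Meq e (sortB (@vsort _ b v)) (fun z => ((rpart z v : car B _) - inc E (lpart z v : car A _))%R).
    apply: sub_term_fun; first exact: (@term_fun_var _ Meq e (inr v)).
    exact: (@term_fun_app _ Meq e (inl (Finc XA XC (@vsort _ b v) : fsym LM))
      (fun (_ : 'I_1) z => z (inl v)) (fun _ => @term_fun_var _ Meq e (inl v))).
  exact: (definable_comp (c := cB) Hd (B_definable_eq _)).
- move=> k g.
  have [|P [ppP HP]] := @pp_conj L0 b k (fun j => formula_subst (pp_fm (sval (projT1 (sval (g j))))) (projT2 (sval (g j)))).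
    by move=> j; rewrite is_pp_formula_subst pp_ok.
  have : @sat L C b P (nus E y).
    apply/HP => j; apply/ppset_phi_term; have := svalP (g j); apply: sat_imp => i.
    by rewrite /nus /evals (@morphism_eval _ B C _ _ _ _ y (prj_morph E)).
  move=> /(pp_nus E y ppP) [z [x [Hz ey]]].
  exists x => j; have := (HP B z).1 Hz j; apply: sat_imp => i.
  by rewrite ey /tsub /tadd addrK.
exists x => pt Hpt; have := Hx (exist _ pt Hpt); by rewrite /F ppset_phi_term.
Qed.

Definition merge (v w : asg (dom M) uc) (x : asg (car A) b) : asg (dom M) uc :=
  fun k => match k return dom M (@vsort _ uc k) with
    | inl (inl i) => part_A v i
    | inl (inr i) => (part_B w i + inc E (x i))%R
    | inr i => part_C w i end.

Lemma nus_merge v w x : nus E (part_B (merge v w x)) = nus E (part_B w).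
Proof. exact: nus_tadd_incs. Qed.

Lemma C_sat_at_merge v w x (p : C_formula b c D) W :
  C_sat_at p (merge v w x) W <-> C_sat_at p w W.
Proof.
rewrite /C_sat_at; apply: sat_ext => -[[k|k]|k] //.
exact: (congr1 (fun f => f k) (nus_merge v w x)).
Qed.

(** Inside the domain, the choice of [x] makes the two arguments congruent modulo phi(B). Outside,
    both sides take the default value, since merging leaves the image under nu equal to that of
    [w]. *)
Lemma rho_merge (v w : asg (dom M) uc) (x : asg (car A) b) (pt : phi_term Phi b) (beta : asg (car B) (pp_ar (sval (projT1 pt)))) :
  let dom_at (z : asg (dom M) uc) := inC pt (tsub (tm pt (part_B z)) beta) in
  (dom_at v <-> dom_at w) ->
  (inC pt (tm pt (tsub (part_B v) (part_B w))) ->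
   ppset B (sval (projT1 pt)) (tm pt (tsub (tsub (part_B v) (part_B w)) (incs E x)))) ->
  @rho _ _ _ _ _ E (projT1 pt) (tsub (tm pt (part_B (merge v w x))) beta) =
  @rho _ _ _ _ _ E (projT1 pt) (tsub (tm pt (part_B v)) beta).
Proof.
move=> dom_at dvw Hx; have [dv|ndv] := pselect (dom_at v).
  have /Hx Hb : inC pt (tm pt (tsub (part_B v) (part_B w))).
    have := pp_sub (pp_ok _) dv (dvw.1 dv); apply: sat_imp => i.
    by rewrite nus_evals_sub !nus_sub /tsub opprB addrA subrK.
  apply/esym; apply: rho_congr; move: Hb; apply: sat_imp => i.
  rewrite /tsub opprB addrA subrK /evals -eval_sub; apply: (@eval_ext L B) => k.
  by rewrite /tsub /merge /part_B /= opprD addrA.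
rewrite !rho_outside //.
have e : nus E (tsub (tm pt (part_B (merge v w x))) beta) =
    nus E (tsub (tm pt (part_B w)) beta).
  rewrite !nus_sub; congr tsub.
  have H (z : asg (dom M) uc) : nus E (tm pt (part_B z)) = fun i => @eval L C b (nus E (part_B z)) _ (projT2 pt i).
    by rewrite evals_nus.
  by rewrite !H nus_merge.
by rewrite e => /dvw.
Qed.

Lemma p0_nus (v w : asg (dom M) uc) : nus E (part_B v) = nus E (part_B w) -> p0 G u v -> p0 G u w.
Proof.
move=> e [Hp Hm].
have ee d (t : terms b d) : nus E (evals (N := B) t (part_B v)) = nus E (evals (N := B) t (part_B w)).
  have H (z : asg (dom M) uc) : nus E (evals (N := B) t (part_B z)) = fun i => @eval L C b (nus E (part_B z)) _ (t i).
    by rewrite evals_nus.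
  by rewrite !H e.
split=> [pt Hpt|pt Hpt X GX].
  have {}Hp : inC pt (tm pt (tsub (part_B v) (part_B u))) by exact: Hp.
  suff : inC pt (tm pt (tsub (part_B w) (part_B u))) by exact.
  by move: Hp; rewrite !nus_evals_sub ee.
have := Hm pt Hpt X GX; rewrite -[prjs E _]/(nus E (tm pt (part_B v))) ee.
exact.
Qed.

(** Finiteness of the list [tau] is what allows the domain pattern of an A-formula to be written as
    one formula. *)
Lemma A_formula_support (p : A_formula a b D) : exists n (tau : 'I_n -> rho_term b D),
  forall (x x' : asg (dom M) uc) W, (forall i, part_A x i = part_A x' i) ->
  (forall i, rho_at (part_B x) W (tau i) = rho_at (part_B x') W (tau i)) ->
  A_sat_at p x W <-> A_sat_at p x' W.
Proof.
have [n [tau [inj [p' Hp']]]] := formula_arity_right p.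
exists n, tau => x x' W Hx Htau; rewrite /A_sat_at !Hp'; apply: sat_ext => -[[k|k]|k].
- by [].
- exact: Hx.
- exact: Htau.
Qed.

Lemma domain_definable (r : rho_term b D) :
  definable (fun z : asg (dom Meq) (csum ucq (params D)) =>
    ppset C (sval (rt_phi r)) (nus E (tsub (rt_val (part_B (lpart z : asg (dom M) uc)) r) (rt_beta_at (rpart z) r)))).
Proof.
pose d := csum ucq (params D).
have Hd i : @term_fun _ Meq d (sortB (@asort _ (phi_ar (rt_phi r)) i))
    (fun z => (rt_val (part_B (lpart z : asg (dom M) uc)) r i - rt_beta_at (rpart z) r i)%R).
  apply: sub_term_fun.
    apply: (@evals_term_fun d _ (rt_term (r := r) i) (fun v z => z (inl (inl (inr v))))) => k.
    exact: (@term_fun_var _ Meq d (inl (inl (inr k)))).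
  exact: (@term_fun_var _ Meq d (inr (exist _ (B_elt E YA YC (@mkelt _ B _ (rt_beta (r := r) i))) (rt_beta_in i)))).
exact: (definable_comp (c := cmap sortB (phi_ar (rt_phi r))) Hd (C_of_B_definable_eq E YA YC (pp_fm (sval (rt_phi r))))).
Qed.

(** The formula [side] freezes the domain pattern of the rho-terms of [pA]. It is added to the
    A-formula true of [v] and to the C-formula true of [w]; both strengthened formulas stay
    consistent along the sequence, and their realizations now agree on the domains. *)
Lemma merge_nondividing (v w : asg (dom M) uc) x :
  p0 G u v -> p0 G u w -> ~ type_divides G (tp_M D v) -> ~ type_divides G (tp_M D w) ->
  (forall p : A_formula a b D, A_sat p (merge v w x) -> A_sat p v) ->
  ~ type_divides G (tp_M D (merge v w x)).
Proof.
move=> pv pw ndv ndw HA dv.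
have [y [p [yc px nfs]]] := type_divides_witness Dinf Qsat Qhom Gsmall Dsmall dv.
apply: nfs.
have [pA [pC [pAx pCx pAC]]] := isolate_AC HPhi HD H2 px.
have [n [tau Htau]] := A_formula_support pA.
pose indom (i : 'I_n) (z : asg (dom M) uc) (W : asg (dom Meq) (params D)) :=
  ppset C (sval (rt_phi (tau i))) (nus E (tsub (rt_val (part_B z) (tau i)) (rt_beta_at W (tau i)))).
pose side z W := forall i, indom i z W <-> indom i v (@pval _ Meq D).
have side_def : definable (fun z : asg (dom Meq) (csum ucq (params D)) => side (lpart z) (rpart z)).
  apply: definable_all => i; apply: definable_iff; last exact: definable_cst.
  exact: domain_definable.
have [s Hs] := side_def.
(* Here each type must be nondividing: a coset condition met by one tuple is passed on to the other
   by [nondividing_domain], in both directions. *)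
have side_w : side w (@pval _ Meq D).
  move=> i; pose pt : phi_term Phi b := as_pt (tau i).
  split; [apply: (@nondividing_domain w v pt)|apply: (@nondividing_domain v w pt)] => //;
  exact: (@rt_beta_in _ _ _ _ _ _ _ _ _ _ _ _ (tau i)).
have [qA HqA] := A_sat_formula c pA; have [qC HqC] := C_sat_formula a pC.
have fsv := @nondividing_satisfiable _ Meq G ucq D v y (And qA s) ndv yc.
have fsw := @nondividing_satisfiable _ Meq G ucq D w y (And qC s) ndw yc.
(* That [pA] and [pC] imply [p] is a property of the parameters, expressed by a formula, so it
   passes from the enumeration of [D] to its conjugate [y k]. *)
have imp W k : W = y k -> forall z, A_sat_at pA z W -> C_sat_at pC z W -> @sat _ Meq _ p (xsum (z : asg (dom Meq) ucq) W).
  move=> ->.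
  pose R (z : asg (dom Meq) ucq) (W : asg (dom Meq) (params D)) := sat qA (xsum z W) /\ (sat qC (xsum z W) /\ ~ sat p (xsum z W)).
  have RR : definable (fun z : asg (dom Meq) (csum ucq (params D)) => R (lpart z) (rpart z)).
    apply: definable_and; last apply: definable_and.
    - exact: ((definable_parts _).1 (@definable_sat _ Meq _ qA)).
    - exact: ((definable_parts _).1 (@definable_sat _ Meq _ qC)).
    - exact: (definable_not ((definable_parts _).1 (@definable_sat _ Meq _ p))).
  have RD := definable_not (definable_exs (v : asg (dom Meq) ucq) RR).
  have [_ /(_ k) [h [ha hG hy]] _] := yc.
  have : ~ exists z, R z (y k).
    rewrite hy; apply: (automorphism_definable _ ha RD).1 => -[z [z1 [z2 z3]]].
    by apply: z3; apply: pAC; [exact: (HqA z (@pval _ Meq D)).1 z1|exact: (HqC z (@pval _ Meq D)).1 z2].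
  move=> nR z zA zC; apply: contrapT => np; apply: nR; exists z; split; first exact/HqA.
  by split; first exact/HqC.
move=> k g.
have [|vs Hvs] := fsv _ k g.
  split; first exact: ((HqA v (@pval _ Meq D)).2 (HA _ pAx)).
  by apply: (Hs (xsum (v : asg (dom Meq) ucq) (@pval _ Meq D))).2.
have [|ws Hws] := fsw _ k g.
  split; first exact: ((HqC w (@pval _ Meq D)).2 ((C_sat_at_merge v w x pC (@pval _ Meq D)).1 pCx)).
  exact: ((Hs (xsum (w : asg (dom Meq) ucq) (@pval _ Meq D))).2 side_w).
(* One translation serves all the instances at once, since it depends on the two realizations and
   not on the parameters. *)
have [a0 Ha0] := translate_by_A (tsub (part_B (vs : asg (dom M) uc)) (part_B (ws : asg (dom M) uc))).
exists (merge vs ws a0) => j.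
have [/HqA vA /Hs vS] := Hvs j; have [/HqC wC /Hs wS] := Hws j.
apply: (imp _ (g j) erefl); last exact/C_sat_at_merge.
apply/(Htau _ vs) => // i; apply: rho_merge (as_pt (tau i)) _ _ _.
  by have := vS i; have := wS i; rewrite /indom /= => -> ->.
exact: Ha0.
Qed.

Lemma combine_types (v w : asg (dom M) uc) :
  p0 G u v -> p0 G u w -> ~ type_divides G (tp_M D v) -> ~ type_divides G (tp_M D w) ->
  exists z : asg (dom M) uc, [/\ p0 G u z, ~ type_divides G (tp_M D z),
    tp_A D z = tp_A D v & tp_C D z = tp_C D w].
Proof.
move=> pv pw ndv ndw.
have [x Hx] := translate_by_A (tsub (part_B v) (part_B w)).
have HA (p : A_formula a b D) : A_sat p (merge v w x) <-> A_sat p v.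
  rewrite /A_sat; apply: sat_ext => -[[k|k]|r] //=.
  apply: (@rho_merge v w x (as_pt r)); last exact: Hx.
  pose pt : phi_term Phi b := as_pt r.
  split; [apply: (@nondividing_domain v w pt)|apply: (@nondividing_domain w v pt)] => //;
  exact: (@rt_beta_in _ _ _ _ _ _ _ _ _ _ _ _ r).
exists (merge v w x); split.
- by apply: p0_nus pw; rewrite nus_merge.
- by apply: merge_nondividing => // p /HA.
- by apply/seteqP; split=> p /HA.
- by apply/seteqP; split=> p /(C_sat_at_merge v w x p (@pval _ Meq D)).
Qed.

Lemma small_ucq : small D (var ucq).
Proof. by apply: small_sum => //; [apply: small_sum => //|]; apply: small_count. Qed.

(** The set [p0] is given by its realizations and not as formulas, so its invariance is seen through
    an automorphism fixing [D], which fixes the cosets over [G] occurring in its definition. *)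
Lemma p0_type (v w : asg (dom M) uc) :
  @realizes _ Meq D ucq (tp_M D v) w -> p0 G u v -> p0 G u w.
Proof.
move=> Hw [Hp Hm].
have vw : same_type D (v : asg (dom Meq) ucq) w.
  move=> p; split; first exact: Hw.
  by move=> pw; apply: contrapT => /(Hw (Not p)).
have [h [ha hD ew]] := same_type_conjugate Dinf Qhom Dsmall small_ucq vw.
have hc (pt : phi_term Phi b) : c_coset E YA YC (nus E (tm pt (part_B w))) =
    h _ (c_coset E YA YC (nus E (tm pt (part_B v)))).
  have Ht i : @term_fun _ Meq ucq (sortB (asort i))
      (fun z => tm pt (part_B (z : asg (dom M) uc)) i).
    apply: (@evals_term_fun ucq _ (projT2 pt i) (fun v z => z (inl (inr v)))) => k.
    exact: (@term_fun_var _ Meq ucq (inl (inr k))).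
  have [t ht] := coset_term_fun Ht.
  have := automorphism_eval t (v : asg (dom Meq) ucq) ha; rewrite -ew.
  by rewrite (ht v) (ht w).
split=> pt Hpt.
  have Hv : inC pt (tm pt (tsub (part_B v) (part_B u))) := Hp pt Hpt.
  suff : inC pt (tm pt (tsub (part_B w) (part_B u))) by exact.
  move: Hv; rewrite !nus_evals_sub => /c_coset_eq ev; apply/c_coset_eq.
  rewrite (hc pt) ev; exact: (hD _ (HGD Hpt)).
move=> X GX ewX; apply: (Hm pt Hpt X GX).
have [hb _ _] := ha; apply: (bij_inj (hb _)); rewrite (hD _ (HGD GX)).
by rewrite -ewX; apply/esym; apply: hc.
Qed.

Lemma complete_type_tp (q : set (@formula_over _ Meq D ucq)) : complete_type q ->
  exists v : asg (dom M) uc, q = tp_M D v.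
Proof.
move=> [qc qt].
have [||v Hv] := @Qsat ucq (params D) (@pval _ Meq D) small_ucq Dsmall {p | q p}
  (fun p x w => @sat _ Meq _ (sval p) (xsum x w)).
- move=> p; exact: ((definable_parts _).1 (@definable_sat _ Meq _ (sval p))).
- exact: qc.
exists v; apply/seteqP; split=> p Hp; first exact: (Hv (exist _ p Hp)).
by have [//|np] := qt p; case: (Hv (exist _ _ np)).
Qed.

Lemma tp_complete (v : asg (dom M) uc) : complete_type (tp_M D v).
Proof.
split=> [k g|p]; first by exists v => j; exact: (svalP (g j)).
by have [h|h] := pselect (@sat_over _ Meq D ucq p v); [left|right].
Qed.

Lemma tp_AC (v w : asg (dom M) uc) :
  tp_M D v = tp_M D w <-> tp_A D v = tp_A D w /\ tp_C D v = tp_C D w.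
Proof.
split=> [e|[eA eC]].
  split; apply/seteqP; split=> p Hp.
  - have [q Hq] := A_sat_formula c p; have : tp_M D v q := (Hq v (@pval _ _ D)).2 Hp.
    by rewrite e => /(Hq w (@pval _ _ D)).
  - have [q Hq] := A_sat_formula c p; have : tp_M D w q := (Hq w (@pval _ _ D)).2 Hp.
    by rewrite -e => /(Hq v (@pval _ _ D)).
  - have [q Hq] := C_sat_formula a p; have : tp_M D v q := (Hq v (@pval _ _ D)).2 Hp.
    by rewrite e => /(Hq w (@pval _ _ D)).
  - have [q Hq] := C_sat_formula a p; have : tp_M D w q := (Hq w (@pval _ _ D)).2 Hp.
    by rewrite -e => /(Hq v (@pval _ _ D)).
suff H (v' w' : asg (dom M) uc) : tp_A D v' = tp_A D w' -> tp_C D v' = tp_C D w' ->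
    tp_M D v' `<=` tp_M D w'.
  by apply/seteqP; split; apply: H.
move=> {}eA {}eC p pv; have [pA [pC [HA HC Himp]]] := isolate_AC HPhi HD H2 pv.
apply: Himp; first by have : tp_A D v' pA by []; rewrite eA.
by have : tp_C D v' pC by []; rewrite eC.
Qed.

Lemma nondividing_homeomorphism :
  exists f : type_space (nondividing_types G D u) ->
             type_space (nondividing_A_types G D u) *
             type_space (nondividing_C_types G D u),
    homeomorphism f /\
    forall (q : type_space (nondividing_types G D u)) (v : asg (dom M) uc),
      sval q = tp_M D v ->
      sval (f q).1 = tp_A D v /\ sval (f q).2 = tp_C D v.
Proof.
have Hq (q : type_space (nondividing_types G D u)) : exists v : asg (dom M) uc,
    [/\ sval q = tp_M D v, p0 G u v & ~ type_divides G (tp_M D v)].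
  have [qc qp qd] := svalP q; have [v e] := complete_type_tp qc.
  exists v; rewrite -e; split=> //; apply: qp; rewrite e => p; exact.
have [V HV] := dep_choice Hq.
have mkA q : nondividing_A_types G D u (tp_A D (V q)).
  by have [_ h1 h2] := HV q; exists (V q).
have mkC q : nondividing_C_types G D u (tp_C D (V q)).
  by have [_ h1 h2] := HV q; exists (V q).
pose f q : type_space (nondividing_A_types G D u) * type_space (nondividing_C_types G D u) :=
  (exist _ _ (mkA q), exist _ _ (mkC q)).
(* By [tp_AC] the image does not depend on the realization chosen by [V]. *)
have fE q (v : asg (dom M) uc) : sval q = tp_M D v -> sval (f q).1 = tp_A D v /\ sval (f q).2 = tp_C D v.
  by have [e _ _] := HV q; rewrite e /= => /tp_AC.
have Hy (y : type_space (nondividing_A_types G D u) * type_space (nondividing_C_types G D u)) :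
    exists z : asg (dom M) uc, [/\ p0 G u z, ~ type_divides G (tp_M D z),
      sval y.1 = tp_A D z & sval y.2 = tp_C D z].
  have [v [pv nv ev]] := svalP y.1; have [w [pw nw ew]] := svalP y.2.
  have [z [pz nz eA eC]] := combine_types pv pw nv nw.
  by exists z; split=> //; rewrite ?eA ?eC.
have [Z HZ] := dep_choice Hy.
have mkM y : nondividing_types G D u (tp_M D (Z y)).
  have [pz nz _ _] := HZ y; split=> //; first exact: tp_complete.
  by move=> w Hw; apply: p0_type Hw pz.
pose g y : type_space (nondividing_types G D u) := exist _ _ (mkM y).
exists f; split=> //; split.
  have cA : continuous (fun q => (f q).1).
    apply: type_space_continuous => p.
    have [r Hr] := A_sat_formula c p.
    have -> : [set q | sval (f q).1 p] = [set q | sval q r].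
      apply/seteqP; split=> q /=; have [e _ _] := HV q; rewrite e => h.
        exact/(Hr (V q) (@pval _ _ D)).
      exact/(Hr (V q) (@pval _ _ D)).
    exact: type_space_open.
  have cC : continuous (fun q => (f q).2).
    apply: type_space_continuous => p.
    have [r Hr] := C_sat_formula a p.
    have -> : [set q | sval (f q).2 p] = [set q | sval q r].
      apply/seteqP; split=> q /=; have [e _ _] := HV q; rewrite e => h.
        exact/(Hr (V q) (@pval _ _ D)).
      exact/(Hr (V q) (@pval _ _ D)).
    exact: type_space_open.
  by move=> q; exact: cvg_pair (cA q) (cC q).
exists g; split.
(* A formula in the type of [Z y] is implied by an A-formula and a C-formula true there, and these
   cut out a product neighbourhood of [y]. *)
- apply: type_space_continuous => p; rewrite openE => y yp; rewrite /interior.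
  have [_ _ eA eC] := HZ y.
  have [pA [pC [HA HC Himp]]] := isolate_AC HPhi HD H2 yp.
  have NA : nbhs y [set y' | sval y'.1 pA].
    have H : nbhs y.1 [set q | sval q pA].
      by apply: open_nbhs_nbhs; split; [exact: type_space_open | rewrite /= eA].
    exact: (@cvg_fst _ _ (nbhs y.1) (nbhs y.2) _ _ H).
  have NC : nbhs y [set y' | sval y'.2 pC].
    have H : nbhs y.2 [set q | sval q pC].
      by apply: open_nbhs_nbhs; split; [exact: type_space_open | rewrite /= eC].
    exact: (@cvg_snd _ _ (nbhs y.1) (nbhs y.2) _ _ H).
  apply: filterS (filterI NA NC) => y' [/= h1 h2].
  have [_ _ eA' eC'] := HZ y'.
  by apply: Himp; [move: h1; rewrite eA'|move: h2; rewrite eC'].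
- move=> q; apply: type_space_inj; have [e _ _] := HV q; rewrite e.
  apply/tp_AC; have [_ _ <- <-] := HZ (f q); by [].
- move=> y; have [_ _ eA eC] := HZ y.
  have [e1 e2] := fE (g y) (Z y) erefl.
  rewrite [LHS]surjective_pairing [RHS]surjective_pairing.
  by congr pair; apply: type_space_inj; rewrite ?e1 ?e2 ?eA ?eC.
Qed.
End Main.

Theorem corollary5p3p5
  (L0 : language) (Phi : set (ppf (ab_lang L0))) (A B C : ab_str L0)
  (E : pure_ses Phi A B C)
  (XA : expansion (quot_lang Phi)) (YA : exp_str (quot_ab Phi A) XA)
  (XC : expansion (ab_lang L0)) (YC : exp_str C XC)
  (HPhi : fundamental_system Phi B)
  (G D : set (elt (Meq E YA YC)))
  (HGD : G `<=` D) (HG : G = dcl G) (HD : D = dcl D)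
  (Hsat : saturated_above (M E YA YC) D)
  (Hhom : strongly_homogeneous_above (M E YA YC) D)
  (a : arity (srt (LA XA))) (b : arity (srt (ab_lang L0))) (c : arity (srt (LC XC)))
  (u : asg (dom (M E YA YC)) (uctx a b c))
  (H1 : forall p : ppf (ab_lang L0), Phi p ->
     forall X : dom (Meq E YA YC) (cquot_sort E YA YC p), 
       acl G (@mkelt _ (Meq E YA YC) _ X) -> G (@mkelt _ (Meq E YA YC) _ X))
  (H2 : D = dcl (home D)) :
  exists f : type_space (nondividing_types G D u) ->
             type_space (nondividing_A_types G D u) *
             type_space (nondividing_C_types G D u),
    homeomorphism f /\
    forall (q : type_space (nondividing_types G D u))
           (v : asg (dom (M E YA YC)) (uctx a b c)),
      sval q = tp_M D v ->
      sval (f q).1 = tp_A D v /\ sval (f q).2 = tp_C D v.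
Proof. exact: nondividing_homeomorphism. Qed.
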